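(* Suppose that $F:\mathcal K\to L^2(\Omega)$ is pointwise linearly bounded and uniformly continuous. Then for every $(\bar X,\bar V)\in\mathcal K\times L^2(\Omega)$ there exists a Lagrangian solution with initial data $(\bar X,\bar V)$. Moreover, for any $T\ge0$ there exists a constant $C_T\ge0$ such that any Lagrangian solution $X$ with initial data $(\bar X,\bar V)\in\mathcal K\times L^2(\Omega)$ and velocity $V:=\frac{d^+}{dt}X$ satisfies $$\|X(t)\|_{L^2(\Omega)}+\|V(t)\|_{L^2(\Omega)}\le C_T\Big(1+\|\bar X\|_{L^2(\Omega)}+\|\bar V\|_{L^2(\Omega)}\Big)\quad\text{for all }t\in[0,T].$$ If $\psi:\mathbb R\to[0,\infty)$ is even, convex, of class $C^1(\mathbb R)$, with $\psi(0)=0$, and if for some $q\ge1$ one has $\psi(\lambda r)\le\lambda^q\psi(r)$ for all $r\in\mathbb R$, $\lambda\ge1$, then there exists a constant $C_{q,T}\ge0$ such that any such Lagrangian solution satisfies $$\Psi[X(t)]+\Psi[V(t)]\le C_{q,T}\Big(1+\Psi[\bar X]+\Psi[\bar V]\Big)\quad\text{for all }t\in[0,T],$$ where $\Psi[U]:=\int_\Omega\psi(U(m))\,dm\in[0,\infty]$.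
   Context: $\Omega=(0,1)$. $\mathcal K\subset L^2(\Omega)$ is the closed convex cone of nondecreasing functions. For $X\in\mathcal K$, $\partial I_{\mathcal K}(X)=\{W\in L^2(\Omega):\int_\Omega W(\tilde X-X)\,dm\le0\ \forall\tilde X\in\mathcal K\}$. $F$ is pointwise linearly bounded if there is $C_{\mathsf p}\ge0$ such that $|F[X](m)|\le C_{\mathsf p}(1+|X(m)|+\|X\|_{L^1(\Omega)})$ for a.e. $m\in\Omega$ and all $X\in\mathcal K$. $F$ is uniformly continuous if there is $C\ge0$ with $\|F[X]\|_{L^2(\Omega)}\le C(1+\|X\|_{L^2(\Omega)})$ for all $X\in\mathcal K$ and a modulus of continuity $\omega$ (concave continuous $\omega:[0,\infty)\to[0,\infty)$ with $0=\omega(0)<\omega(r)$ for $r>0$) with $\|F[X_1]-F[X_2]\|_{L^2(\Omega)}\le\omega(\|X_1-X_2\|_{L^2(\Omega)})$ for all $X_1,X_2\in\mathcal K$. A Lagrangian solution with initial data $(\bar X,\bar V)$ is a curve $X\in\mathrm{Lip}_{\rm loc}([0,\infty);\mathcal K)$ with $X(0)=\bar X$ and $\dot X(t)+\partial I_{\mathcal K}(X(t))\ni\bar V+\int_0^tF[X(s)]\,ds$ for a.e. $t>0$. Every Lagrangian solution has a right derivative $V(t)=\frac{d^+}{dt}X(t)$ in $L^2(\Omega)$ at every $t\ge0$. *)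

(* Defs.v *)
From HB Require Import structures.
From mathcomp Require Export all_boot all_order all_algebra.
From mathcomp Require Export all_classical all_reals all_analysis.
Export Order.TTheory GRing.Theory Num.Theory.
Export numFieldNormedType.Exports.

Set Implicit Arguments.
Unset Strict Implicit.
Unset Printing Implicit Defensive.

#[global] Open Scope classical_set_scope.
#[global] Open Scope ring_scope.

Definition Omega (R : realType) : set (measurableTypeR R) := `]0, 1[.

Lemma measurable_Omega (R : realType) : measurable (@Omega R).
Proof. exact: measurable_itv. Qed.

Definition leb_Omega (R : realType) : {measure set (measurableTypeR R) -> \bar R} :=
  mrestr lebesgue_measure (@measurable_Omega R).

(* [LfunType] consists of functions, not of classes modulo equality a.e.:
   [L2norm] is only a seminorm, and identities in the space L^2(0,1) are
   stated almost everywhere or through [L2norm]. *)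
Notation L2 R := (LfunType (leb_Omega R) (lee1n 2)).

Section L2Omega.
Variable R : realType.
Implicit Types U W : L2 R.

Definition L2norm U : R := fine 'N[leb_Omega R]_2%:E[EFin \o U]%E.

Definition L1norm U : R := fine 'N[leb_Omega R]_1[EFin \o U]%E.

Definition L2inner U W : R := (\int[leb_Omega R]_m (U m * W m))%R.

End L2Omega.

Section Cone.
Variable R : realType.

Definition monotone_cone : set (L2 R) :=
  [set X | exists2 Y : R -> R,
     {in @Omega R &, {homo Y : x y / x <= y}} &
     \forall m \ae leb_Omega R, X m = Y m].

Definition subdiff_cone (X : L2 R) : set (L2 R) :=
  [set W | forall X', monotone_cone X' -> L2inner W (X' - X) <= 0].

End Cone.

(* The force is a map on the cone: every notion below evaluates [F] only at
   elements of [monotone_cone]. *)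
Section Force.
Variables (R : realType) (F : L2 R -> L2 R).

Definition pointwise_linearly_bounded : Prop :=
  exists2 C : R, 0 <= C & forall X, monotone_cone X ->
    \forall m \ae leb_Omega R, `|F X m| <= C * (1 + `|X m| + L1norm X).

Definition modulus_of_continuity (w : R -> R) : Prop :=
  [/\ forall r, 0 <= r -> 0 <= w r,
      convex_function (E := R^o) `[0, +oo[ (\- w),
      {within `[0, +oo[, continuous w},
      w 0 = 0 &
      forall r, 0 < r -> 0 < w r].

Definition uniformly_continuous_force : Prop :=
  (exists2 C : R, 0 <= C & forall X, monotone_cone X ->
     L2norm (F X) <= C * (1 + L2norm X)) /\
  (exists2 w : R -> R, modulus_of_continuity w &
     forall X1 X2, monotone_cone X1 -> monotone_cone X2 ->
       L2norm (F X1 - F X2) <= w (L2norm (X1 - X2))).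

End Force.

Section Bochner.
Variable R : realType.

(* A finite list of pairs (A, c) encodes the simple function sum_(A, c) 1_A c. *)
Definition simple_L2 := seq (set (measurableTypeR R) * L2 R).

Definition simple_eval (s : simple_L2) (t : R) : L2 R :=
  \sum_(p <- s) \1_(p.1) t *: p.2.

Definition simple_integral (D : set (measurableTypeR R)) (s : simple_L2) : L2 R :=
  \sum_(p <- s) fine (lebesgue_measure (p.1 `&` D)) *: p.2.

(* [I] is a Bochner integral of [f] over [D], a set of finite measure. *)
Definition is_bochner_integral (D : set (measurableTypeR R))
    (f : R -> L2 R) (I : L2 R) : Prop :=
  exists s : nat -> simple_L2,
  [/\ forall k, {in map fst (s k), forall A, measurable A},
      {ae lebesgue_measure, forall t : measurableTypeR R, D t ->
         L2norm (f t - simple_eval (s k) t) @[k --> \oo] --> (0 : R)},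
      (\int[lebesgue_measure]_(t in D)
         (L2norm (f t - simple_eval (s k) t))%:E)%E @[k --> \oo] --> 0%E &
      L2norm (I - simple_integral D (s k)) @[k --> \oo] --> (0 : R)].

End Bochner.

Section Lagrangian.
Variable R : realType.
Implicit Types X : R -> L2 R.

Definition loc_lipschitz X : Prop :=
  forall T : R, 0 <= T -> exists L : R, forall s t : R,
    0 <= s <= T -> 0 <= t <= T -> L2norm (X t - X s) <= L * `|t - s|.

Definition is_L2_derivative X (t : R) (D : L2 R) : Prop :=
  L2norm (h^-1 *: (X (t + h) - X t) - D) @[h --> 0^'] --> (0 : R).

Definition is_L2_right_derivative X (t : R) (D : L2 R) : Prop :=
  L2norm (h^-1 *: (X (t + h) - X t) - D) @[h --> 0^'+] --> (0 : R).

Definition lagrangian_solution (F : L2 R -> L2 R) (Xbar Vbar : L2 R) X : Prop :=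
  [/\ forall t, 0 <= t -> monotone_cone (X t),
      loc_lipschitz X,
      \forall m \ae leb_Omega R, X 0 m = Xbar m &
      {ae lebesgue_measure, forall t : measurableTypeR R, 0 < (t : R) ->
        exists X' I : L2 R,
        [/\ is_L2_derivative X t X',
            is_bochner_integral `[0, (t : R)] (F \o X) I &
            subdiff_cone (X t) (Vbar + I - X')]}].

Definition is_velocity X (V : R -> L2 R) : Prop :=
  forall t, 0 <= t -> is_L2_right_derivative X t (V t).

End Lagrangian.

Definition admissible_energy (R : realType) (psi : R -> R) : Prop :=
  [/\ forall r, 0 <= psi r,
      forall r, psi (- r) = psi r,
      convex_function (E := R^o) setT psi,
      (forall r, derivable psi r 1) /\ continuous (derive1 psi) &
      psi 0 = 0].

Definition Psi (R : realType) (psi : R -> R) (U : L2 R) : \bar R :=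
  (\int[leb_Omega R]_m (psi (U m))%:E)%E.

(* Main.v *)
Require Import Defs.
From mathcomp Require Import measurable_realfun ring lra.

(** The inclusion [X' + dI_K(X) ∋ G], with [G(t) = Vbar + \int_0^t F(X)], is the
    gradient flow of the indicator of a convex cone, driven by a forcing [G] that is
    Lipschitz in time. Where the cone of monotone functions does not matter, the
    arguments run in a module with a positive semidefinite form.

    Velocity. A solution is characterized by the inequality [evi],
    [d/dt |X - Z|^2 <= 2 <G, X - Z>] for all [Z] in [K]. Testing it with points [Z]
    that lie on a feasible half-line from [X(t)] shows that [X] has at every time a
    right derivative [V(t)], the projection of [G(t)] on the tangent cone
    ([right_derivative]); in particular [<G - V, V> = 0]. Monotonicity of the normal
    cone makes [c t - |V(t)|^2] nondecreasing, hence continuous off a countable set,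
    and where the speed is continuous the derivative is two-sided
    ([ae_two_sided]). Together with the uniqueness of Bochner integrals of continuous
    curves this makes [evi] equivalent to being a Lagrangian solution
    ([lagrangian_flow], [flow_lagrangian]).

    Existence. Consider [x' = P_K (x + tau g)], [g' = g + tau F(x)]. As [F] is merely
    continuous, a limit of this scheme has to come from compactness, and the cone
    provides it: monotone functions with uniformly small tails form a precompact
    subset of [L^2] ([ultra_cauchy_tails]). The tails are controlled because
    the projection on [K] does not increase the norm of a soft thresholding
    ([tail_projection]), and the pointwise bound on [F] transports it from [X] to
    [F(X)] ([euler_uniform_tails]). Passing to the limit along one ultrafilter
    treats all times at once, and [evi] survives ([euler_limit]).

    Estimates. Let [Phi(U)] be the integral of [phi(U)], with [phi] convex and
    [phi'] Lipschitz. Then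
    [d/dt Phi(X) = <phi'(X), V> <= Phi(X + V) - Phi(X)], which the growth
    hypothesis on [phi] bounds by [c (Phi(X) + Phi(V))], and likewise for [G], whose
    derivative is [F(X)]. Moreover [Phi(V) <= Phi(G)], because [X + eta(Y - X)] is
    monotone whenever [X] and [Y] are and [eta] is a nondecreasing contraction
    ([cone_perturb], [energy_velocity]), and [Phi(F(X)) <= c (1 + Phi(X))] by
    Jensen's inequality. Gronwall's lemma applies to [Phi(X) + Phi(G)]
    ([energy_flow]). The case [phi r = r^2] is the bound in [L^2]. A general [psi] is
    the limit of its Moreau regularizations, for which the constants are uniform, and
    Fatou's lemma concludes ([Psi_of_moreau]). *)

Set Implicit Arguments.
Unset Strict Implicit.
Unset Printing Implicit Defensive.

(** * Linear identities between vectors *)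

(** Linear identities between vectors of a module are decided coordinatewise:
    [vexp] is a linear combination written with formal vectors, and two of them
    have the same value as soon as the coefficients of every vector agree. *)
Inductive vexp (R : Type) :=
  | VX of nat | V0 | VD of vexp R & vexp R | VN of vexp R | VS of R & vexp R.

Section LinearCombinations.
Variables (R : realType) (H : lmodType R).

Fixpoint veval (xs : seq H) (e : vexp R) : H :=
  match e with
  | VX i => xs`_i
  | V0 => 0
  | VD e1 e2 => veval xs e1 + veval xs e2
  | VN e1 => - veval xs e1
  | VS a e1 => a *: veval xs e1
  end.

Fixpoint vcoef (e : vexp R) (i : nat) : R :=
  match e with
  | VX j => if eqn i j then 1 else 0
  | V0 => 0
  | VD e1 e2 => vcoef e1 i + vcoef e2 i
  | VN e1 => - vcoef e1 i
  | VS a e1 => a * vcoef e1 i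
  end.

Lemma vevalE xs e :
  veval xs e = \sum_(i < size xs) vcoef e i *: xs`_i.
Proof.
elim: e => [j||e1 IH1 e2 IH2|e1 IH1|a e1 IH1] /=.
- have [js|sj] := ltnP j (size xs).
    rewrite (bigD1 (Ordinal js))//= eqnE eqxx scale1r big1 ?addr0// => i ij.
    by rewrite ifF ?scale0r//; apply: contraNF ij => /eqP ij; apply/eqP/val_inj.
  rewrite nth_default// big1// => i _; rewrite eqnE ifF ?scale0r//.
  by apply/negbTE; rewrite neq_ltn (leq_trans (ltn_ord i)).
- by rewrite big1// => i _; rewrite scale0r.
- by rewrite IH1 IH2 -big_split; apply: eq_bigr => i _; rewrite scalerDl.
- by rewrite IH1 -sumrN; apply: eq_bigr => i _; rewrite scaleNr.
- by rewrite IH1 scaler_sumr; apply: eq_bigr => i _; rewrite scalerA.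
Qed.

Fixpoint vcoef_eq (n : nat) (e1 e2 : vexp R) : Prop :=
  if n is n'.+1 then vcoef e1 n' = vcoef e2 n' /\ vcoef_eq n' e1 e2 else True.

Lemma veval_eq xs e1 e2 : vcoef_eq (size xs) e1 e2 ->
  veval xs e1 = veval xs e2.
Proof.
move=> h; rewrite !vevalE; apply: eq_bigr => -[i /= ilt] _; congr (_ *: _).
elim: (size xs) ilt h => //= n IH; rewrite ltnS leq_eqVlt => /predU1P[->|ilt].
  by case.
by move=> [_] /(IH ilt).
Qed.

End LinearCombinations.

Ltac vec_index x xs :=
  lazymatch xs with
  | cons x _ => constr:(0%N)
  | cons _ ?t => let n := vec_index x t in constr:(S n)
  end.

Ltac vec_mem x xs :=
  lazymatch xs with
  | nil => constr:(false)
  | cons x _ => constr:(true)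
  | cons _ ?t => vec_mem x t
  end.

Ltac vec_atoms e xs :=
  lazymatch e with
  | 0 => xs
  | ?a + ?b => let ys := vec_atoms a xs in vec_atoms b ys
  | - ?a => vec_atoms a xs
  | _ *: ?a => vec_atoms a xs
  | _ => lazymatch vec_mem e xs with
         | true => xs
         | false => constr:(@cons _ e xs)
         end
  end.

Ltac vec_reify R e xs :=
  lazymatch e with
  | 0 => constr:(@V0 R)
  | ?a + ?b => let ea := vec_reify R a xs in let eb := vec_reify R b xs in
               constr:(@VD R ea eb)
  | - ?a => let ea := vec_reify R a xs in constr:(@VN R ea)
  | ?k *: ?a => let ea := vec_reify R a xs in constr:(@VS R k ea)
  | _ => let n := vec_index e xs in constr:(@VX R n)
  end.

Ltac vec_ring R H :=
  lazymatch goal with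
  | |- @eq _ ?u ?v =>
    let K := constr:(Real.sort R) in
    let xs := vec_atoms u (@nil (GRing.Lmodule.sort H)) in
    let xs := vec_atoms v xs in
    let eu := vec_reify K u xs in
    let ev := vec_reify K v xs in
    refine (@veval_eq R H xs eu ev _)
  end.

Ltac vec R H := vec_ring R H; cbn [size vcoef_eq vcoef eqn]; repeat split; try ring.

(** * Positive semidefinite forms and projections *)

(** Semidefinite only: the elements of [L2 R] are functions, so a vector of
    norm zero need not vanish. *)
Record semi_inner (R : realType) (H : lmodType R) := SemiInner {
  inner :> H -> H -> R;
  innerC : forall x y, inner x y = inner y x;
  innerDl : forall x y z, inner (x + y) z = inner x z + inner y z;
  innerZl : forall a x y, inner (a *: x) y = a * inner x y;
  inner_ge0 : forall x, 0 <= inner x x }.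

Section SemiHilbert.
Variables (R : realType) (H : lmodType R) (ip : semi_inner H).
Implicit Types (x y z : H) (a b e : R).

Definition snorm x : R := Num.sqrt (ip x x).
Local Notation N := snorm.

Lemma innerDr x y z : ip x (y + z) = ip x y + ip x z.
Proof. by rewrite innerC innerDl !(innerC _ x). Qed.

Lemma innerZr a x y : ip x (a *: y) = a * ip x y.
Proof. by rewrite innerC innerZl innerC. Qed.

Lemma innerNl x y : ip (- x) y = - ip x y.
Proof. by rewrite -scaleN1r innerZl mulN1r. Qed.

Lemma innerNr x y : ip x (- y) = - ip x y.
Proof. by rewrite innerC innerNl innerC. Qed.

Lemma inner0l x : ip 0 x = 0.
Proof. by rewrite -(scale0r 0) innerZl mul0r. Qed.

Definition innerE := (innerDl, innerDr, innerNl, innerNr, innerZl, innerZr).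

Lemma snorm_ge0 x : 0 <= N x.
Proof. exact: sqrtr_ge0. Qed.

Lemma sqr_snorm x : N x ^+ 2 = ip x x.
Proof. by rewrite sqr_sqrtr ?inner_ge0. Qed.

Lemma snorm0 : N 0 = 0.
Proof. by rewrite /snorm inner0l sqrtr0. Qed.

Lemma snormN x : N (- x) = N x.
Proof. by rewrite /snorm innerNl innerNr opprK. Qed.

Lemma snormB x y : N (x - y) = N (y - x).
Proof. by rewrite -snormN opprB. Qed.

Lemma snormZ a x : N (a *: x) = `|a| * N x.
Proof.
by rewrite /snorm innerZl innerZr mulrA -expr2 sqrtrM ?sqr_ge0// sqrtr_sqr.
Qed.

Lemma snorm_le x a : 0 <= a -> ip x x <= a ^+ 2 -> N x <= a.
Proof.
move=> a0 xa; rewrite -(@ler_pXn2r _ 2)// ?nnegrE ?snorm_ge0//.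
by rewrite sqr_snorm.
Qed.

(** The form may be degenerate, and a null vector [u] has to be treated apart:
    it satisfies [<u, v> <= 0], as [|k u - v|^2] would become negative for large [k]. *)
Lemma cauchy_schwarz x y : ip x y <= N x * N y.
Proof.
have N_eq0 u v : ip u u = 0 -> ip u v <= 0.
  move=> u0; rewrite leNgt; apply/negP => uv0.
  have := inner_ge0 ip (((ip v v + 1) / (2 * ip u v)) *: u - v).
  rewrite !innerE u0 (innerC _ v u); set w := ip u v.
  set k := _ / _.
  have kw : k * w = (ip v v + 1) / 2 by rewrite /k; field; rewrite gt_eqF.
  lra.
have [x0|x0] := eqVneq (ip x x) 0.
  by rewrite (le_trans (N_eq0 _ _ x0))// mulr_ge0// snorm_ge0.
have [y0|y0] := eqVneq (ip y y) 0.
  by rewrite innerC (le_trans (N_eq0 _ _ y0))// mulr_ge0// snorm_ge0.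
have Nx : 0 < N x by rewrite sqrtr_gt0 lt_def x0 inner_ge0.
have Ny : 0 < N y by rewrite sqrtr_gt0 lt_def y0 inner_ge0.
have := inner_ge0 ip (N y *: x - N x *: y).
rewrite !innerE (innerC _ y x) -!sqr_snorm.
set a := N x in Nx *; set b := N y in Ny *; set w := ip x y => h.
have : 0 <= (2 * a * b) * (a * b - w) by apply: le_trans h _; rewrite le_eqVlt; apply/orP; left; apply/eqP; ring.
by rewrite pmulr_rge0 ?subr_ge0// !mulr_gt0.
Qed.

Lemma normr_inner_le x y : `|ip x y| <= N x * N y.
Proof.
rewrite ler_norml cauchy_schwarz andbT lerNl -innerNl -(snormN x).
exact: cauchy_schwarz.
Qed.

Lemma snormD x y : N (x + y) <= N x + N y.
Proof.
apply: snorm_le; first by rewrite addr_ge0// snorm_ge0.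
rewrite !innerE (innerC _ y x) sqrrD !sqr_snorm.
have := cauchy_schwarz x y; lra.
Qed.

Lemma snorm_triangle y x z : N (x - z) <= N (x - y) + N (y - z).
Proof. by rewrite (le_trans _ (snormD _ _))// addrA subrK. Qed.

Lemma snorm_sum I (r : seq I) (P : pred I) (f : I -> H) :
  N (\sum_(i <- r | P i) f i) <= \sum_(i <- r | P i) N (f i).
Proof.
elim/big_ind2 : _ => [|x a y b xa yb|i _]; rewrite ?snorm0//.
by rewrite (le_trans (snormD _ _))// lerD.
Qed.

Definition scauchy (u : nat -> H) := forall e, 0 < e ->
  exists n, forall i j, (n <= i)%N -> (n <= j)%N -> N (u i - u j) <= e.

Definition slim (u : nat -> H) x := forall e, 0 < e ->
  exists n, forall i, (n <= i)%N -> N (u i - x) <= e.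

Definition scomplete := forall u, scauchy u -> exists x, slim u x.

Definition sconvex (K : set H) := forall x y a,
  K x -> K y -> 0 <= a <= 1 -> K (a *: x + (1 - a) *: y).

Definition sclosure (K : set H) : set H :=
  [set x | forall e, 0 < e -> exists2 y, K y & N (y - x) <= e].

Lemma parallelogram x y :
  ip (x + y) (x + y) + ip (x - y) (x - y) = 2 * (ip x x + ip y y).
Proof. by rewrite !innerE (innerC _ y x); ring. Qed.

Lemma slim_closure (K : set H) u x : (forall n, K (u n)) -> slim u x ->
  sclosure K x.
Proof. by move=> Ku ux e /ux[n] /(_ _ (leqnn n)) uxn; exists (u n). Qed.

Lemma eps_ler a b : (forall e, 0 < e -> a <= b + e) -> a <= b.
Proof. by move=> h; apply/ler_addgt0Pl => e /h; rewrite addrC. Qed.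

Lemma le_inner_closure (K : set H) w c : (forall y, K y -> ip w y <= c) ->
  forall y, sclosure K y -> ip w y <= c.
Proof.
move=> Kw y Ky; apply: eps_ler => e e0.
have w0 : 0 < N w + 1 by rewrite ltr_wpDl// snorm_ge0.
have [z Kz zy] := Ky (e / (N w + 1)) (divr_gt0 e0 w0).
rewrite -(subrK z y) innerDr addrC lerD ?Kw//.
rewrite (le_trans (cauchy_schwarz _ _))// snormB.
rewrite (le_trans (y := (N w + 1) * (e / (N w + 1))))//.
  by rewrite ler_pM ?snorm_ge0// lerDl.
by rewrite mulrC divfK// gt_eqF.
Qed.

(** A minimizing sequence of the distance to [g] is Cauchy by the parallelogram
    identity, because midpoints stay in [K]. Its limit lies in the closure of [K] only;
    the cone of feasible directions at a point, to which this applies, is seldom closed. *)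
Lemma projection_closure (K : set H) g : scomplete -> sconvex K -> K !=set0 ->
  exists2 p, sclosure K p & forall y, K y -> ip (g - p) (y - p) <= 0.
Proof.
move=> cH cK [k0 Kk0].
pose S := [set ip (g - y) (g - y) | y in K].
have S0 : has_inf S.
  split; first by exists (ip (g - k0) (g - k0)), k0.
  by exists 0 => _ [y _ <-]; exact: inner_ge0.
pose d := inf S.
have dle y : K y -> d <= ip (g - y) (g - y).
  by move=> Ky; apply: ge_inf; [exact: S0.2|exists y].
have ex n : exists y, K y /\ ip (g - y) (g - y) <= d + n.+1%:R^-1.
  have n0 : 0 < n.+1%:R^-1 :> R by rewrite invr_gt0.
  have [_ [y Ky <-] yd] := inf_adherent n0 S0.
  by exists y; split => //; exact: ltW.
have [u uP] := choice ex.
(* Near minimizers are close to each other, as their midpoint is no better than [d]. *)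
have close i j : ip (u i - u j) (u i - u j) <= 2 * (i.+1%:R^-1 + j.+1%:R^-1).
  have [[Ki di] [Kj dj]] := (uP i, uP j).
  have := parallelogram (g - u i) (g - u j).
  have -> : g - u i - (g - u j) = - (u i - u j) by vec R H.
  have -> : g - u i + (g - u j) =
      2 *: (g - (2^-1 *: u i + (1 - 2^-1) *: u j)).
    by vec R H; field.
  rewrite (innerNl (u i - u j)) (innerNr _ (u i - u j)) innerZl innerZr.
  have h01 : 0 <= (2^-1 : R) <= 1 by apply/andP; split; lra.
  move=> par; have := dle _ (cK _ _ _ Ki Kj h01).
  move: par; set q := ip (g - (_ + _)) _; set r := ip (u i - u j) _ => par dq.
  by move: di dj; move: (i.+1%:R^-1) (j.+1%:R^-1) => a b di dj; lra.
have uC : scauchy u.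
  move=> e e0; have e20 : 0 < e ^+ 2 / 4 by rewrite divr_gt0// exprn_gt0.
  have [n _ nP] := near_infty_natSinv_lt (PosNum e20).
  exists n => i j ni nj; apply: snorm_le; first exact: ltW.
  rewrite (le_trans (close i j))//.
  have := nP _ ni; have := nP _ nj; rewrite /=.
  by move: (i.+1%:R^-1) (j.+1%:R^-1) => a b ha hb; lra.
have [p up] := cH u uC.
exists p; first by apply: slim_closure up => n; case: (uP n).
have dp : ip (g - p) (g - p) <= d.
  have Ngp : N (g - p) <= Num.sqrt d.
    apply: eps_ler => e e0.
    have e2 : 0 < e / 2 by rewrite divr_gt0.
    have [n1 n1P] := up _ e2.
    have e20 : 0 < e ^+ 2 / 4 by rewrite divr_gt0// exprn_gt0.
    have [n2 _ n2P] := near_infty_natSinv_lt (PosNum e20).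
    pose n := maxn n1 n2.
    rewrite (le_trans (snorm_triangle (u n) _ _))//.
    have := n1P n (leq_maxl _ _); have := n2P n (leq_maxr _ _) => /= h1 h2.
    have d0 : 0 <= d by apply: lb_le_inf S0.1 _ => _ [y _ <-]; exact: inner_ge0.
    suff : N (g - u n) <= Num.sqrt d + e / 2 by move=> hs; lra.
    apply: snorm_le; first by rewrite addr_ge0 ?sqrtr_ge0//; lra.
    rewrite (le_trans (uP n).2)// sqrrD sqr_sqrtr//.
    move: h1; move: (n.+1%:R^-1) => a h1.
    have s0 := sqrtr_ge0 d; have : 0 <= Num.sqrt d * (e / 2) by rewrite mulr_ge0//; lra.
    have -> : (e / 2) ^+ 2 = e ^+ 2 / 4 by field.
    by move=> sd; rewrite mulr2n; lra.
  rewrite -sqr_snorm; have d0 : 0 <= d by apply: lb_le_inf S0.1 _ => _ [y _ <-]; exact: inner_ge0.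
  by rewrite -(sqr_sqrtr d0) ler_pXn2r// nnegrE ?snorm_ge0 ?sqrtr_ge0.
move=> y Ky.
(* Minimality on the segment from [p] to [y], reached through the points [u n] of [K]. *)
have conv a : 0 <= a <= 1 -> d <= ip (g - p - a *: (y - p)) (g - p - a *: (y - p)).
  move=> a01; rewrite -sqr_snorm.
  apply: (@le_trans _ _ (Num.sqrt d ^+ 2)); first by case: (leP 0 d) => [/sqr_sqrtr ->//|/ltW h]; exact: le_trans h (sqr_ge0 _).
  rewrite ler_pXn2r ?nnegrE ?sqrtr_ge0 ?snorm_ge0//.
  apply: eps_ler => e e0.
  have [n nP] := up e e0.
  have [Kn _] := uP n.
  have := dle _ (cK _ _ a Ky Kn a01).
  rewrite -ler_sqrt ?inner_ge0// => h; apply: le_trans h _.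
  change (N (g - (a *: y + (1 - a) *: u n)) <= N (g - p - a *: (y - p)) + e).
  have -> : g - (a *: y + (1 - a) *: u n) = g - p - a *: (y - p) - (1 - a) *: (u n - p).
    by vec R H.
  rewrite (le_trans (snormD _ _))// lerD2l snormN snormZ.
  rewrite (le_trans (y := 1 * N (u n - p)))//; last by rewrite mul1r nP.
  rewrite ler_wpM2r ?snorm_ge0// ger0_norm; lra.
rewrite leNgt; apply/negP => w0.
set w := ip _ _ in w0; set q := ip (y - p) (y - p).
have q0 : 0 <= q by exact: inner_ge0.
(* This step towards [y] would bring [p] strictly closer to [g]. *)
pose a := w / (w + q).
have a01 : 0 <= a <= 1.
  rewrite /a divr_ge0 ?addr_ge0 ?(ltW w0)//=.
  by rewrite ler_pdivrMr ?mul1r ?lerDl// ltr_pwDl.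
have := conv _ a01; rewrite leNgt => /negP; apply.
apply: lt_le_trans (_ : ip (g - p) (g - p) <= d)%R => //.
rewrite (innerDl _ (g - p)) (innerDr (g - p)) (innerDr (- _)) !innerNl !innerNr !(innerZl, innerZr).
rewrite (innerC _ (y - p) (g - p)) -/w -/q.
rewrite -subr_gt0.
have wq : 0 < w + q by rewrite ltr_pwDl.
have -> : ip (g - p) (g - p) - (ip (g - p) (g - p) - a * w + (- (a * w) - - (a * (a * q)))) = a * (2 * w - a * q) by ring.
apply: mulr_gt0; first by rewrite divr_gt0.
rewrite subr_gt0 (@le_lt_trans _ _ w)//; last by lra.
by rewrite /a mulrAC ler_pdivrMr// ler_pM2l// lerDr ltW.
Qed.

End SemiHilbert.

(** * Functions with nonpositive Dini derivative almost everywhere *)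

Section Dini.
Variable R : realType.
Implicit Types (a b t h e L : R) (phi : R -> R).
Local Notation mu := (@lebesgue_measure R).

(** A null set of exceptional times is harmless because [phi] climbs at
    speed at most [L]. Cover it by an open set [U] of measure at most [e]: the inequality
    [phi t <= phi a + e (t - a) + L |U `&` ]a, t]|] propagates from [a] to [b], using the
    Dini bound outside [E] and the Lipschitz bound inside [U]. *)
Lemma dini_nonincreasing phi a b L (E : set (measurableTypeR R)) :
  a <= b -> 0 <= L ->
  (forall s t, a <= s -> s <= t -> t <= b -> phi t <= phi s + L * (t - s)) ->
  mu.-negligible E ->
  (forall t, a <= t -> t < b -> ~ E t -> forall e, 0 < e -> exists2 d : R, 0 < d &
     forall h, 0 < h -> h < d -> t + h <= b -> phi (t + h) <= phi t + e * h) ->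
  phi b <= phi a.
Proof.
move=> ab L0 lipphi [N [mN N0 EN]] dini.
apply: (@eps_ler R) => e0 e00.
pose e := e0 / (b - a + L + 1).
have S0 : 0 < b - a + L + 1 by rewrite ltr_wpDl// addr_ge0// subr_ge0.
have e_gt0 : 0 < e by rewrite divr_gt0.
have [|U [oU NU UN]] := @lebesgue_regularity_outer R N e mN _ e_gt0.
  by apply: le_lt_trans (ltry 0); rewrite le_eqVlt; apply/orP; left; apply/eqP.
have mU : measurable (U : set (measurableTypeR R)) by exact: measurable_realfun.open_measurable.
have muU : (mu U <= e%:E)%E.
  rewrite -(setDKU NU); apply: (@le_trans _ _ (mu (U `\` N) + mu N)%E).
    by apply: measureU2 => //; exact: measurableD.
  by rewrite N0 adde0 ltW.
pose I t : set (measurableTypeR R) := U `&` `]a, t].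
have mI t : measurable (I t) by apply: measurableI => //; exact: measurable_itv.
have leI t : (mu (I t) <= e%:E)%E.
  by apply: le_trans muU; apply: le_measure; rewrite ?inE//; exact: subIsetl.
have finI t : mu (I t) \is a fin_num.
  rewrite ge0_fin_numE//; exact: le_lt_trans (leI t) (ltry _).
pose m t := fine (mu (I t)).
have m_le t : m t <= e by rewrite -lee_fin fineK.
have m_ge0 t : 0 <= m t by exact: fine_ge0.
have m_mono s t : s <= t -> m s <= m t.
  move=> st; rewrite -lee_fin !fineK//; apply: le_measure; rewrite ?inE//.
  by apply: setIS => x /=; rewrite !in_itv/= => /andP[-> /le_trans]; exact.
have m_add s h : a <= s -> 0 < h -> `]s, s + h] `<=` U -> m s + h <= m (s + h).
  move=> as_ h0 sU; rewrite -lee_fin EFinD !fineK//.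
  have -> : h%:E = mu (`]s, s + h]%classic : set (measurableTypeR R)).
    rewrite lebesgue_measure_itv/= lte_fin ltrDl h0 -EFinB.
    by congr EFin; ring.
  rewrite -measureU//; last first.
    rewrite -subset0 => x [[_ /=]]; rewrite !in_itv/= => /andP[_ xs] /andP[sx _].
    by have := lt_le_trans sx xs; rewrite ltxx.
  apply: le_measure; rewrite ?inE//.
    by apply: measurableU => //; exact: measurable_itv.
  move=> x [[Ux /=]|/= xs].
    rewrite in_itv/= => /andP[ax xs]; split => //=; rewrite in_itv/= ax/=.
    by rewrite (le_trans xs)// lerDl ltW.
  split; first exact: sU.
  move: xs => /=; rewrite !in_itv/= => /andP[sx ->]; rewrite andbT.
  exact: le_lt_trans sx.
(* The supremum of [A] belongs to [A], and it is [b] since [A] extends beyond any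
   of its points below [b]. *)
pose A : set R := [set t | a <= t <= b /\
  phi t <= phi a + e * (t - a) + L * m t].
have Aa : A a.
  by split; rewrite ?lexx//= subrr mulr0 addr0 lerDl mulr_ge0.
have supA : has_sup A.
  by split; [exists a|exists b => t [/andP[]]].
pose s := sup A.
have as_ : a <= s by apply: sup_upper_bound.
have sb : s <= b by apply: ge_sup; [exists a|move=> t [/andP[]]].
have As : A s.
  split; first by rewrite as_.
  apply: (@eps_ler R) => e1 e10.
  pose d := e1 / (L + 1).
  have d0 : 0 < d by rewrite divr_gt0// ltr_wpDl.
  have [t [/andP[at_ tb] At] st] := sup_adherent d0 supA.
  have ts : t <= s by apply: sup_upper_bound => //; split => //; rewrite at_.
  have h1 := lipphi _ _ at_ ts sb.
  have h2 : L * (s - t) <= e1.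
    apply: (@le_trans _ _ ((L + 1) * d)); last first.
      by rewrite /d mulrC divfK// gt_eqF// ltr_wpDl.
    apply: ler_pM => //; [by rewrite subr_ge0|by rewrite lerDl|].
    by rewrite -/s in st; lra.
  have h3 : L * m t <= L * m s by rewrite ler_wpM2l// m_mono.
  have h4 : e * (t - a) <= e * (s - a) by rewrite ler_wpM2l ?(ltW e_gt0)// lerB.
  lra.
have sEb : s = b.
  apply/eqP; rewrite eq_le sb/= leNgt; apply/negP => slb.
  suff [h h0 Ah] : exists2 h : R, 0 < h & A (s + h).
    have : s + h <= s by apply: sup_upper_bound.
    by rewrite gerDl leNgt h0.
  have [Es|nEs] := pselect (E s); last first.
    have [d d0 dP] := dini _ as_ slb nEs _ e_gt0.
    pose h := Num.min (d / 2) (b - s).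
    have h0 : 0 < h by rewrite lt_min divr_gt0//= subr_gt0.
    have hb : s + h <= b by rewrite -lerBrDl ge_min lexx orbT.
    exists h => //; split; first by rewrite hb andbT (le_trans as_)// lerDl ltW.
    have hd : h < d by rewrite (@le_lt_trans _ _ (d / 2))// ?ge_min ?lexx//; lra.
    have h1 := dP _ h0 hd hb; have [_ h2] := As.
    have h3 : L * m s <= L * m (s + h) by rewrite ler_wpM2l// m_mono// lerDl ltW.
    lra.
  have /nbhs_ballP[d /= d0 dU] : nbhs s U.
    by rewrite nbhsE; exists U => //; split => //; exact/NU/EN.
  pose h := Num.min (d / 2) (b - s).
  have h0 : 0 < h by rewrite lt_min divr_gt0//= subr_gt0.
  have hb : s + h <= b by rewrite -lerBrDl ge_min lexx orbT.
  have hd : h < d by rewrite (@le_lt_trans _ _ (d / 2))// ?ge_min ?lexx//; lra.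
  exists h => //; split; first by rewrite hb andbT (le_trans as_)// lerDl ltW.
  have h1 : m s + h <= m (s + h).
    apply: m_add => // x /=; rewrite in_itv/= => /andP[sx xh]; apply: dU.
    by rewrite /ball/= ltr0_norm ?subr_lt0//; lra.
  have sh : s <= s + h by rewrite lerDl ltW.
  have h2 := lipphi _ _ as_ sh hb.
  have [_ h3] := As.
  have h4 : L * (m s + h) <= L * m (s + h) by rewrite ler_wpM2l.
  have h5 : 0 <= e * h by rewrite mulr_ge0// ltW.
  lra.
have [_ ] := As; rewrite sEb => h.
apply: (le_trans h); rewrite -addrA lerD2l.
apply: (@le_trans _ _ ((b - a + L + 1) * e)); last first.
  by rewrite /e mulrC divfK// gt_eqF.
have h1 : L * m b <= L * e by rewrite ler_wpM2l.
have := e_gt0; lra.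
Qed.

End Dini.

Lemma dini_affine (R : realType) (phi : R -> R) (a b L c k : R)
    (E : set (measurableTypeR R)) :
  a <= b -> 0 <= L -> 0 <= c ->
  (forall s t, a <= s -> s <= t -> t <= b -> phi t <= phi s + L * (t - s)) ->
  (@lebesgue_measure R).-negligible E ->
  (forall t, a <= t -> t < b -> ~ E t -> forall e, 0 < e ->
     exists2 d : R, 0 < d & forall h, 0 < h -> h < d ->
       phi (t + h) <= phi t + h * (c * (t - a) + k) + e * h) ->
  phi b <= phi a + c * (b - a) ^+ 2 / 2 + k * (b - a).
Proof.
move=> ab L0 c0 lip E0 dini.
pose psi t := phi t - (c * (t - a) ^+ 2 / 2 + k * (t - a)).
suff : psi b <= psi a by rewrite /psi subrr; lra.
apply: (@dini_nonincreasing _ _ _ _ (L + `|k|) E) => //.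
- by rewrite addr_ge0.
- move=> s t as_ st tb; have := lip _ _ as_ st tb; rewrite /psi => h.
  have h1 : 0 <= c * ((t - a) ^+ 2 - (s - a) ^+ 2).
    by rewrite mulr_ge0// subr_ge0 lerXn2r ?nnegrE//; lra.
  have h2 : - (k * (t - s)) <= `|k| * (t - s).
    by rewrite -mulNr ler_wpM2r ?subr_ge0// -normrN ler_norm.
  lra.
- move=> t at_ tb nE e e0; have [d d0 dP] := dini t at_ tb nE e e0.
  exists d => // h h0 hd _; have := dP _ h0 hd; rewrite /psi => h1.
  have h2 : 0 <= c * h ^+ 2 by rewrite mulr_ge0// sqr_ge0.
  lra.
Qed.

(** * Right derivatives of solutions *)

Section Evolution.
Variables (R : realType) (H : lmodType R) (ip : semi_inner H).
Local Notation N := (snorm ip).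
Local Notation mu := (@lebesgue_measure R).

Definition lip_until (X : R -> H) (T L : R) := forall s t,
  0 <= s -> s <= t -> t <= T -> N (X t - X s) <= L * (t - s).

Definition loc_lip (X : R -> H) := forall T,
  exists2 L, 0 <= L & lip_until X T L.

(** Evolution variational inequality. It says that [G t - X'(t)] is normal to
    [K] at [X t], but through squared distances, so that no derivative of [X] occurs. *)
Definition evi (K : set H) (G X : R -> H) := forall Z, K Z ->
  exists2 E : set (measurableTypeR R), mu.-negligible E &
  forall t, 0 < t -> ~ E t -> forall e, 0 < e ->
  exists2 d : R, 0 < d & forall h, 0 < h -> h < d ->
    ip (X (t + h) - Z) (X (t + h) - Z) <=
    ip (X t - Z) (X t - Z) + h * (2 * ip (G t) (X t - Z)) + e * h.

Definition rderiv (X : R -> H) (t : R) (V : H) := forall e, 0 < e ->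
  exists2 d : R, 0 < d & forall h, 0 < h -> h < d ->
    N (X (t + h) - X t - h *: V) <= e * h.

Lemma sqdist_lip X T L Z a b : lip_until X T L -> 0 <= L ->
  0 <= a -> b <= T -> exists2 M, 0 <= M & forall s t, a <= s -> s <= t ->
    t <= b -> ip (X t - Z) (X t - Z) <= ip (X s - Z) (X s - Z) + M * (t - s).
Proof.
move=> lipX L0 a0 bT.
have [ba|ab] := ltP b a.
  by exists 0 => // s t as_ st tb; lra.
pose B := N (X a - Z) + L * (b - a).
have B0 : 0 <= B by rewrite addr_ge0 ?snorm_ge0// mulr_ge0// subr_ge0.
exists (2 * B * L); first by rewrite !mulr_ge0.
have bnd t : a <= t -> t <= b -> N (X t - Z) <= B.
  move=> at_ tb; apply: le_trans (snorm_triangle ip (X a) _ _) _.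
  rewrite /B addrC lerD2l (le_trans (lipX _ _ a0 at_ (le_trans tb bT)))//.
  by rewrite ler_wpM2l// lerB.
move=> s t as_ st tb.
have h1 := bnd _ (le_trans as_ st) tb; have h2 := bnd _ as_ (le_trans st tb).
have h3 := lipX _ _ (le_trans a0 as_) st (le_trans tb bT).
have h4 : N (X t - Z) <= N (X t - X s) + N (X s - Z) by exact: snorm_triangle.
rewrite -!sqr_snorm; set p := N (X t - Z) in h1 h4 *.
set q := N (X s - Z) in h2 h4 *; set r := N _ in h3 h4.
have p0 : 0 <= p := snorm_ge0 _ _; have q0 : 0 <= q := snorm_ge0 _ _.
have -> : p ^+ 2 = q ^+ 2 + (p - q) * (p + q) by ring.
rewrite lerD2l; have [pq|qp] := leP p q.
  rewrite (@le_trans _ _ 0)//; first by rewrite mulr_le0_ge0 ?subr_le0 ?addr_ge0.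
  by rewrite !mulr_ge0// subr_ge0.
rewrite (@le_trans _ _ ((L * (t - s)) * (2 * B)))//; last by rewrite le_eqVlt; apply/orP; left; apply/eqP; ring.
by apply: ler_pM; rewrite ?subr_ge0 ?(ltW qp) ?addr_ge0//; lra.
Qed.

Variables (K : set H) (X G : R -> H).
Hypotheses (cK : sconvex K) (KX : forall t, 0 <= t -> K (X t)).
Hypotheses (lipX : loc_lip X) (lipG : loc_lip G) (eviX : evi K G X).

(** For a fixed [Z], an affine bound on the forcing integrates to a quadratic
    bound on the squared distance to [Z]. *)
Lemma evi_affine Z a b c k : K Z -> 0 <= a -> a <= b -> 0 <= c ->
  (forall t, a < t -> t < b -> 2 * ip (G t) (X t - Z) <= c * (t - a) + k) ->
  ip (X b - Z) (X b - Z) <=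
    ip (X a - Z) (X a - Z) + c * (b - a) ^+ 2 / 2 + k * (b - a).
Proof.
move=> KZ a0 ab c0 Gle.
have [L L0 lipL] := lipX b.
have [M M0 lipM] := @sqdist_lip X b L Z a b lipL L0 a0 (lexx _).
have [E E0 EP] := eviX KZ.
apply: (@dini_affine R (fun t => ip (X t - Z) (X t - Z)) a b M c k (E `|` [set a])) => //.
  apply: negligibleU => //; apply/negligibleP => //.
  exact: lebesgue_measure_set1.
move=> t at_ tb nE e e0.
have tE : ~ E t by move=> Et; apply: nE; left.
have lt_at : a < t.
  rewrite lt_neqAle at_ andbT; apply/eqP => ta; apply: nE; right.
  by rewrite /= ta.
have [d d0 dP] := EP t (le_lt_trans a0 lt_at) tE e e0.
exists d => // h h0 hd; apply: le_trans (dP h h0 hd) _.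
by rewrite lerD2r lerD2l ler_wpM2l ?(ltW h0)// Gle.
Qed.

Section RightDerivative.
Variable t0 : R.
Hypothesis t0_ge0 : 0 <= t0.
Let x0 := X t0.
Let g0 := G t0.
Let dX s := X (t0 + s) - x0.

(** The feasible directions at [X t0], whose closure is the tangent cone. *)
Definition cone_of : set H :=
  [set z | exists2 h : R, 0 < h & K (x0 + h *: z)].

Lemma cone_of_down z h1 h : K (x0 + h1 *: z) -> 0 < h -> h <= h1 ->
  K (x0 + h *: z).
Proof.
move=> Kz h0 hh1; have h10 : 0 < h1 := lt_le_trans h0 hh1.
have -> : x0 + h *: z = (h / h1) *: (x0 + h1 *: z) + (1 - h / h1) *: x0.
  by vec R H; field; rewrite gt_eqF.
apply: cK => //; first exact: KX.
by rewrite divr_ge0 ?(ltW h0) ?(ltW h10)//= ler_pdivrMr// mul1r.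
Qed.

Lemma sconvex_cone_of : sconvex cone_of.
Proof.
move=> x y a [h1 h10 K1] [h2 h20 K2] a01.
pose h := Num.min h1 h2.
have h0 : 0 < h by rewrite lt_min h10.
exists h => //.
have -> : x0 + h *: (a *: x + (1 - a) *: y) =
    a *: (x0 + h *: x) + (1 - a) *: (x0 + h *: y) by vec R H.
apply: cK => //.
  by apply: cone_of_down K1 _ _; rewrite // ge_min lexx.
by apply: cone_of_down K2 _ _; rewrite // ge_min lexx orbT.
Qed.

Lemma cone_ofZ z c : 0 < c -> cone_of z -> cone_of (c *: z).
Proof.
move=> c0 [h h0 Kz]; exists (h / c); first by rewrite divr_gt0.
by rewrite scalerA divfK ?gt_eqF.
Qed.

Lemma cone_of0 : cone_of 0.
Proof. by exists 1 => //; rewrite scaler0 addr0; exact: KX. Qed.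

Lemma cone_of_dX s : 0 < s -> cone_of (s^-1 *: dX s).
Proof.
move=> s0; exists s => //; rewrite scalerA mulfV ?gt_eqF// scale1r.
by rewrite /dX addrC subrK; apply: KX; rewrite addr_ge0// ltW.
Qed.

(** On a cone the variational inequality of the projection splits: scaling [z]
    up gives the sign condition, and [z = 0] against [z = P] the orthogonality. *)
Lemma tangent_projection : scomplete ip -> exists P,
  [/\ sclosure ip cone_of P, forall z, cone_of z -> ip (g0 - P) z <= 0 &
      ip (g0 - P) P = 0].
Proof.
move=> cH; have [] := @projection_closure R H ip cone_of g0 cH sconvex_cone_of.
  by exists 0; exact: cone_of0.
move=> P CP Pproj.
have P1 z : cone_of z -> ip (g0 - P) z <= 0.
  move=> Cz; rewrite leNgt; apply/negP => w0.
  have q0 : 0 <= ip (g0 - P) P.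
    by have := Pproj _ cone_of0; rewrite sub0r innerNr oppr_le0.
  set w := ip _ _ in w0; set q := ip _ P in q0.
  have c0 : 0 < (q + 1) / w by rewrite divr_gt0// ltr_wpDl.
  have := Pproj _ (cone_ofZ c0 Cz).
  rewrite innerDr innerNr innerZr -/w -/q divfK ?gt_eqF// addrAC subrr add0r.
  by rewrite ler10.
exists P; split => //; apply/le_anti/andP; split; first exact: le_inner_closure P1 _ CP.
by have := Pproj _ cone_of0; rewrite sub0r innerNr oppr_le0.
Qed.

Variables (P : H) (LX LG : R).
Hypotheses (CP : sclosure ip cone_of P).
Hypotheses (P1 : forall z, cone_of z -> ip (g0 - P) z <= 0).
Hypotheses (P2 : ip (g0 - P) P = 0).
Hypotheses (LX0 : 0 <= LX) (lipLX : lip_until X (t0 + 1) LX).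
Hypotheses (LG0 : 0 <= LG) (lipLG : lip_until G (t0 + 1) LG).

Lemma inner_dX s : 0 < s -> ip g0 (dX s) <= N P * N (dX s).
Proof.
move=> s0; have := P1 (cone_of_dX s0).
rewrite innerZr pmulr_rle0 ?invr_gt0// innerDl innerNl subr_le0 => h.
exact: le_trans h (cauchy_schwarz _ _ _).
Qed.

Lemma inner_G_sub s z : 0 <= s -> s <= 1 ->
  ip (G (t0 + s) - g0) z <= LG * s * N z.
Proof.
move=> s0 s1; apply: le_trans (cauchy_schwarz _ _ _) _.
rewrite ler_wpM2r ?snorm_ge0//.
have := lipLG t0_ge0 (t := t0 + s); rewrite [t0 + s - t0]addrAC subrr add0r.
by apply; rewrite ?lerDl ?lerD2l.
Qed.

(** Testing with [X t0] bounds [|dX s|^2] by twice the integral of [p |dX|],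
    with [p = |P| + LG s0]. So if [c] is the best constant in [|dX s| <= c s], then
    [c^2 <= p c]. *)
Lemma dX_le s0 : 0 < s0 -> s0 <= 1 -> forall s, 0 <= s -> s <= s0 ->
  N (dX s) <= (N P + LG * s0) * s.
Proof.
move=> s00 s01.
pose p := N P + LG * s0.
have p0 : 0 <= p by rewrite addr_ge0 ?snorm_ge0// mulr_ge0// ltW.
have lipd s : 0 <= s -> s <= 1 -> N (dX s) <= LX * s.
  move=> s_ge0 s1; have := lipLX t0_ge0 (t := t0 + s).
  by rewrite [t0 + s - t0]addrAC subrr add0r; apply; rewrite ?lerDl ?lerD2l.
pose S := [set N (dX s) / s | s in [set s | 0 < s <= s0]].
have S0 : S !=set0 by exists (N (dX s0) / s0), s0 => //=; rewrite s00/=.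
have supS : has_sup S.
  split=> //; exists LX => _ [s /andP[s_gt0 ss0] <-].
  by rewrite ler_pdivrMr//; exact: lipd (ltW s_gt0) (le_trans ss0 s01).
pose c := sup S.
have c_ub s : 0 < s -> s <= s0 -> N (dX s) <= c * s.
  move=> s_gt0 ss0; rewrite -ler_pdivrMr//; apply: sup_upper_bound => //.
  by exists s => //=; rewrite s_gt0.
have c0 : 0 <= c.
  by have := le_trans (snorm_ge0 _ _) (c_ub _ s00 (lexx _)); rewrite pmulr_lge0.
have sqr_le s : 0 < s -> s <= s0 -> N (dX s) ^+ 2 <= (p * c) * s ^+ 2.
  move=> s_gt0 ss0.
  have := @evi_affine x0 t0 (t0 + s) (2 * (p * c)) 0 (KX t0_ge0) t0_ge0.
  rewrite -/x0 subrr inner0l add0r mul0r addr0 [t0 + s - t0]addrAC subrr add0r.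
  rewrite -/(dX s) -sqr_snorm => h; apply: le_trans (h _ _ _) _.
  - by rewrite lerDl ltW.
  - by rewrite !mulr_ge0.
  - move=> t t0t ts; pose r := t - t0.
    have r0 : 0 < r by rewrite subr_gt0.
    have tE : t = t0 + r by rewrite /r addrC subrK.
    have rs : r <= s0 by rewrite /r; lra.
    rewrite addr0 tE -/(dX r) [t0 + r - t0]addrAC subrr add0r -mulrA ler_wpM2l//.
    have -> : ip (G (t0 + r)) (dX r) = ip g0 (dX r) + ip (G (t0 + r) - g0) (dX r).
      by rewrite innerDl innerNl [RHS]addrC subrK.
    have h1 := inner_dX r0.
    have h2 := inner_G_sub (dX r) (ltW r0) (le_trans rs s01).
    have h3 : LG * r * N (dX r) <= LG * s0 * N (dX r).
      by rewrite ler_wpM2r ?snorm_ge0// ler_wpM2l.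
    have h4 : p * N (dX r) <= p * (c * r) by rewrite ler_wpM2l// c_ub.
    have pE : p * N (dX r) = N P * N (dX r) + LG * s0 * N (dX r) by rewrite -mulrDl.
    rewrite -mulrA; lra.
  - by rewrite le_eqVlt; apply/orP; left; apply/eqP; field.
(* By [sqr_le] the supremum [c] of the quotients is at most [sqrt (p * c)]. *)
have cp : c <= p.
  have : c <= Num.sqrt (p * c).
    apply: ge_sup => // _ [s /andP[s_gt0 ss0] <-].
    rewrite ler_pdivrMr// -(@ler_pXn2r _ 2)// ?nnegrE ?snorm_ge0 ?mulr_ge0 ?sqrtr_ge0 ?(ltW s_gt0)//.
    by rewrite exprMn (sqr_sqrtr (mulr_ge0 p0 c0)) sqr_le.
  rewrite -(@ler_pXn2r _ 2)// ?nnegrE ?sqrtr_ge0// sqr_sqrtr ?mulr_ge0// expr2.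
  have [->//|cn0] := eqVneq c 0.
  by rewrite ler_pM2r// lt_def cn0.
move=> s; rewrite le_eqVlt => /predU1P[<- _|s_gt0 ss0].
  by rewrite /dX addr0 subrr snorm0 mulr0.
by apply: le_trans (c_ub _ s_gt0 ss0) _; rewrite ler_wpM2r// ltW.
Qed.

(** Testing with [X t0 + h z], for a feasible direction [z], compares the
    difference quotient with [z]. When [z] approaches [P] and [h], [s0] are small, the
    bracket is close to [|z|^2 + |P|^2 - 2 <g0, z>], hence to [0]. *)
Lemma dX_sub_le z h1 s0 h : K (x0 + h1 *: z) -> 0 < s0 -> s0 <= 1 ->
  0 < h -> h <= s0 -> h <= h1 ->
  N (dX h - h *: z) ^+ 2 <= h ^+ 2 *
   (ip z z + N P * (N P + LG * s0) - 2 * ip g0 z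
    + 2 * LG * h * (N P + LG * s0 + N z)).
Proof.
move=> Kz s00 s01 h0 hs0 hh1; pose p := N P + LG * s0.
have p0 : 0 <= p by rewrite addr_ge0 ?snorm_ge0// mulr_ge0// ltW.
have KZ := cone_of_down Kz h0 hh1.
pose Z := x0 + h *: z.
have dZ s : X (t0 + s) - Z = dX s - h *: z by rewrite /Z /dX opprD addrA.
pose k := 2 * (- (h * ip g0 z) + LG * h ^+ 2 * (p + N z)).
have := @evi_affine Z t0 (t0 + h) (2 * (N P * p)) k KZ t0_ge0.
rewrite dZ -/x0 [t0 + h - t0]addrAC subrr add0r.
have -> : x0 - Z = - (h *: z) by rewrite /Z; vec R H.
rewrite -sqr_snorm => ev; apply: le_trans (ev _ _ _) _.
- by rewrite lerDl ltW.
- by rewrite !mulr_ge0// snorm_ge0.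
- move=> t t0t th; pose r := t - t0.
  have r0 : 0 < r by rewrite subr_gt0.
  have tE : t = t0 + r by rewrite /r addrC subrK.
  have rh : r <= h by rewrite /r; lra.
  rewrite tE dZ [t0 + r - t0]addrAC subrr add0r.
  have -> : ip (G (t0 + r)) (dX r - h *: z) = ip g0 (dX r) - h * ip g0 z
      + ip (G (t0 + r) - g0) (dX r - h *: z).
    by rewrite !innerE; ring.
  have h1' := inner_dX r0.
  have h2 := inner_G_sub (dX r - h *: z) (ltW r0) (le_trans rh (le_trans hs0 s01)).
  have h3 : N (dX r) <= p * r by rewrite dX_le// ?(ltW r0) ?(le_trans rh).
  have h4 : N (dX r - h *: z) <= h * (p + N z).
    apply: le_trans (snormD _ _ _) _; rewrite snormN snormZ ger0_norm ?(ltW h0)//.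
    rewrite mulrDr lerD2r (le_trans h3)// mulrC ler_wpM2r//.
  have h5 : LG * r * N (dX r - h *: z) <= LG * h ^+ 2 * (p + N z).
    have -> : LG * h ^+ 2 * (p + N z) = (LG * h) * (h * (p + N z)) by ring.
    apply: ler_pM; rewrite ?mulr_ge0 ?snorm_ge0 ?(ltW r0)//.
    by rewrite ler_wpM2l.
  have h6 : N P * N (dX r) <= N P * (p * r) by rewrite ler_wpM2l ?snorm_ge0.
  rewrite /k; lra.
- rewrite /k innerNl innerNr innerZl innerZr -/p.
  by rewrite le_eqVlt; apply/orP; left; apply/eqP; field.
Qed.

Lemma rderiv_projection : rderiv X t0 P.
Proof.
move=> e e0.
pose Q := N (P - g0); have Q0 : 0 <= Q by exact: snorm_ge0.
have NP0 : 0 <= N P by exact: snorm_ge0.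
have Q1 : 0 < 1 + 2 * Q by rewrite ltr_pwDl// mulr_ge0.
pose eta := Num.min 1 (Num.min (e / 2) (e ^+ 2 / 8 / (1 + 2 * Q))).
have e8 : 0 < e ^+ 2 / 8 by rewrite divr_gt0// exprn_gt0.
have eta0 : 0 < eta by rewrite !lt_min ltr01 (divr_gt0 e0)//= divr_gt0.
have eta1 : eta <= 1 by rewrite ge_min lexx.
have etae : eta <= e / 2 by rewrite !ge_min lexx orbT.
have etaQ : eta * (1 + 2 * Q) <= e ^+ 2 / 8.
  by rewrite -ler_pdivlMr// !ge_min lexx !orbT.
have [z [h1 h10 Kz] zP] := CP eta0.
pose M := LG * N P + 2 * LG * (N P + LG + N z) + 1.
have Nz0 : 0 <= N z by exact: snorm_ge0.
have M0 : 0 < M.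
  by rewrite ltr_wpDl// addr_ge0 ?mulr_ge0// !addr_ge0// snorm_ge0.
pose s0 := Num.min 1 (e ^+ 2 / 8 / M).
have s00 : 0 < s0 by rewrite lt_min ltr01/= divr_gt0.
have s01 : s0 <= 1 by rewrite ge_min lexx.
have s0M : s0 * M <= e ^+ 2 / 8 by rewrite -ler_pdivlMr// ge_min lexx orbT.
exists (Num.min s0 h1); first by rewrite lt_min s00.
move=> h h0; rewrite lt_min => /andP[/ltW hs0 /ltW hh1].
have := dX_sub_le Kz s00 s01 h0 hs0 hh1.
set B := (_ + _ - _ + _) => hB.
have BE : B <= e ^+ 2 / 4.
  (* Here [<g0, P> = |P|^2] is used. *)
  have E1 : ip z z - 2 * ip g0 z + N P ^+ 2 =
      N (z - P) ^+ 2 + 2 * ip (P - g0) (z - P).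
    have -> : ip (P - g0) (z - P) = ip (P - g0) z.
      by rewrite innerDr innerNr -(opprB g0 P) !innerNl P2; lra.
    by rewrite !sqr_snorm !innerE (innerC _ z P); ring.
  have E2 : ip (P - g0) (z - P) <= Q * eta.
    by rewrite (le_trans (cauchy_schwarz _ _ _))// ler_wpM2l.
  have E3 : N (z - P) ^+ 2 <= eta.
    rewrite (@le_trans _ _ (eta ^+ 2))//.
      by rewrite lerXn2r ?nnegrE ?snorm_ge0// ltW.
    by rewrite expr2 ler_piMr// ltW.
  have E4 : N P * (LG * s0) + 2 * LG * h * (N P + LG * s0 + N z) <= s0 * M.
    have -> : s0 * M = N P * (LG * s0) + 2 * LG * s0 * (N P + LG + N z) + s0.
      by rewrite /M; ring.
    apply: ler_wpDr; first exact: ltW.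
    rewrite lerD2l.
    apply: ler_pM; rewrite ?mulr_ge0 ?(ltW h0)//.
    - by rewrite !addr_ge0// mulr_ge0// ltW.
    - by rewrite ler_wpM2l// mulr_ge0.
    - by rewrite lerD2r lerD2l ler_piMr.
  have E5 : B = (ip z z - 2 * ip g0 z + N P ^+ 2) +
     (N P * (LG * s0) + 2 * LG * h * (N P + LG * s0 + N z)).
    by rewrite /B; ring.
  rewrite E5 E1; lra.
have hh : N (dX h - h *: z) <= h * (e / 2).
  apply: snorm_le; first by rewrite mulr_ge0// ltW// divr_gt0.
  rewrite -sqr_snorm (le_trans hB)// exprMn ler_wpM2l ?sqr_ge0//.
  by rewrite (le_trans BE)// le_eqVlt; apply/orP; left; apply/eqP; field.
rewrite -/x0 -/(dX h).
have -> : dX h - h *: P = (dX h - h *: z) + h *: (z - P) by vec R H.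
apply: le_trans (snormD _ _ _) _; rewrite snormZ ger0_norm ?(ltW h0)//.
have : h * N (z - P) <= h * (e / 2) by rewrite ler_wpM2l ?(ltW h0)// (le_trans zP).
lra.
Qed.

End RightDerivative.

Lemma right_derivative t : scomplete ip -> 0 <= t ->
  exists V, [/\ rderiv X t V, forall Z, K Z -> ip (G t - V) (Z - X t) <= 0 &
                ip (G t - V) V = 0].
Proof.
move=> cH t_ge0.
have [P [CP P1 P2]] := tangent_projection t_ge0 cH.
have [LX LX0 lX] := lipX (t + 1); have [LG LG0 lG] := lipG (t + 1).
exists P; split => //; first exact: (rderiv_projection t_ge0 CP P1 P2 lX LG0 lG).
by move=> Z KZ; apply: P1; exists 1 => //; rewrite scale1r addrC subrK.
Qed.

End Evolution.

(** * Two-sided derivatives almost everywhere *)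

(** The gaps that [F] jumps over from the left at distinct points are disjoint,
    and each of them contains a rational number. *)
Lemma left_jumps_countable (R : realType) (F : R -> R) (T : R) :
  (forall x y, 0 <= x -> x <= y -> y < T -> F x <= F y) ->
  countable [set t | 0 < t < T /\ exists2 e, 0 < e &
    forall s, 0 <= s -> s < t -> F s <= F t - e].
Proof.
move=> F_nd; set A := [set t | _].
have ratP t : exists q : rat, A t -> ratr q < F t /\
    (forall s, 0 <= s -> s < t -> F s < ratr q).
  have [[tT [e e0 Fe]]|nA] := pselect (A t); last by exists 0.
  have Fte : F t - e < F t by lra.
  have [q] := rat_in_itvoo Fte; rewrite in_itv/= => /andP[q1 q2].
  by exists q => _; split => // s s0 st; exact: le_lt_trans (Fe s s0 st) q1.
have [f fP] := choice ratP.
apply/countable_injP; exists (pickle \o f) => x y.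
rewrite !inE => Ax Ay /(pcan_inj pickleK) fxy.
have lt_f u v : A u -> A v -> u < v -> ratr (f u) < ratr (f v) :> R.
  move=> Au Av uv; apply: lt_trans (fP u Au).1 _; apply: (fP v Av).2 => //.
  by case: Au => /andP[/ltW].
case: (ltgtP x y) => // xy.
  by have := lt_f _ _ Ax Ay xy; rewrite fxy ltxx.
by have := lt_f _ _ Ay Ax xy; rewrite fxy ltxx.
Qed.

Section TwoSided.
Variables (R : realType) (H : lmodType R) (ip : semi_inner H).
Local Notation N := (snorm ip).
Local Notation mu := (@lebesgue_measure R).
Implicit Types (t s h k e a b L c : R).

Definition lderiv (X : R -> H) (t : R) (V : H) := forall e, 0 < e ->
  exists2 d : R, 0 < d & forall h, 0 < h -> h < d ->
    N (X t - X (t - h) - h *: V) <= e * h.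

Lemma rderivB X Y t V W : rderiv ip X t V -> rderiv ip Y t W ->
  rderiv ip (fun t => X t - Y t) t (V - W).
Proof.
move=> dX dY e e0; have e2 : 0 < e / 2 by rewrite divr_gt0.
have [d1 d10 h1] := dX _ e2; have [d2 d20 h2] := dY _ e2.
exists (Num.min d1 d2); first by rewrite lt_min d10.
move=> h h0; rewrite lt_min => /andP[hd1 hd2].
have -> : X (t + h) - Y (t + h) - (X t - Y t) - h *: (V - W) =
  (X (t + h) - X t - h *: V) - (Y (t + h) - Y t - h *: W) by vec R H.
apply: le_trans (snormD _ _ _) _; rewrite snormN.
have := h1 _ h0 hd1; have := h2 _ h0 hd2; lra.
Qed.

Lemma rderiv_shift X t k V : rderiv ip X (t + k) V ->
  rderiv ip (fun t => X (t + k)) t V.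
Proof.
move=> dX e /dX[d d0 h]; exists d => // x x0 xd.
by have := h x x0 xd; rewrite (addrAC t).
Qed.

Lemma rderiv_sqr X t V e : rderiv ip X t V -> 0 < e ->
  exists2 d : R, 0 < d & forall h, 0 < h -> h < d ->
    ip (X (t + h)) (X (t + h)) <=
    ip (X t) (X t) + h * (2 * ip (X t) V) + e * h.
Proof.
move=> dX e0; pose a := N (X t); pose b := N V.
have a0 : 0 <= a by exact: snorm_ge0.
have b0 : 0 <= b by exact: snorm_ge0.
pose e1 := Num.min 1 (e / 2 / (2 * a + 1)).
have a1 : 0 < 2 * a + 1 by rewrite ltr_wpDl// mulr_ge0.
have e10 : 0 < e1 by rewrite lt_min ltr01/= !divr_gt0.
have e11 : e1 <= 1 by rewrite ge_min lexx.
have e1a : e1 * (2 * a + 1) <= e / 2 by rewrite -ler_pdivlMr// ge_min lexx orbT.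
have [d d0 hd] := dX _ e10.
pose B := (b + 1) ^+ 2; have B0 : 0 < B by rewrite exprn_gt0// ltr_wpDl.
exists (Num.min d (e / 2 / B)); first by rewrite lt_min d0 !divr_gt0.
move=> h h0; rewrite lt_min => /andP[/(hd _ h0) Nr hB].
have hB' : h * B <= e / 2 by rewrite -ler_pdivlMr// ltW.
set r := X (t + h) - X t - h *: V in Nr.
have -> : X (t + h) = X t + (h *: V + r) by rewrite /r; vec R H.
have h1 : ip (X t) r <= a * (e1 * h).
  by rewrite (le_trans (cauchy_schwarz _ _ _))// ler_wpM2l.
have h2 : N (h *: V + r) <= h * (b + 1).
  rewrite (le_trans (snormD _ _ _))// snormZ ger0_norm ?(ltW h0)// mulrDr lerD2l.
  by rewrite (le_trans Nr)// mulrC ler_wpM2l// ltW.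
have h3 : ip (h *: V + r) (h *: V + r) <= h * (h * B).
  rewrite -sqr_snorm (le_trans (y := (h * (b + 1)) ^+ 2))//.
    by rewrite lerXn2r// nnegrE ?snorm_ge0// mulr_ge0 ?addr_ge0// ltW.
  by rewrite le_eqVlt /B; apply/orP; left; apply/eqP; ring.
have h4 : h * (h * B) <= h * (e / 2) by rewrite ler_wpM2l// ltW.
have h5 : h * (e1 * (2 * a)) <= h * (e / 2).
  rewrite ler_wpM2l ?(ltW h0)// (le_trans _ e1a)//.
  by rewrite ler_wpM2l ?(ltW e10)// lerDl.
rewrite (innerDl _ (X t)) (innerDr _ (X t) (X t)) (innerDr _ (h *: V + r) (X t)).
rewrite (innerC _ (h *: V + r) (X t)) (innerDr _ (X t) (h *: V)) innerZr.
lra.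
Qed.

Lemma rderiv_inner X t V z e : rderiv ip X t V -> 0 < e ->
  exists2 d : R, 0 < d & forall h, 0 < h -> h < d ->
    ip (X (t + h)) z <= ip (X t) z + h * ip V z + e * h.
Proof.
move=> dX e0; have z1 : 0 < N z + 1 by rewrite ltr_wpDl// snorm_ge0.
have [d d0 hd] := dX _ (divr_gt0 e0 z1); exists d => // h h0 /(hd _ h0).
set r := _ - _ - _ => Nr.
have -> : X (t + h) = X t + h *: V + r by rewrite /r; vec R H.
rewrite 2!innerDl innerZl lerD2l; apply: le_trans (cauchy_schwarz _ _ _) _.
apply: (@le_trans _ _ (e / (N z + 1) * h * (N z + 1))).
  apply: ler_pM; rewrite ?snorm_ge0// lerDl//.
by rewrite mulrAC divfK// gt_eqF.
Qed.

Lemma inner_sqrD x y : ip (x + y) (x + y) = ip x x + 2 * ip x y + ip y y.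
Proof. by rewrite !innerE (innerC _ y x); ring. Qed.

Lemma inner_sqrBZ x y h : ip (x - h *: y) (x - h *: y) =
  N x ^+ 2 - 2 * h * ip x y + h ^+ 2 * N y ^+ 2.
Proof. by rewrite !sqr_snorm !innerE (innerC _ y x); ring. Qed.

Variables (K : set H) (X G V : R -> H).
Hypothesis KX : forall t, 0 <= t -> K (X t).
Hypotheses (lipX : loc_lip ip X) (lipG : loc_lip ip G) (eviX : evi ip K G X).
Hypotheses (dX : forall t, 0 <= t -> rderiv ip X t (V t)).
Hypotheses (VI : forall t, 0 <= t ->
  forall Z, K Z -> ip (G t - V t) (Z - X t) <= 0).

Lemma eps_le_sqr p q c : 0 <= p -> 0 <= q -> 0 <= c ->
  (forall e, 0 < e -> p <= Num.sqrt ((q + e) ^+ 2 + c) + e) ->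
  p ^+ 2 <= q ^+ 2 + c.
Proof.
move=> p0 q0 c0 h; have qc : 0 <= q ^+ 2 + c by rewrite addr_ge0 ?sqr_ge0.
set w := Num.sqrt (q ^+ 2 + c); have w0 : 0 <= w by exact: sqrtr_ge0.
have w2 : w ^+ 2 = q ^+ 2 + c by rewrite sqr_sqrtr.
have qw : q <= w by rewrite -(@ler_pXn2r _ 2)// ?nnegrE// w2 lerDl.
suff pw : p <= w by rewrite -w2 lerXn2r.
apply: (@eps_ler R) => e e0; have e2 : 0 < e / 2 by rewrite divr_gt0.
apply: le_trans (h _ e2) _.
suff : Num.sqrt ((q + e / 2) ^+ 2 + c) <= w + e / 2 by move=> ?; lra.
have we : 0 <= w + e / 2 by rewrite addr_ge0// ltW.
rewrite -[leRHS](ger0_norm we) -sqrtr_sqr ler_wsqrtr// sqrrD [leRHS]sqrrD w2.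
have : q * (e / 2) <= w * (e / 2) by rewrite ler_wpM2r// ltW.
move=> ?; lra.
Qed.

(** For the increment [X (r + k) - X r] the monotonicity of the normal cone
    leaves only the variation of [G], so its squared norm divided by [k^2] grows at rate
    at most [2 LG LX]; then [k] tends to [0]. *)
Lemma speed_almost_nonincreasing T LX LG s t :
  0 <= LX -> 0 <= LG -> lip_until ip X (T + 1) LX -> lip_until ip G (T + 1) LG ->
  0 <= s -> s <= t -> t <= T ->
  N (V t) ^+ 2 <= N (V s) ^+ 2 + 2 * LG * LX * (t - s).
Proof.
move=> LX0 LG0 lX lG s0 st tT.
have c0 : 0 <= 2 * LG * LX * (t - s) by rewrite !mulr_ge0// subr_ge0.
apply: eps_le_sqr; rewrite ?snorm_ge0// => e e0.
have [d1 d10 h1] := dX s0 e0; have [d2 d20 h2] := dX (le_trans s0 st) e0.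
pose k := Num.min 1 (Num.min d1 d2) / 2.
have m0 : 0 < Num.min 1 (Num.min d1 d2) by rewrite !lt_min ltr01 d10.
have k0 : 0 < k by rewrite divr_gt0.
have klt : k < Num.min 1 (Num.min d1 d2) by rewrite /k; lra.
move: klt; rewrite !lt_min => /and3P[/ltW k1 kd1 kd2].
pose D r := X (r + k) - X r.
have lipD : lip_until ip D T (2 * LX).
  move=> a b a0 ab bT; rewrite /D.
  have -> : X (b + k) - X b - (X (a + k) - X a) =
    (X (b + k) - X (a + k)) - (X b - X a) by vec R H.
  rewrite (le_trans (snormD _ _ _))// snormN.
  have := lX (a + k) (b + k); rewrite addr_ge0 ?(ltW k0)// lerD2r ab lerD//.
  move=> /(_ isT isT isT); have := lX a b a0 ab; rewrite (le_trans bT) ?lerDl//.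
  move=> /(_ isT); lra.
have [M M0 lipM] := @sqdist_lip R H ip D T (2 * LX) 0 s t lipD (mulr_ge0 (ler0n _ 2) LX0) s0 tT.
(* The increments at distance [k] are compared at the times [s] and [t]. *)
have D2 : ip (D t) (D t) <= ip (D s) (D s) + (2 * LG * LX * (t - s)) * k ^+ 2.
  have := @dini_affine R (fun r => ip (D r) (D r)) s t M 0 (2 * LG * LX * k ^+ 2) set0 st M0 (lexx 0).
  rewrite mul0r mul0r addr0 => h; rewrite [_ * k ^+ 2]mulrAC; apply: h.
  - by move=> a b sa ab bt; have := lipM a b sa ab bt; rewrite !subr0.
  - exact: negligible_set0.
  - move=> r sr rt _ e1 e10.
    have r0 : 0 <= r := le_trans s0 sr.
    (* Each of [X r] and [X (r + k)] is a test point for the other one. *)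
    have rk0 : 0 <= r + k by rewrite addr_ge0// ltW.
    have dD : rderiv ip D r (V (r + k) - V r).
      by apply: rderivB (dX r0); exact/rderiv_shift/dX.
    have [d d0 hd] := rderiv_sqr dD e10; exists d => // h h0 /(hd _ h0) hle.
    apply: le_trans hle _; rewrite mul0r add0r lerD2r lerD2l ler_wpM2l ?(ltW h0)//.
    have v1 := VI r0 (KX rk0); have v2 := VI rk0 (KX r0).
    have lXr : N (D r) <= LX * k.
      have := lX r (r + k) r0; rewrite lerDl (ltW k0) [r + k - r]addrAC subrr add0r.
      by apply => //; rewrite lerD// (le_trans (ltW rt)).
    have lGr : N (G (r + k) - G r) <= LG * k.
      have := lG r (r + k) r0; rewrite lerDl (ltW k0) [r + k - r]addrAC subrr add0r.
      by apply => //; rewrite lerD// (le_trans (ltW rt)).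
    have v3 : ip (D r) (V (r + k) - V r) <= ip (G (r + k) - G r) (D r).
      have v2' : ip (G (r + k) - V (r + k)) (D r) >= 0.
        by move: v2; rewrite -(opprB (X (r + k))) innerNr oppr_le0.
      rewrite -subr_ge0; have -> : ip (G (r + k) - G r) (D r) - ip (D r) (V (r + k) - V r) =
        ip (G (r + k) - V (r + k)) (D r) - ip (G r - V r) (D r).
        by rewrite (innerC _ (D r)) -!innerNl -!innerDl; congr (ip _ _); vec R H.
      by rewrite subr_ge0 (le_trans v1).
    have v4 : ip (G (r + k) - G r) (D r) <= (LG * k) * (LX * k).
      by rewrite (le_trans (cauchy_schwarz _ _ _))// ler_pM ?snorm_ge0.
    have -> : 2 * LG * LX * k ^+ 2 = 2 * ((LG * k) * (LX * k)) by ring.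
    by rewrite ler_wpM2l// (le_trans v3).
have nD r : rderiv ip X r (V r) -> N (D r - k *: V r) <= e * k ->
    `|N (D r) - k * N (V r)| <= e * k.
  move=> _ hr; rewrite ler_norml.
  have kV : k * N (V r) = N (k *: V r) by rewrite snormZ ger0_norm// ltW.
  have a1 : N (D r) <= N (D r - k *: V r) + N (k *: V r).
    by rewrite -[X in N X <= _](subrK (k *: V r)) snormD.
  have a2 : N (k *: V r) <= N (D r - k *: V r) + N (D r).
    by rewrite (snormB _ (D r)) -[X in N X <= _](subrK (D r)) snormD.
  by rewrite kV; apply/andP; split; lra.
have ht := nD t (dX (le_trans s0 st)) (h2 _ k0 kd2).
have hs := nD s (dX s0) (h1 _ k0 kd1).
rewrite -(@ler_pM2l _ k)// mulrDr.
have -> : k * Num.sqrt ((N (V s) + e) ^+ 2 + 2 * LG * LX * (t - s)) =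
    Num.sqrt ((k * (N (V s) + e)) ^+ 2 + 2 * LG * LX * (t - s) * k ^+ 2).
  rewrite -[k in LHS](ger0_norm (ltW k0)) -sqrtr_sqr -sqrtrM ?sqr_ge0//.
  by congr Num.sqrt; ring.
have : N (D t) <= Num.sqrt ((k * (N (V s) + e)) ^+ 2 + 2 * LG * LX * (t - s) * k ^+ 2).
  have Ds : N (D s) <= k * (N (V s) + e).
    by move: hs; rewrite ler_norml => /andP[_ hs]; lra.
  apply: ler_wsqrtr; apply: le_trans D2 _; rewrite lerD2r -sqr_snorm.
  by rewrite lerXn2r// ?nnegrE ?snorm_ge0// (le_trans _ Ds)// snorm_ge0.
move: ht; rewrite ler_norml => /andP[ht _] hD.
lra.
Qed.

(** Let [E = X t - X (t - h)]. Left continuity of the speed gives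
    [|E| <= h |V t|] up to a small error. Conversely, the evolution inequality on
    [[t - h, t]] tested with [X (t + k)], where [h] is much smaller than [k], gives
    [<E, V t> >= h |V t|^2] up to a small error. Both together force [E / h] to be close
    to [V t]. *)
Lemma lderiv_of_left_continuous T LX LG t :
  0 <= LX -> 0 <= LG -> lip_until ip X (T + 1) LX -> lip_until ip G (T + 1) LG ->
  0 < t -> t < T -> ip (G t - V t) (V t) = 0 ->
  (forall e, 0 < e -> exists2 s, 0 <= s < t & forall r, s <= r -> r < t ->
     N (V r) ^+ 2 <= N (V t) ^+ 2 + e) ->
  lderiv X t (V t).
Proof.
move=> LX0 LG0 lX lG t0 tT GV left_cont e e0.
pose v := V t; pose g := G t.
pose A := LX + N g; have A0 : 0 <= A by rewrite addr_ge0 ?snorm_ge0.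
pose C := LX ^+ 2 / 2 + (N g * LX + 2 * LG * LX).
have C0 : 0 <= C.
  by rewrite !addr_ge0 ?mulr_ge0 ?snorm_ge0 ?sqr_ge0.
pose e4 := e ^+ 2 / 4; have e40 : 0 < e4 by rewrite divr_gt0// exprn_gt0.
have [s /andP[s0 st] sV] := left_cont _ e40.
pose e1 := e4 / (2 * A + 1).
have A1 : 0 < 2 * A + 1 by rewrite ltr_wpDl// mulr_ge0.
have e10 : 0 < e1 by rewrite divr_gt0.
have e1A : e1 * (2 * A) <= e4.
  rewrite (@le_trans _ _ (e1 * (2 * A + 1)))//; last by rewrite /e1 divfK// gt_eqF.
  by rewrite ler_wpM2l ?lerDl// ltW.
have [d d0 hd] := dX (ltW t0) e10.
pose k := Num.min 1 d / 2.
have m0 : 0 < Num.min 1 d by rewrite lt_min ltr01.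
have k0 : 0 < k by rewrite divr_gt0.
have : k < Num.min 1 d by rewrite /k; lra.
rewrite lt_min => /andP[/ltW k1 kd].
pose U := X (t + k) - X t.
have NU : N (U - k *: v) <= e1 * k by exact: hd.
(* The last bound makes errors quadratic in [h] negligible against [k * h]. *)
pose d' := Num.min (t - s) (Num.min 1 (k * e4 / (2 * C + 1))).
have C1 : 0 < 2 * C + 1 by rewrite ltr_wpDl// mulr_ge0.
exists d'; first by rewrite !lt_min subr_gt0 st ltr01 divr_gt0// mulr_gt0.
move=> h h0; rewrite !lt_min => /and3P[hts /ltW h1 hC].
have hC' : h * (2 * C) <= k * e4.
  rewrite (@le_trans _ _ (h * (2 * C + 1)))//.
    by rewrite ler_wpM2l ?lerDl// ltW.
  by rewrite -ler_pdivlMr// ltW.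
pose E := X t - X (t - h).
have th0 : 0 <= t - h by lra.
have tht : t - h <= t by lra.
have tT1 : t <= T + 1 by lra.
have tth : t - (t - h) = h by ring.
have NE : N E <= LX * h.
  by have := lX _ _ th0 tht tT1; rewrite tth.
have NE2 : N E ^+ 2 <= h ^+ 2 * (N v ^+ 2 + e4).
  pose M := Num.sqrt (N v ^+ 2 + e4).
  have ve0 : 0 <= N v ^+ 2 + e4 by rewrite addr_ge0 ?sqr_ge0// ltW.
  have M0 : 0 <= M by exact: sqrtr_ge0.
  suff : ip E E <= h * (M * N E).
    rewrite -sqr_snorm => EE; have NEM : N E <= h * M.
      have [->|n0] := eqVneq (N E) 0; first by rewrite mulr_ge0// ltW.
      by rewrite -(@ler_pM2r _ (N E)) ?lt_def ?n0 ?snorm_ge0// -expr2 -mulrA.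
    by rewrite -(sqr_sqrtr ve0) -exprMn lerXn2r// nnegrE ?snorm_ge0 ?mulr_ge0 ?(ltW h0).
  have := @dini_affine R (fun r => ip (X r) E) (t - h) t (LX * N E) 0 (M * N E) set0 tht.
  rewrite mul0r mul0r addr0 tth => dini.
  suff : ip (X t) E <= ip (X (t - h)) E + M * N E * h by rewrite {2}/E innerDl innerNl; lra.
  apply: dini => //.
  - by rewrite mulr_ge0// snorm_ge0.
  - move=> a b ta ab bt; rewrite addrC -lerBlDr -innerNl -innerDl.
    rewrite (le_trans (cauchy_schwarz _ _ _))// mulrAC ler_wpM2r ?snorm_ge0//.
    by apply: lX => //; lra.
  - exact: negligible_set0.
  - move=> r tr rt _ e' e'0; have r0 : 0 <= r by lra.
    have [d1 d10 hd1] := rderiv_inner E (dX r0) e'0.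
    exists d1 => // x x0 /(hd1 _ x0) hx; apply: le_trans hx _.
    rewrite lerD2r lerD2l ler_wpM2l ?(ltW x0)// mul0r add0r.
    rewrite (le_trans (cauchy_schwarz _ _ _))// ler_wpM2r ?snorm_ge0//.
    rewrite -[leLHS](ger0_norm (snorm_ge0 _ _)) -sqrtr_sqr ler_wsqrtr// sV//; lra.
(* The evolution inequality on [[t - h, t]], tested with [X (t + k)]. *)
have EU : h * ip g U - N E ^+ 2 / 2 - h ^+ 2 * (N g * LX + 2 * LG * LX) <= ip E U.
  pose Z := X (t + k).
  have tk0 : 0 <= t + k by rewrite addr_ge0// ltW.
  pose b := 2 * (- ip g U + h * (N g * LX + 2 * LG * LX)).
  have := @evi_affine R H ip K X G lipX eviX Z (t - h) t 0 b (KX tk0) th0 tht (lexx _).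
  rewrite mul0r mul0r addr0 tth.
  have -> : X t - Z = - U by rewrite /Z /U opprB.
  have -> : X (t - h) - Z = - (E + U) by rewrite /Z /U /E; vec R H.
  rewrite !innerNl !innerNr !opprK => ev.
  suff: ip U U <= ip (E + U) (E + U) + b * h.
    by rewrite (inner_sqrD E U) -(sqr_snorm _ E) /b => UU; lra.
  apply: ev => r tr rt; rewrite mul0r add0r /b ler_wpM2l//.
  have r0 : 0 <= r by lra.
  have -> : ip (G r) (X r - Z) = - ip g U + (- ip g (X t - X r) - ip (g - G r) (X r - Z)).
    have UE : U = Z - X t by [].
    by rewrite UE !innerE; ring.
  rewrite lerD2l.
  have lr : N (X t - X r) <= LX * h.
    apply: le_trans (lX _ _ r0 (ltW rt) tT1) _; rewrite ler_wpM2l//; lra.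
  have lg : N (g - G r) <= LG * h.
    apply: le_trans (lG _ _ r0 (ltW rt) tT1) _; rewrite ler_wpM2l//; lra.
  have lz : N (X r - Z) <= LX * 2.
    rewrite snormB (le_trans (lX r (t + k) r0 _ _))//; [lra|lra|].
    rewrite ler_wpM2l//; lra.
  have c1 : - ip g (X t - X r) <= N g * (LX * h).
    rewrite -innerNr (le_trans (cauchy_schwarz _ _ _))// snormN.
    by rewrite ler_wpM2l ?snorm_ge0.
  have c2 : - ip (g - G r) (X r - Z) <= (LG * h) * (LX * 2).
    rewrite -innerNr (le_trans (cauchy_schwarz _ _ _))// snormN.
    by rewrite ler_pM ?snorm_ge0.
  lra.
have gv : ip g v = N v ^+ 2.
  by move: GV; rewrite sqr_snorm innerDl innerNl => /eqP; rewrite subr_eq0 => /eqP.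
have EV : h * (k * N v ^+ 2) - h * (k * (e1 * A)) - h * (h * C) <= k * ip E v.
  have [r UE Nr] : exists2 r, U = k *: v + r & N r <= e1 * k.
    by exists (U - k *: v) => //; rewrite addrC subrK.
  have c1 : ip E r <= (LX * h) * (e1 * k).
    by rewrite (le_trans (cauchy_schwarz _ _ _))// ler_pM ?snorm_ge0.
  have c2 : - ip g r <= N g * (e1 * k).
    rewrite -innerNr (le_trans (cauchy_schwarz _ _ _))// snormN.
    by rewrite ler_wpM2l ?snorm_ge0.
  have c3 : N E ^+ 2 <= h ^+ 2 * LX ^+ 2.
    by rewrite -exprMn lerXn2r ?nnegrE ?snorm_ge0 ?mulr_ge0 ?(ltW h0)// mulrC.
  have c4 : h * - ip g r <= h * (N g * (e1 * k)).
    by rewrite ler_wpM2l// ltW.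
  move: EU c1 c2 c3 c4.
  rewrite UE (innerDr _ g) (innerZr _ _ g) (innerDr _ E) (innerZr _ _ E) gv /A /C.
  move: (ip E r) (ip g r) (N E ^+ 2) (ip E v) (N v ^+ 2) (N g) => p q n x y z.
  clear; move=> *; lra.
have key : ip E v >= h * (N v ^+ 2 - e1 * A) - h * (h * C / k).
  rewrite -(@ler_pM2l _ k)//; apply: le_trans EV.
  by rewrite le_eqVlt; apply/orP; left; apply/eqP; field; rewrite gt_eqF.
apply: snorm_le; first by rewrite mulr_ge0// ltW.
have -> : ip (X t - X (t - h) - h *: V t) (X t - X (t - h) - h *: V t) =
   N E ^+ 2 - 2 * h * ip E v + h ^+ 2 * N v ^+ 2.
  exact: inner_sqrBZ.
have hk : 2 * (h * C / k) <= e4.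
  by rewrite mulrA ler_pdivrMr// [e4 * k]mulrC mulrCA.
have key2 : h * ip E v >= h * (h * (N v ^+ 2 - e1 * A) - h * (h * C / k)).
  by rewrite ler_wpM2l// ltW.
have f1 : h ^+ 2 * (e1 * (2 * A)) <= h ^+ 2 * e4 by rewrite ler_wpM2l ?sqr_ge0.
have f2 : h ^+ 2 * (2 * (h * C / k)) <= h ^+ 2 * e4 by rewrite ler_wpM2l ?sqr_ge0.
have -> : (e * h) ^+ 2 = 4 * (h ^+ 2 * e4) by rewrite /e4; field.
have f3 : 0 <= h ^+ 2 * e4 by rewrite mulr_ge0 ?sqr_ge0// ltW.
move: key2 f2; set w := h * C / k => key2 f2.
lra.
Qed.

Lemma ae_two_sided : (forall t, 0 <= t -> ip (G t - V t) (V t) = 0) ->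
  exists2 E : set (measurableTypeR R), mu.-negligible E &
  forall t, 0 < t -> ~ E t -> lderiv X t (V t).
Proof.
move=> GV.
have stepT (n : nat) : exists E : set (measurableTypeR R), mu.-negligible E /\
    forall t, 0 < t -> t < n%:R -> ~ E t -> lderiv X t (V t).
  pose T : R := n%:R.
  have [LX LX0 lX] := lipX (T + 1); have [LG LG0 lG] := lipG (T + 1).
  pose c := 2 * LG * LX; have c0 : 0 <= c by rewrite !mulr_ge0.
  pose F r := c * r - N (V r) ^+ 2.
  have F_nd x y : 0 <= x -> x <= y -> y < T -> F x <= F y.
    move=> x0 xy /ltW yT.
    have := speed_almost_nonincreasing LX0 LG0 lX lG x0 xy yT.
    rewrite /F -/c; lra.
  have cF := left_jumps_countable F_nd.
  set E := [set x | _] in cF.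
  exists E; split.
    apply/negligibleP; last exact: countable_lebesgue_measure0.
    by apply: countable_measurable => // t; exact: measurable_set1.
  move=> t t0 tT nE.
  apply: (lderiv_of_left_continuous LX0 LG0 lX lG t0 tT (GV _ (ltW t0))).
  move=> e e0; apply: contrapT => left_jump.
  apply: nE; split; first by rewrite t0.
  exists e => // s s0 st; rewrite leNgt; apply/negP => Fs; apply: left_jump.
  exists s; first by rewrite s0.
  move=> r sr rt; have := F_nd _ _ s0 sr (lt_trans rt tT).
  have : c * r <= c * t by rewrite ler_wpM2l// ltW.
  move: Fs; rewrite /F => *; lra.
have [E EP] := choice stepT.
exists (\bigcup_n E n); first by apply: negligible_bigcup => k; case: (EP k).
move=> t t0 nE.
have [n tn] : exists n : nat, t < n%:R.
  by exists (Num.bound t); exact: archi_boundP (ltW t0).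
by apply: (EP n).2 => // En; apply: nE; exists n.
Qed.

End TwoSided.

(** * Primitives of continuous curves *)

Section Primitive.
Variables (R : realType) (H : lmodType R) (ip : semi_inner H).
Local Notation N := (snorm ip).
Implicit Types (t s h k e a b L c d T eta : R).

Definition loc_ucont (f : R -> H) := forall T e, 0 < e ->
  exists2 d : R, 0 < d & forall s t, 0 <= s -> s <= t -> t <= T ->
    t - s <= d -> N (f t - f s) <= e.

(** Antiderivatives are described by a uniform mean value property, which
    determines [J] up to null vectors and is stable under limits of Riemann sums. *)
Definition primitive (f J : R -> H) := N (J 0) = 0 /\
  forall T e, 0 < e -> exists2 eta : R, 0 < eta & forall a b, 0 <= a -> a <= b ->
    b <= T -> b - a <= eta -> N (J b - J a - (b - a) *: f a) <= (b - a) * e.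

Lemma local_to_global_lip (D : R -> H) T eta M : 0 < eta ->
  (forall a b, 0 <= a -> a <= b -> b <= T -> b - a <= eta ->
     N (D b - D a) <= (b - a) * M) ->
  forall a b, 0 <= a -> a <= b -> b <= T -> N (D b - D a) <= (b - a) * M.
Proof.
move=> eta0 loc a b a0 ab bT.
have [n bn] : exists n : nat, b - a <= n%:R * eta.
  exists (Num.bound ((b - a) / eta)).
  rewrite -ler_pdivrMr//; apply/ltW/archi_boundP.
  by rewrite divr_ge0 ?subr_ge0// ltW.
elim: n b ab bT bn => [b ab bT|n IH b ab bT bn].
  rewrite mul0r subr_le0 => ba; have -> : b = a by apply/le_anti/andP.
  by rewrite !subrr snorm0 mul0r.
have [be|eb] := leP (b - a) eta; first exact: loc.
have h1 : a <= b - eta by lra.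
have h2 : b - eta <= T by lra.
have h3 : b - eta - a <= n%:R * eta by move: bn; rewrite mulrSr mulrDl mul1r; lra.
have h4 := IH _ h1 h2 h3.
have h5 : N (D b - D (b - eta)) <= (b - (b - eta)) * M by apply: loc => //; lra.
have := snorm_triangle ip (D (b - eta)) (D b) (D a) => h6; lra.
Qed.

Lemma primitive_lip f J T M : primitive f J ->
  (forall t, 0 <= t -> t <= T -> N (f t) <= M) -> lip_until ip J T M.
Proof.
move=> [_ Jf] fM a b a0 ab bT; rewrite mulrC.
have [->|nab] := eqVneq a b; first by rewrite !subrr snorm0 mul0r.
have ba0 : 0 < b - a by rewrite subr_gt0 lt_neqAle nab.
apply: (@eps_ler R) => e e0.
have [eta eta0 mv] := Jf T _ (divr_gt0 e0 ba0).
have -> : (b - a) * M + e = (b - a) * (M + e / (b - a)).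
  by field; rewrite gt_eqF.
apply: (@local_to_global_lip J T eta) => // x y x0 xy yT xye.
have := mv x y x0 xy yT xye; set r := _ - _ *: _ => Nr.
have -> : J y - J x = (y - x) *: f x + r by rewrite /r; vec R H.
apply: le_trans (snormD _ _ _) _; rewrite mulrDr lerD// snormZ ger0_norm ?subr_ge0//.
by rewrite ler_wpM2l ?subr_ge0// fM// (le_trans xy).
Qed.

Lemma primitive_rderiv f J t : primitive f J -> 0 <= t -> rderiv ip J t (f t).
Proof.
move=> [_ Jf] t0 e e0; have [eta eta0 mv] := Jf (t + 1) e e0.
exists (Num.min 1 eta); first by rewrite lt_min ltr01.
move=> h h0; rewrite lt_min => /andP[h1 he].
have := mv t (t + h) t0; rewrite lerDl (ltW h0) lerD2l (ltW h1).
by rewrite [t + h - t]addrAC subrr add0r (ltW he) mulrC; apply.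
Qed.

Lemma primitive_riemann_sum f J T e : primitive f J -> 0 < e ->
  exists2 eta : R, 0 < eta & forall (tau : R) n, 0 <= tau -> tau <= eta ->
    n%:R * tau <= T ->
    N (J (n%:R * tau) - tau *: \sum_(i < n) f (i%:R * tau)) <= n%:R * tau * e.
Proof.
move=> [J0 Jf] e0; have [eta eta0 mv] := Jf T e e0; exists eta => // tau n tau0 te.
elim: n => [_|n IH nT].
  by rewrite big_ord0 mul0r scaler0 subr0 J0 mul0r.
have nT' : n%:R * tau <= T.
  by rewrite (le_trans _ nT)// ler_wpM2r// ler_nat.
have := IH nT'; rewrite big_ord_recr/=.
set S := \sum_(i < n) _ => h1.
have nE : n.+1%:R * tau - n%:R * tau = tau by rewrite mulrSr; ring.
have := mv (n%:R * tau) (n.+1%:R * tau); rewrite nE mulr_ge0// => /(_ isT) h2.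
have := h2 _ nT te; rewrite ler_wpM2r ?ler_nat// => /(_ isT).
have -> : J (n.+1%:R * tau) - tau *: (S + f (n%:R * tau)) =
  (J (n.+1%:R * tau) - J (n%:R * tau) - tau *: f (n%:R * tau)) +
  (J (n%:R * tau) - tau *: S) by vec R H.
move=> h3; apply: le_trans (snormD _ _ _) _.
have -> : n.+1%:R * tau * e = tau * e + n%:R * tau * e by rewrite mulrSr; ring.
exact: lerD.
Qed.

Section Construction.
Variable f : R -> H.

Let delta n : R := n.+1%:R^-1.
Let coef n i t : R := Num.min t (i.+1%:R * delta n) - Num.min t (i%:R * delta n).
Let Jn n t : H := \sum_(i < n.+1 ^ 2) coef n i t *: f (i%:R * delta n).

Lemma delta_gt0 n : 0 < delta n.
Proof. by rewrite invr_gt0. Qed.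

Lemma coef_sum n m t : 0 <= t -> t <= m%:R * delta n ->
  \sum_(i < m) coef n i t = t.
Proof.
move=> t0 tm; have -> : \sum_(i < m) coef n i t =
    Num.min t (m%:R * delta n) - Num.min t (0%:R * delta n).
  rewrite -(telescope_sumr (fun i => Num.min t (i%:R * delta n)) (leq0n m)).
  by rewrite big_mkord.
by rewrite mul0r (min_idPl tm) (min_idPr t0) subr0.
Qed.

Lemma coef_mono n i a b : a <= b -> coef n i a <= coef n i b.
Proof.
move=> ab; rewrite /coef; set p := i%:R * _; set q := i.+1%:R * _.
have pq : p <= q by rewrite ler_wpM2r ?ler_nat// ltW// delta_gt0.
by case: (leP a q); case: (leP a p); case: (leP b q); case: (leP b p); lra.
Qed.

(** Only the cells that meet [[a, b]] contribute to an increment from [a] to [b]. *)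
Lemma coef_changes n i a b : a <= b -> coef n i b != coef n i a ->
  a - delta n <= i%:R * delta n <= b.
Proof.
move=> ab; apply: contraR; rewrite negb_and -!ltNge /coef => h.
set p := i%:R * _ in h *; set q := i.+1%:R * _.
have qE : q = p + delta n by rewrite /q mulrSr mulrDl mul1r.
have := delta_gt0 n; apply/implyP/eqP.
rewrite qE; move: (delta n) h => d.
case/orP => h; apply/eqP/implyP => d0.
  rewrite !(min_idPr _) ?(ltW _)//; lra.
rewrite !(min_idPl _) ?subrr//; lra.
Qed.

Lemma Jn_mean n T e a b : T <= n.+1%:R -> 0 <= a -> a <= b -> b <= T ->
  (forall r, 0 <= r -> a - delta n <= r -> r <= b -> N (f r - f a) <= e) ->
  N (Jn n b - Jn n a - (b - a) *: f a) <= (b - a) * e.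
Proof.
move=> Tn a0 ab bT fe.
have Kd : (n.+1 ^ 2)%:R * delta n = n.+1%:R.
  by rewrite natrX expr2 -mulrA mulfV ?mulr1// gt_eqF.
have cE t : 0 <= t -> t <= T -> t = \sum_(i < n.+1 ^ 2) coef n i t.
  by move=> t0 tT; rewrite coef_sum// Kd (le_trans tT).
have baE : b - a = \sum_(i < n.+1 ^ 2) (coef n i b - coef n i a).
  by rewrite sumrB -!cE//; [exact: le_trans bT|exact: le_trans ab].
have -> : Jn n b - Jn n a - (b - a) *: f a =
   \sum_(i < n.+1 ^ 2) (coef n i b - coef n i a) *: (f (i%:R * delta n) - f a).
  rewrite [in LHS]baE scaler_suml /Jn -!sumrB; apply: eq_bigr => i _.
  by vec R H.
apply: le_trans (snorm_sum _ _ _ _) _.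
rewrite baE mulr_suml; apply: ler_sum => i _; rewrite snormZ.
rewrite ger0_norm ?subr_ge0 ?coef_mono//.
have [->|ne] := eqVneq (coef n i b) (coef n i a); first by rewrite subrr !mul0r.
have /andP[h1 h2] := coef_changes ab ne.
rewrite ler_wpM2l ?subr_ge0 ?coef_mono// fe//.
by rewrite mulr_ge0// ltW// delta_gt0.
Qed.

(** The integrals [Jn] of step functions, where [coef n i t] is the length of the
    part of the cell [i] that lies below [t], satisfy the mean value property uniformly
    in [n]. Comparing two of them over short intervals shows that they form a Cauchy
    sequence. *)
Lemma primitive_exists : scomplete ip -> loc_ucont f -> exists J, primitive f J.
Proof.
move=> cH fc.
have Jn0 n : Jn n 0 = 0.
  rewrite /Jn big1// => i _; rewrite /coef !(min_idPl _) ?subrr ?scale0r//.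
    by rewrite mulr_ge0// ltW// delta_gt0.
  by rewrite mulr_ge0// ltW// delta_gt0.
have mv T e : 0 < e -> exists2 eta : R, 0 < eta & exists n0, forall n,
    (n0 <= n)%N -> forall a b, 0 <= a -> a <= b -> b <= T -> b - a <= eta ->
    N (Jn n b - Jn n a - (b - a) *: f a) <= (b - a) * e.
  move=> e0; have [d d0 fd] := fc T e e0; exists d => //.
  have [n1 _ n1P] := near_infty_natSinv_lt (PosNum d0).
  exists (maxn n1 (Num.bound T)) => n; rewrite geq_max => /andP[/n1P/= dn Tn] a b a0 ab bT abd.
  have := @Jn_mean n T e a b; apply => //.
    have [T0|/ltW T0] := leP 0 T; last by rewrite (le_trans T0).
    apply/ltW; apply: lt_le_trans (archi_boundP T0) _.
    by rewrite ler_nat (leq_trans Tn).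
  move=> r r0 ar rb; have [ra|/ltW ra] := leP a r.
    by apply: fd => //; lra.
  rewrite snormB; apply: fd => //; first exact: le_trans ab bT.
  rewrite /delta in ar; move: dn ar; move: (n.+1%:R^-1) => x; lra.
have close T e : 0 < e -> exists n0, forall i j, (n0 <= i)%N -> (n0 <= j)%N ->
    forall t, 0 <= t -> t <= T -> N (Jn i t - Jn j t) <= t * e.
  move=> e0; have e2 : 0 < e / 2 by rewrite divr_gt0.
  have [eta eta0 [n0 n0P]] := mv T _ e2; exists n0 => i j ni nj t t0 tT.
  have := @local_to_global_lip (fun t => Jn i t - Jn j t) T eta e eta0 _ 0 t (lexx _) t0 tT.
  rewrite !Jn0 !subr0; apply => a b a0 ab bT abe.
  have h1 := n0P i ni a b a0 ab bT abe; have h2 := n0P j nj a b a0 ab bT abe.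
  have -> : Jn i b - Jn j b - (Jn i a - Jn j a) =
    (Jn i b - Jn i a - (b - a) *: f a) - (Jn j b - Jn j a - (b - a) *: f a).
    by vec R H.
  apply: le_trans (snormD _ _ _) _; rewrite snormN; lra.
have lim t : exists x, 0 <= t -> slim ip (Jn ^~ t) x.
  have [t0|t0] := leP 0 t; last by exists 0.
  have [|x hx] := cH (Jn ^~ t); last by exists x.
  move=> e e0; have t1 : 0 < t + 1 by rewrite ltr_wpDl.
  have [n0 n0P] := close t _ (divr_gt0 e0 t1).
  exists n0 => i j ni nj; apply: le_trans (n0P i j ni nj t t0 (lexx _)) _.
  by rewrite mulrA ler_pdivrMr// mulrC ler_wpM2l ?(ltW e0)// lerDl.
have [J JP] := choice lim; exists J; split.
  apply/le_anti; rewrite snorm_ge0 andbT; apply: (@eps_ler R) => e e0.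
  have [n /(_ n (leqnn n))] := JP 0 (lexx _) e e0.
  by rewrite Jn0 sub0r snormN add0r.
move=> T e e0; have [eta eta0 [n0 n0P]] := mv T _ e0; exists eta => // a b a0 ab bT abe.
apply: (@eps_ler R) => e' e'0; have e2 : 0 < e' / 2 by rewrite divr_gt0.
have [n1 n1P] := JP a a0 _ e2; have [n2 n2P] := JP b (le_trans a0 ab) _ e2.
pose n := maxn n0 (maxn n1 n2).
have h0 := n0P n (leq_maxl _ _) a b a0 ab bT abe.
have h1 := n1P n (leq_trans (leq_maxl n1 n2) (leq_maxr _ _)).
have h2 := n2P n (leq_trans (leq_maxr n1 n2) (leq_maxr _ _)).
have -> : J b - J a - (b - a) *: f a =
  (Jn n b - Jn n a - (b - a) *: f a) + ((Jn n a - J a) - (Jn n b - J b)) by vec R H.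
apply: le_trans (snormD _ _ _) _; apply: lerD => //.
apply: le_trans (snormD _ _ _) _; rewrite snormN; lra.
Qed.

End Construction.

End Primitive.

(** * The space of square integrable functions and the monotone cone *)

Lemma limn_einf_le (R : realType) (u : nat -> \bar R) (c : \bar R) j :
  (forall k, (j <= k)%N -> (u k <= c)%E) -> (limn_einf u <= c)%E.
Proof.
move=> uc; rewrite limn_einf_lim; apply: lime_le; first exact: is_cvg_einfs.
apply: nearW => n; apply: le_trans (uc (maxn n j) (leq_maxr _ _)).
by apply: ereal_inf_lbound; exists (maxn n j) => //=; exact: leq_maxl.
Qed.

Lemma halfpow_lt (R : realType) (e : R) : 0 < e -> exists j : nat, 2^-1 ^+ j < e.
Proof.
move=> e0; have h : `|2^-1 : R| < 1 by rewrite ger0_norm ?invr_ge0//; lra.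
have /cvgrPdist_lt /(_ e e0) [j _ /(_ j (leqnn j))] := cvg_expr h.
by rewrite sub0r normrN ger0_norm ?exprn_ge0// => ?; exists j.
Qed.

Lemma ae_filter_leb_Omega (R : realType) : Filter (almost_everywhere (leb_Omega R)).
Proof. exact: ae_filter_ringOfSetsType. Qed.

#[local] Hint Extern 0 (Filter _) => exact: ae_filter_leb_Omega : typeclass_instances.

Section L2Space.
Variable R : realType.
Local Notation mu := (leb_Omega R).
Local Notation T := (measurableTypeR R).
Implicit Types (U W X Y Z : L2 R) (f g : R -> R).

Lemma L2D U W m : (U + W) m = U m + W m. Proof. by []. Qed.
Lemma L2B U W m : (U - W) m = U m - W m. Proof. by []. Qed.
Lemma L2Z (a : R) U m : (a *: U) m = a * U m. Proof. by []. Qed.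
Lemma L2_0 m : (0 : L2 R) m = 0. Proof. by []. Qed.
Lemma L2_measurable U : measurable_fun [set: T] U.
Proof. by []. Qed.

Lemma L2_mul_integrable U W : mu.-integrable setT (EFin \o (fun m => U m * W m)).
Proof. exact/Lfun1_integrable/(Lfun2_mul_Lfun1 (LfunP U) (LfunP W)). Qed.

Lemma L2innerC U W : L2inner U W = L2inner W U.
Proof. by apply: eq_Rintegral => m _; rewrite mulrC. Qed.

Lemma L2innerDl U W Z : L2inner (U + W) Z = L2inner U Z + L2inner W Z.
Proof.
rewrite /L2inner -RintegralD//; try exact: L2_mul_integrable.
by apply: eq_Rintegral => m _; rewrite L2D mulrDl.
Qed.

Lemma L2innerZl (a : R) U W : L2inner (a *: U) W = a * L2inner U W.
Proof.
rewrite /L2inner -RintegralZl//; try exact: L2_mul_integrable.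
by apply: eq_Rintegral => m _; rewrite L2Z mulrA.
Qed.

Lemma L2inner_ge0 U : 0 <= L2inner U U.
Proof. by apply: Rintegral_ge0 => m _; rewrite -expr2 sqr_ge0. Qed.

Definition L2_inner : semi_inner (L2 R) :=
  SemiInner L2innerC L2innerDl L2innerZl L2inner_ge0.

Local Notation ip := L2_inner.
Local Notation N := (snorm ip).

Lemma L2inner_intE U W :
  (L2inner U W)%:E = (\int[mu]_m (U m * W m)%:E)%E.
Proof. by rewrite fineK//; apply: integrable_fin_num => //; exact: L2_mul_integrable. Qed.

Lemma sqr_snorm_intE U : (N U ^+ 2)%:E = (\int[mu]_m (U m ^+ 2)%:E)%E.
Proof.
rewrite sqr_snorm; apply: etrans (L2inner_intE U U) _.
by apply: eq_integral => m _; rewrite expr2.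
Qed.

Lemma L2normE U : L2norm U = N U.
Proof.
apply/eqP; rewrite -(@eqrXn2 _ 2)//; last 2 first.
- by rewrite fine_ge0// Lnorm_ge0.
- exact: snorm_ge0.
apply/eqP/EFin_inj; rewrite sqr_snorm_intE.
have e : (L2norm U)%:E = 'N[mu]_2%:E[EFin \o U]%E by rewrite finite_norm_fine.
rewrite -powR_mulrn ?fine_ge0 ?Lnorm_ge0// -poweR_EFin e.
rewrite poweR_Lnorm//; apply: eq_integral => m _.
by rewrite [X in (X `^ _)%E](_ : _ = (`|U m|)%:E)// poweR_EFin powR_mulrn// real_normK// num_real.
Qed.

Lemma snorm_int_le U (a : R) : 0 <= a ->
  (\int[mu]_m (U m ^+ 2)%:E <= (a ^+ 2)%:E)%E -> N U <= a.
Proof.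
move=> a0; rewrite -sqr_snorm_intE lee_fin => h.
by rewrite -(@ler_pXn2r _ 2)// nnegrE snorm_ge0.
Qed.

Lemma L2_sqr_measurable U : measurable_fun [set: T] (fun m => (U m ^+ 2)%:E).
Proof. by apply/measurable_EFinP; exact: measurable_funX. Qed.

Lemma in_L2 f : measurable_fun [set: T] f ->
  (\int[mu]_m (f m ^+ 2)%:E < +oo)%E -> f \in Lfun mu 2%:E.
Proof.
move=> mf fi; rewrite inE; apply/andP; split; rewrite inE//=.
rewrite /finite_norm unlock; apply: poweR_lty.
apply: le_lt_trans fi; rewrite le_eqVlt; apply/orP; left; apply/eqP.
apply: eq_integral => m _.
by rewrite [X in (X `^ _)%E](_ : _ = (`|f m|)%:E)// poweR_EFin powR_mulrn// real_normK// num_real.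
Qed.

(** The value [0] outside [L^2] spares a membership proof in the definitions
    that use it. *)
Definition toL2 f : L2 R :=
  if pselect (f \in Lfun mu 2%:E) is left fP then Lfun_Sub (lee1n 2) fP else 0.

Lemma toL2E f : f \in Lfun mu 2%:E -> toL2 f = f :> (R -> R).
Proof. by rewrite /toL2; case: pselect => // fP _. Qed.

Lemma leb_OmegaT : mu setT = 1%E.
Proof.
rewrite /leb_Omega/= /mrestr setTI /Omega lebesgue_measure_itv/= lte_fin ltr01.
by rewrite oppr0 adde0.
Qed.

Lemma ae_Omega : \forall m \ae mu, Omega (m : R).
Proof.
exists (~` (@Omega R)); split => //.
- by apply: measurableC; exact: measurable_Omega.
- by rewrite /leb_Omega/= /mrestr setICl measure0.
Qed.

Lemma ae_ex_itv (P : R -> Prop) (a b : R) : (\forall m \ae mu, P m) ->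
  0 <= a -> a < b -> b <= 1 -> exists m, [/\ P m, a < m & m < b].
Proof.
move=> [A [mA A0 PA]] a0 ab b1; apply: contrapT => nex.
have sub : `]a, b[ `<=` A.
  move=> m /=; rewrite in_itv/= => /andP[am mb]; apply: PA => /= Pm.
  by apply: nex; exists m.
have : (mu (`]a, b[%classic : set T) <= mu A)%E.
  by apply: le_measure; rewrite ?inE//; exact: measurable_itv.
rewrite A0 /leb_Omega/= /mrestr setIidl; last first.
  move=> m /=; rewrite /Omega/= !in_itv/= => /andP[am mb].
  by rewrite (le_lt_trans a0)//= (lt_le_trans mb).
rewrite lebesgue_measure_itv/= lte_fin ab -EFinB lee_fin; lra.
Qed.

Lemma L2_const_in (a : R) : (cst a : R -> R) \in Lfun mu 2%:E.
Proof.
apply: in_L2; first exact: measurable_cst.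
have -> : (\int[mu]_m (cst a m ^+ 2)%:E)%E = (a ^+ 2)%:E; last exact: ltry.
by apply: etrans (integral_cst mu measurableT (a ^+ 2)%:E) _; rewrite leb_OmegaT mule1.
Qed.

Definition L2cst (a : R) : L2 R := toL2 (cst a).

Lemma L2cstE (a : R) m : L2cst a m = a.
Proof. by rewrite /L2cst toL2E// L2_const_in. Qed.

Lemma snorm_cst (a : R) : N (L2cst a) = `|a|.
Proof.
apply/eqP; rewrite -(@eqrXn2 _ 2)// ?snorm_ge0//; apply/eqP/EFin_inj.
rewrite sqr_snorm_intE; under eq_integral do rewrite L2cstE.
by rewrite integral_cst// leb_OmegaT mule1 real_normK// num_real.
Qed.

Lemma le_L2_in f U (c : R) : measurable_fun [set: T] f ->
  (\forall m \ae mu, `|f m| <= c * (1 + `|U m|)) -> f \in Lfun mu 2%:E.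
Proof.
move=> mf fU; apply: in_L2 => //.
pose W : L2 R := L2cst 1 + toL2 (fun m => `|U m|).
have absU : (fun m => `|U m|) \in Lfun mu 2%:E.
  apply: in_L2; first exact: measurableT_comp.
  under eq_integral do rewrite real_normK ?num_real//.
  by rewrite -sqr_snorm_intE ltry.
apply: (@le_lt_trans _ _ (\int[mu]_m ((c *: W) m ^+ 2)%:E)%E); last first.
  by rewrite -sqr_snorm_intE ltry.
apply: ae_ge0_le_integral => //.
- by move=> m _; rewrite lee_fin sqr_ge0.
- by apply/measurable_EFinP; exact: measurable_funX.
- by move=> m _; rewrite lee_fin sqr_ge0.
- exact: L2_sqr_measurable.
- apply: filterS fU => m h _; rewrite lee_fin L2Z L2D L2cstE (toL2E absU).
  rewrite -(real_normK (num_real (f m))) lerXn2r ?nnegrE//.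
  exact: le_trans h.
Qed.

Lemma snorm_ae_le U W : (\forall m \ae mu, `|U m| <= `|W m|) -> N U <= N W.
Proof.
move=> UW; apply: snorm_int_le; first exact: snorm_ge0.
rewrite sqr_snorm_intE; apply: ae_ge0_le_integral => //.
- by move=> m _; rewrite lee_fin sqr_ge0.
- exact: L2_sqr_measurable.
- by move=> m _; rewrite lee_fin sqr_ge0.
- exact: L2_sqr_measurable.
- apply: filterS UW => m h _; rewrite lee_fin.
  by rewrite -(real_normK (num_real (U m))) -(real_normK (num_real (W m))) lerXn2r ?nnegrE.
Qed.

Lemma snorm_ae_eq U W : (\forall m \ae mu, U m = W m) -> N (U - W) = 0.
Proof.
move=> UW; apply/le_anti; rewrite snorm_ge0 andbT -(snorm0 ip).
by apply: snorm_ae_le; apply: filterS UW => m e; rewrite L2B e subrr.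
Qed.

Lemma ae_eq_snorm U : N U = 0 -> \forall m \ae mu, U m = 0.
Proof.
by rewrite -L2normE => /fine_Lnormr_eq0; apply: filterS => m; apply.
Qed.

Lemma L1norm_inner U : exists2 A : L2 R, forall m, A m = `|U m| & L1norm U = ip A (L2cst 1).
Proof.
have absU : (fun m => `|U m|) \in Lfun mu 2%:E.
  apply: (@le_L2_in _ U 1); first exact: measurableT_comp.
  by apply: nearW => m; rewrite normr_id mul1r lerDr.
exists (toL2 (fun m => `|U m|)); first by move=> m; rewrite toL2E.
rewrite /L1norm Lnorm1; congr fine; apply: eq_integral => m _.
by rewrite L2cstE mulr1 toL2E.
Qed.

Lemma L1norm_le U : L1norm U <= N U.
Proof.
have [A AE ->] := L1norm_inner U.
rewrite (le_trans (cauchy_schwarz _ _ _))// snorm_cst normr1 mulr1.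
by apply: snorm_ae_le; apply: nearW => m; rewrite AE normr_id.
Qed.

Lemma int_norm_le U : (\int[mu]_m (`|U m|)%:E <= (N U)%:E)%E.
Proof.
have -> : (\int[mu]_m (`|U m|)%:E)%E = (L1norm U)%:E; last by rewrite lee_fin L1norm_le.
rewrite /L1norm Lnorm1 fineK//.
have /Lfun1_integrable/integrableP[_ h] : (U : R -> R) \in Lfun mu 1.
  by apply: Lfun_subset12; [rewrite leb_OmegaT|exact: LfunP].
by rewrite ge0_fin_numE// integral_ge0.
Qed.

(** On a space of measure one the [L^1] norms are summable as well, so the
    integral of the sum is finite. *)
Lemma ae_summable (g : nat -> L2 R) : (forall k, N (g k) <= 2^-1 ^+ k) ->
  \forall m \ae mu, cvgn (series (fun k => `|g k m|)).
Proof.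
move=> gle.
pose h m := (\sum_(0 <= k <oo) (`|g k m|)%:E)%E.
have mh k : measurable_fun [set: T] (fun m => (`|g k m|)%:E).
  by apply/measurable_EFinP; exact: measurableT_comp.
have hint : (\int[mu]_m h m < +oo)%E.
  rewrite integral_nneseries//.
  apply: (@le_lt_trans _ _ (\sum_(0 <= k <oo) (2^-1 ^+ k)%:E)%E).
    apply: lee_nneseries => [k _ _|k _]; first exact: integral_ge0.
    by rewrite (le_trans (int_norm_le _))// lee_fin.
  apply: (@le_lt_trans _ _ 2%:E); last exact: ltry.
  apply: lime_le; first by apply: is_cvg_nneseries => k _ _; rewrite lee_fin exprn_ge0.
  apply: nearW => n; rewrite sumEFin lee_fin big_mkord.
  suff -> : \sum_(i < n) 2^-1 ^+ i = 2 - 2 * 2^-1 ^+ n :> R.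
    by rewrite lerBlDr lerDl mulr_ge0// exprn_ge0.
  elim: n => [|n IH]; first by rewrite big_ord0 expr0 mulr1 subrr.
  by rewrite big_ord_recr/= IH exprS; field.
have hi : mu.-integrable setT h.
  apply/integrableP; split.
    by apply: ge0_emeasurable_sum => // k m _ _; rewrite lee_fin.
  under eq_integral => m _ do rewrite gee0_abs ?nneseries_ge0//.
  by [].
have := integrable_ae measurableT hi; apply: filterS => m /(_ I) hm.
apply: nnseries_is_cvg => //.
by rewrite -ge0_fin_numE// nneseries_ge0.
Qed.

Lemma ae_cvg_fast (g : nat -> L2 R) U : (forall k, N (g k - U) <= 2^-1 ^+ k) ->
  \forall m \ae mu, g k m @[k --> \oo] --> U m.
Proof.
move=> /ae_summable; apply: filterS => m /cvg_series_cvg_0 h.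
apply/cvgrPdist_lt => e e0; move/cvgrPdist_lt : h => /(_ e e0).
by apply: filterS => k; rewrite sub0r normrN normr_id L2B distrC.
Qed.

Lemma fast_subsequence (u : nat -> L2 R) : scauchy ip u ->
  exists phi : nat -> nat, (forall k, (phi k <= phi k.+1)%N) /\
   forall k i j, (phi k <= i)%N -> (phi k <= j)%N -> N (u i - u j) <= 2^-1 ^+ k.
Proof.
move=> uC; have ex k : exists n, forall i j, (n <= i)%N -> (n <= j)%N ->
    N (u i - u j) <= 2^-1 ^+ k.
  by apply: uC; rewrite exprn_gt0// invr_gt0.
have [f fP] := choice ex.
exists (fun k => \max_(i < k.+1) f i)%N; split=> [k|k i j ki kj].
  by rewrite [leqRHS]big_ord_recr/= leq_maxl.
have fk : (f k <= \max_(i < k.+1) f i)%N by exact: (leq_bigmax (@ord_max k)).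
by apply: fP; [exact: leq_trans ki|exact: leq_trans kj].
Qed.

(** Riesz and Fischer: a subsequence with summable increments converges almost
    everywhere, and Fatou's lemma shows that its pointwise limit is the limit in norm. *)
Lemma L2_complete : scomplete ip.
Proof.
move=> u uC; have [phi [phiS phiP]] := fast_subsequence uC.
pose y k := u (phi k).
have phi_le j k : (j <= k)%N -> (phi j <= phi k)%N.
  by move=> /subnKC <-; elim: (k - j)%N => [|n IH]; rewrite ?addn0// addnS (leq_trans IH).
have ys k : N (y k.+1 - y k) <= 2^-1 ^+ k by apply: phiP; rewrite ?phi_le.
have yc : \forall m \ae mu, cvgn (fun k => y k m).
  have := ae_summable ys; apply: filterS => m /normed_cvg h.
  have -> : (fun k => y k m) = (fun k => y 0%N m + series (fun k => (y k.+1 - y k) m) k).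
    apply/funext => k; rewrite /series/=.
    have E i : true -> (y i.+1 - y i) m = y i.+1 m - y i m by [].
    by rewrite (eq_bigr _ E) (telescope_sumr (fun k => y k m))// addrC subrK.
  by apply: is_cvgD => //; exact: is_cvg_cst.
have [A [mA A0 ycA]] := yc.
pose z k m := y k m * \1_(~` A) m.
have zc m : cvgn (z ^~ m).
  rewrite /z; have [Am|nAm] := pselect (A m).
    under eq_fun do rewrite indicE memNset ?mulr0//; exact: is_cvg_cst.
  have ym : cvgn (fun k => y k m) by apply: contrapT => h; apply: nAm; exact: ycA.
  by apply: is_cvgMl.
pose x m := limn (z ^~ m).
have mz k : measurable_fun [set: T] (z k).
  by apply: measurable_funM => //; apply: measurable_indic; exact: measurableC.
have mx : measurable_fun [set: T] x.
  by apply: (@measurable_fun_cvg _ _ _ setT z x) => // m _; exact: zc.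
have zy k : \forall m \ae mu, z k m = y k m.
  exists A; split => // m /=; apply: contra_notP => nAm.
  by rewrite /z indicE mem_set ?mulr1.
have dist j : (\int[mu]_m ((x m - z j m) ^+ 2)%:E <= ((2^-1 ^+ j) ^+ 2)%:E)%E.
  pose q k m := ((z k m - z j m) ^+ 2)%:E.
  have mq k : measurable_fun [set: T] (q k).
    by apply/measurable_EFinP/measurable_funX/measurable_funB.
  have q0 k m : (0 <= q k m)%E by rewrite lee_fin sqr_ge0.
  have -> : (\int[mu]_m ((x m - z j m) ^+ 2)%:E = \int[mu]_m limn_einf (q ^~ m))%E.
    apply: eq_integral => m _.
    have qm : q k m @[k --> \oo] --> ((x m - z j m) ^+ 2)%:E.
      apply: cvg_EFin; first exact: nearW.
      rewrite /comp/= [X in _ --> X]expr2; under eq_fun do rewrite expr2.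
      by apply: cvgM; apply: cvgB; try exact: zc; exact: cvg_cst.
    by rewrite (cvg_limn_einf_sup qm).1.
  apply: le_trans (fatou mu measurableT mq (fun k m _ => q0 k m)) _.
  apply: (limn_einf_le (j := j)) => k jk.
  have -> : (\int[mu]_m q k m = (N (y k - y j) ^+ 2)%:E)%E.
    rewrite sqr_snorm_intE; apply: ge0_ae_eq_integral => //.
    - exact: L2_sqr_measurable.
    - by move=> m _; rewrite lee_fin sqr_ge0.
    - by apply: filterS2 (zy k) (zy j) => m zk zj _; rewrite /q zk zj.
  by rewrite lee_fin lerXn2r ?nnegrE ?snorm_ge0 ?exprn_ge0 ?phiP ?phi_le.
have dL2 j : (fun m => x m - z j m) \in Lfun mu 2%:E.
  apply: in_L2; first exact: measurable_funB.
  exact: le_lt_trans (dist j) (ltry _).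
(* Only differences [x - z j] are known to be square integrable. *)
pose xL : L2 R := y 0%N + toL2 (fun m => x m - z 0%N m).
have xLE : \forall m \ae mu, xL m = x m.
  by apply: filterS (zy 0%N) => m zm; rewrite /xL L2D toL2E// zm addrC subrK.
have Nx j : N (xL - y j) <= 2^-1 ^+ j.
  apply: snorm_int_le; first by rewrite exprn_ge0.
  apply: le_trans (dist j); rewrite le_eqVlt; apply/orP; left; apply/eqP.
  apply: ge0_ae_eq_integral => //.
  - exact: L2_sqr_measurable.
  - by apply/measurable_EFinP/measurable_funX/measurable_funB.
  - by move=> m _; rewrite lee_fin sqr_ge0.
  - by move=> m _; rewrite lee_fin sqr_ge0.
  - by apply: filterS2 xLE (zy j) => m e1 e2 _; rewrite L2B e1 e2.
exists xL => e e0; have [j je] : exists j : nat, 2^-1 ^+ j <= e / 2 :> R.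
  have [j hj] := halfpow_lt (divr_gt0 e0 (ltr0n R 2)); exists j; exact: ltW.
exists (phi j) => i ij; apply: le_trans (snorm_triangle ip (y j) _ _) _.
rewrite [leRHS]splitr; apply: lerD.
  exact: le_trans (phiP j i (phi j) ij (leqnn _)) je.
by rewrite snormB; exact: le_trans (Nx j) je.
Qed.

Local Notation K := (@monotone_cone R).

(** The supremum of the values of [X] at the good points to the left of [m] is
    a representative that is monotone on all of [Omega]. *)
Lemma cone_of_ae_monotone X (A : R -> Prop) : (\forall m \ae mu, A m) ->
  (forall a b, A a -> A b -> Omega a -> Omega b -> a <= b -> X a <= X b) -> K X.
Proof.
move=> Aae Xmono.
pose S m := [set X a | a in [set a : R | [/\ A a, Omega a & a <= m]]].
have itvE a : Omega (a : R) = (0 < a < 1) by rewrite /Omega/= in_itv.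
have S0 m : Omega m -> S m !=set0.
  rewrite itvE => /andP[m0 m1]; have [a [Aa a0 am]] := ae_ex_itv Aae (lexx 0) m0 (ltW m1).
  exists (X a), a => //; split => //; last exact: ltW.
  by rewrite itvE a0 (lt_trans am).
have SU m : Omega m -> has_sup (S m).
  move=> Om; split; first exact: S0.
  move: Om; rewrite itvE => /andP[m0 m1].
  have [b [Ab mb b1]] := ae_ex_itv Aae (ltW m0) m1 (lexx 1).
  exists (X b) => _ [a [Aa Oa am] <-]; apply: Xmono => //.
    by rewrite itvE b1 (lt_trans m0).
  by rewrite (le_trans am)// ltW.
exists (fun m => sup (S m)).
  move=> a b; rewrite !inE => Oa Ob ab; apply: ge_sup; first exact: S0.
  move=> _ [c [Ac Oc ca] <-]; apply: sup_upper_bound; first exact: SU.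
  by exists c => //; split => //; exact: le_trans ab.
apply: filterS2 Aae ae_Omega => m Am Om; apply/le_anti/andP; split.
  by apply: sup_upper_bound; [exact: SU|exists m].
apply: ge_sup; first exact: S0.
by move=> _ [a [Aa Oa am] <-]; exact: Xmono.
Qed.

Lemma cone_rep X : K X -> exists Y : R -> R,
  [/\ forall a b, Omega (a : R) -> Omega (b : R) -> a <= b -> Y a <= Y b &
      \forall m \ae mu, X m = Y m].
Proof.
move=> [Y Ym XY]; exists Y; split => // a b Oa Ob; apply: Ym; exact: mem_set.
Qed.

Lemma sconvex_cone : sconvex K.
Proof.
move=> X Y a [X' mX' XX'] [Y' mY' YY'] /andP[a0 a1].
exists (fun m => a * X' m + (1 - a) * Y' m).
  move=> x y Ox Oy xy; apply: lerD; rewrite ler_wpM2l ?subr_ge0//.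
    exact: mX'.
  exact: mY'.
by apply: filterS2 XX' YY' => m e1 e2; rewrite L2D !L2Z e1 e2.
Qed.

Lemma cone0 : K 0.
Proof. by exists (fun=> 0) => //; apply: nearW => m; rewrite L2_0. Qed.

(** A fast sequence converges almost everywhere, and monotonicity on a set of
    full measure passes to the pointwise limit. *)
Lemma closed_cone : sclosure ip K `<=` K.
Proof.
move=> X KX.
have ex k : exists Y : L2 R, K Y /\ N (Y - X) <= 2^-1 ^+ k.
  have h0 : 0 < 2^-1 ^+ k :> R by rewrite exprn_gt0// invr_gt0.
  have [Y KY YX] := KX _ h0.
  by exists Y.
have [Y YP] := choice ex.
have ex' k : exists Y' : R -> R, (forall a b, Omega (a : R) -> Omega (b : R) ->
    a <= b -> Y' a <= Y' b) /\ \forall m \ae mu, Y k m = Y' m.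
  by have [Y' [? ?]] := cone_rep (YP k).1; exists Y'.
have [Y' Y'P] := choice ex'.
have cvgYX := ae_cvg_fast (fun k => (YP k).2).
have YY' : \forall m \ae mu, forall k, Y k m = Y' k m.
  by apply: ae_foralln => k; exact: (Y'P k).2.
apply: (cone_of_ae_monotone (A := fun m => Y' k m @[k --> \oo] --> X m)).
  apply: filterS2 cvgYX YY' => m h e.
  by have -> : Y' ^~ m = (fun k => Y k m) by apply/funext => k; rewrite e.
move=> a b ha hb Oa Ob ab.
by apply: (ler_cvg_to ha hb); apply: nearW => k; exact: (Y'P k).1.
Qed.

Definition contraction_nd (eta : R -> R) := forall a b, a <= b ->
  0 <= eta b - eta a <= b - a.

(** Where [Y - X] increases, [X] and [eta (Y - X)] both do. Where [Y - X]
    decreases, [eta (Y - X)] decreases by no more, so [X + eta (Y - X)] increases at least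
    as much as [Y]. This compatibility of the cone with pointwise contractions is the
    source of all estimates for convex functionals. *)
Lemma cone_perturb X Y Z (eta : R -> R) : contraction_nd eta -> K X -> K Y ->
  (\forall m \ae mu, Z m = X m + eta (Y m - X m)) -> K Z.
Proof.
move=> etaP [X' mX' XX'] [Y' mY' YY'] ZE.
exists (fun m => X' m + eta (Y' m - X' m)).
  move=> x y Ox Oy xy; have hX := mX' _ _ Ox Oy xy; have hY := mY' _ _ Ox Oy xy.
  have [h|/ltW h] := leP (Y' x - X' x) (Y' y - X' y).
    have /andP[h1 _] := etaP _ _ h.
    move: (eta _) (eta _) h1 => p q h1; lra.
  have /andP[_ h1] := etaP _ _ h.
  move: (eta _) (eta _) h1 => p q h1; lra.
by apply: filterS3 XX' YY' ZE => m e1 e2 ->; rewrite e1 e2.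
Qed.

Lemma contraction_nd_le eta r : contraction_nd eta ->
  `|eta r| <= (1 + `|eta 0|) * (1 + `|r|).
Proof.
move=> etaP; have h : `|eta r - eta 0| <= `|r|.
  have [r0|/ltW r0] := leP 0 r.
    have /andP[h1 h2] := etaP _ _ r0; rewrite subr0 in h2.
    by rewrite !ger0_norm.
  have /andP[h1 h2] := etaP _ _ r0; rewrite sub0r in h2.
  by rewrite distrC (ger0_norm h1) ler0_norm.
have := ler_normD (eta r - eta 0) (eta 0); rewrite subrK => h2.
have := mulr_ge0 (normr_ge0 (eta 0)) (normr_ge0 r); lra.
Qed.

Lemma contraction_nd_measurable eta : contraction_nd eta ->
  measurable_fun [set: R] eta.
Proof.
move=> etaP; apply: nondecreasing_measurable => // a b /etaP /andP[h _].
by rewrite -subr_ge0.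
Qed.

Lemma comp_L2_in eta U : contraction_nd eta -> (eta \o U : R -> R) \in Lfun mu 2%:E.
Proof.
move=> etaP; apply: (@le_L2_in _ U (1 + `|eta 0|)).
  apply: measurableT_comp => //; exact: contraction_nd_measurable.
by apply: nearW => m; exact: (@contraction_nd_le eta (U m) etaP).
Qed.

End L2Space.

(** * Tails and compactness of monotone functions *)

Section Truncation.
Variable R : realType.
Implicit Types (M a b r c : R).

Definition trunc M r := Num.max (- M) (Num.min M r).
Definition soft M r := r - trunc M r.

Lemma softP M r : 0 <= M ->
  [\/ r <= - M /\ soft M r = r + M, - M <= r <= M /\ soft M r = 0
    | M <= r /\ soft M r = r - M].
Proof.
move=> M0; rewrite /soft /trunc.
have [h1|/ltW h1] := leP r (- M).
  apply: Or31; split => //; rewrite (min_idPr _); last by lra.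
  by rewrite (max_idPl _)// opprK.
have [h2|/ltW h2] := leP r M.
  by apply: Or32; split; [rewrite h1|rewrite (max_idPr h1) subrr].
apply: Or33; split => //; rewrite (max_idPr _)//; lra.
Qed.

Lemma norm_soft M r : 0 <= M -> `|soft M r| = Num.max (`|r| - M) 0.
Proof.
move=> M0; have [[h ->]|[/andP[h1 h2] ->]|[h ->]] := softP r M0.
- rewrite (@ler0_norm _ r) ?(@ler0_norm _ (r + M)); [|lra|lra].
  by rewrite (max_idPl _) ?opprD//; lra.
- by rewrite normr0 (max_idPr _)// subr_le0 ler_norml h1.
- rewrite (@ger0_norm _ r) ?(@ger0_norm _ (r - M)); [|lra|lra].
  by rewrite (max_idPl _)//; lra.
Qed.

Lemma contraction_soft M : 0 <= M -> contraction_nd (soft M).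
Proof.
move=> M0 a b ab.
have [[h1 ->]|[/andP[h1 h2] ->]|[h1 ->]] := softP a M0;
have [[k1 ->]|[/andP[k1 k2] ->]|[k1 ->]] := softP b M0;
by apply/andP; split; lra.
Qed.

Lemma trunc_mono M : {homo trunc M : a b / a <= b}.
Proof.
by move=> a b ab; rewrite /trunc; case: (leP M a); case: (leP M b); case: (leP (- M) M); case: (leP (- M) a); case: (leP (- M) b); lra.
Qed.

Lemma trunc_bound M r : 0 <= M -> - M <= trunc M r <= M.
Proof.
move=> M0; rewrite /trunc le_max lexx/= ge_max; apply/andP; split; first by lra.
by rewrite ge_min lexx.
Qed.

(** The square of [soft M] is convex with derivative [2 soft M]. *)
Lemma soft_convex M a b : 0 <= M ->
  soft M b ^+ 2 + 2 * (soft M b * (a - b)) <= soft M a ^+ 2.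
Proof.
move=> M0; have st x : x = soft M x + trunc M x by rewrite /soft subrK.
have /andP[ta1 ta2] := trunc_bound a M0.
have h : soft M b * (trunc M a - trunc M b) <= 0.
  have tb := st b.
  have [[h1 sb]|[_ ->]|[h1 sb]] := softP b M0; last 2 first.
  - by rewrite mul0r.
  - by rewrite mulr_ge0_le0//; lra.
  - by rewrite mulr_le0_ge0//; lra.
have -> : a - b = (soft M a - soft M b) + (trunc M a - trunc M b).
  by rewrite /soft; ring.
have := sqr_ge0 (soft M a - soft M b).
move: h; move: (soft M a) (soft M b) (trunc M a) (trunc M b) => p q u v h1 h2.
lra.
Qed.

Lemma soft_add M M' a b : 0 <= M -> 0 <= M' ->
  `|soft (M + M') (a + b)| <= `|soft M a| + `|soft M' b|.
Proof.
move=> M0 M'0; rewrite !norm_soft ?addr_ge0//.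
have h := ler_normD a b.
by case: (leP (`|a| - M) 0); case: (leP (`|b| - M') 0); case: (leP (`|a + b| - (M + M')) 0); lra.
Qed.

Lemma soft_le M M' c a b : 0 <= M -> 0 <= c -> c * M <= M' ->
  `|b| - M' <= c * (`|a| - M) -> `|soft M' b| <= c * `|soft M a|.
Proof.
move=> M0 c0 cM h; have M'0 : 0 <= M' by apply: le_trans cM; exact: mulr_ge0.
rewrite !norm_soft// ge_max; apply/andP; split; last first.
  by rewrite mulr_ge0// le_max lexx orbT.
by apply: le_trans h _; rewrite ler_wpM2l// le_max lexx.
Qed.

End Truncation.

Section Ultrafilters.
Variables (R : realType) (U : set_system nat).
Hypothesis ultraU : UltraFilter U.
Let filterU : Filter U := @filter_filter _ _ (@ultra_proper _ _ ultraU).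

(** Cut off one piece of length [d] at a time: the ultrafilter contains either
    that piece or the rest. *)
Lemma ultra_small (r : nat -> R) (d : R) n a (B : set nat) : 0 <= d -> U B ->
  (forall j, B j -> a <= r j <= a + n%:R * d) ->
  exists A, U A /\ forall i j, A i -> A j -> r i - r j <= d.
Proof.
move=> d0; elim: n a B => [|n IH] a B UB Br.
  exists B; split => // i j /Br + /Br; rewrite mul0r addr0 => /andP[h1 h2] /andP[h3 h4].
  lra.
have [UA|UA] := in_ultra_setVsetC [set j | r j <= a + d] ultraU.
  exists (B `&` [set j | r j <= a + d]); split; first exact: filterI.
  by move=> i j [/Br /andP[_ _] /= h1] [/Br /andP[h2 _] _]; lra.
apply: (IH (a + d) (B `&` ~` [set j | r j <= a + d])); first exact: filterI.
move=> j [/Br /andP[h1 h2] /= /negP]; rewrite -ltNge => /ltW -> /=.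
by move: h2; rewrite mulrSr mulrDl mul1r; lra.
Qed.

Lemma ultra_cauchy (r : nat -> R) (M d : R) : (forall j, `|r j| <= M) -> 0 < d ->
  exists A, U A /\ forall i j, A i -> A j -> `|r i - r j| <= d.
Proof.
move=> rM d0.
have [n nM] : exists n : nat, 2 * M <= n%:R * d.
  exists (Num.bound (2 * M / d)); rewrite -ler_pdivrMr//.
  by apply/ltW/archi_boundP; rewrite divr_ge0 ?(ltW d0)// mulr_ge0// (le_trans _ (rM 0%N)).
have [|A [UA AP]] := @ultra_small r d n (- M) setT (ltW d0) filterT.
  by move=> j _; have := rM j; rewrite ler_norml => /andP[-> h] /=; lra.
exists A; split => // i j Ai Aj; rewrite ler_norml; apply/andP; split.
  by have := AP j i Aj Ai; lra.
exact: AP.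
Qed.

Lemma ultra_cauchy_finite (r : nat -> nat -> R) (M d : R) n :
  (forall k j, `|r k j| <= M) -> 0 < d ->
  exists A, U A /\ forall k, (k < n)%N ->
    forall i j, A i -> A j -> `|r k i - r k j| <= d.
Proof.
move=> rM d0; elim: n => [|n [A [UA AP]]]; first by exists setT; split; [exact: filterT|].
have [B [UB BP]] := ultra_cauchy (rM n) d0.
exists (A `&` B); split; first exact: filterI.
move=> k; rewrite ltnS leq_eqVlt => /predU1P[->|kn] i j [Ai Bi] [Aj Bj]; first exact: BP.
exact: AP.
Qed.

End Ultrafilters.

Lemma snormBD (R : realType) (H : lmodType R) (ip : semi_inner H) x y :
  snorm ip (x - y) <= snorm ip x + snorm ip y.
Proof. by apply: le_trans (snormD _ _ _) _; rewrite snormN. Qed.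

Lemma sqr_snorm_add2 (R : realType) (H : lmodType R) (ip : semi_inner H) x u :
  snorm ip x ^+ 2 + 2 * ip u x = ip x (x + 2 *: u).
Proof. by rewrite sqr_snorm innerDr innerZr (innerC _ u x). Qed.

Lemma le_of_sqr (R : realType) (a b : R) : 0 <= a -> 0 <= b ->
  a ^+ 2 <= b ^+ 2 -> a <= b.
Proof. by move=> a0 b0; rewrite ler_pXn2r. Qed.

Section Tails.
Variable R : realType.
Local Notation mu := (leb_Omega R).
Local Notation T := (measurableTypeR R).
Local Notation ip := (@L2_inner R).
Local Notation N := (snorm ip).
Local Notation K := (@monotone_cone R).
Implicit Types (X Y V W : L2 R) (M c : R).

Definition softL2 M X : L2 R := toL2 (soft M \o X).

Lemma softL2E M X m : 0 <= M -> softL2 M X m = soft M (X m).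
Proof. by move=> M0; rewrite /softL2 toL2E//; exact/comp_L2_in/contraction_soft. Qed.

Definition tail M X : R := N (softL2 M X).

Lemma tail_add M M' X Y : 0 <= M -> 0 <= M' ->
  tail (M + M') (X + Y) <= tail M X + tail M' Y.
Proof.
move=> M0 M'0; pose A := toL2 (fun m => `|softL2 M X m|).
pose B := toL2 (fun m => `|softL2 M' Y m|).
have absL2 (Z : L2 R) : (fun m => `|Z m|) \in Lfun mu 2%:E.
  apply: (@le_L2_in _ _ Z 1); first exact: measurableT_comp.
  by apply: nearW => m; rewrite normr_id mul1r lerDr.
have -> : tail M X = N A.
  apply/le_anti/andP; split; apply: snorm_ae_le; apply: nearW => m; rewrite /A toL2E// normr_id//.
have -> : tail M' Y = N B.
  apply/le_anti/andP; split; apply: snorm_ae_le; apply: nearW => m; rewrite /B toL2E// normr_id//.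
apply: le_trans (snormD _ _ _); apply: snorm_ae_le; apply: nearW => m.
rewrite L2D /A /B (toL2E (absL2 (softL2 M X))) (toL2E (absL2 (softL2 M' Y))).
rewrite !softL2E ?addr_ge0// L2D.
by rewrite [leRHS]ger0_norm ?addr_ge0// soft_add.
Qed.

Lemma tail_le M M' c X Y : 0 <= M -> 0 <= c -> c * M <= M' ->
  (\forall m \ae mu, `|Y m| - M' <= c * (`|X m| - M)) ->
  tail M' Y <= c * tail M X.
Proof.
move=> M0 c0 cM h; have M'0 : 0 <= M' by apply: le_trans cM; exact: mulr_ge0.
have -> : c * tail M X = N (c *: softL2 M X) by rewrite snormZ ger0_norm.
apply: snorm_ae_le; apply: filterS h => m h.
by rewrite L2Z !softL2E// normrM (ger0_norm c0) soft_le.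
Qed.

Lemma tailZ M c X : 0 <= M -> 0 <= c -> tail (c * M) (c *: X) <= c * tail M X.
Proof.
move=> M0 c0; apply: tail_le => //; apply: nearW => m.
by rewrite L2Z normrM (ger0_norm c0) mulrBr.
Qed.

(** The function [P - soft M P] is monotone, so it may be compared with the
    projection [P] of [X]; the convexity of the square of [soft M] does the rest. *)
Lemma tail_projection M X P : 0 <= M -> K P ->
  (forall Y, K Y -> ip (X - P) (Y - P) <= 0) -> tail M P <= tail M X.
Proof.
move=> M0 KP proj.
(* This is [cone_perturb] with the constant function [0] as second point. *)
have KT : K (P - softL2 M P).
  apply: (@cone_perturb _ P 0 _ (soft M)) => //; [exact: contraction_soft|exact: cone0|].
  apply: nearW => m; rewrite L2B softL2E// L2_0 sub0r; congr (_ + _).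
  have [[h ->]|[/andP[h1 h2] ->]|[h ->]] := softP (P m) M0;
  have [[k ->]|[/andP[k1 k2] ->]|[k ->]] := softP (- P m) M0; lra.
have := proj _ KT; rewrite addrAC subrr add0r innerNr oppr_le0 => h.
suff : tail M P ^+ 2 + 2 * ip (X - P) (softL2 M P) <= tail M X ^+ 2.
  move=> h2; apply: (le_of_sqr (snorm_ge0 _ _) (snorm_ge0 _ _)).
  by apply: le_trans h2; rewrite lerDl mulr_ge0.
rewrite /tail sqr_snorm_add2 sqr_snorm.
rewrite /= /L2inner; apply: le_Rintegral => //; try exact: L2_mul_integrable.
move=> m _; rewrite L2D L2Z L2B !softL2E//.
have := soft_convex (X m) (P m) M0; lra.
Qed.

Lemma tail_small X (e : R) : 0 < e -> exists2 M, 0 <= M & tail M X <= e.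
Proof.
move=> e0.
pose f (n : nat) m : \bar R := ((softL2 n%:R X m) ^+ 2)%:E.
have mf n : measurable_fun [set: T] (f n) by exact: L2_sqr_measurable.
(* Pointwise, [soft n] vanishes as soon as [n] exceeds the value. *)
have f0 : \forall m \ae mu, setT m -> f n m @[n --> \oo] --> (0%E : \bar R).
  apply: nearW => m _; apply: cvg_near_cst.
  exists (Num.bound `|X m|) => // n /= nX; rewrite /f softL2E//.
  have /ltW h : `|X m| < n%:R.
    by apply: lt_le_trans (archi_boundP (normr_ge0 _)) _; rewrite ler_nat.
  suff -> : soft n%:R (X m) = 0 by rewrite expr0n.
  by apply/eqP; rewrite -normr_eq0 norm_soft// (max_idPr _)// subr_le0.
pose g := EFin \o (fun m => X m * X m).
have gi : mu.-integrable setT g := L2_mul_integrable X X.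
have fg : \forall m \ae mu, forall n, setT m -> (`|f n m| <= g m)%E.
  apply: nearW => m n _; rewrite /f /g /= lee_fin softL2E// normrX norm_soft//.
  rewrite -expr2 -(real_normK (num_real (X m))) lerXn2r ?nnegrE//.
  by rewrite ge_max normr_ge0 andbT lerBlDr lerDl.
have [_ _] := dominated_convergence measurableT mf (measurable_cst 0%E) f0 gi fg.
rewrite integral0 => /fine_cvgP[_ /cvgrPdist_lt] h.
have e20 : 0 < e ^+ 2 by rewrite exprn_gt0.
have [n _ /(_ n (leqnn n))] := h _ e20; rewrite sub0r normrN /= => hn.
exists n%:R => //; apply: snorm_le; first exact: ltW.
rewrite -sqr_snorm; have -> : N (softL2 n%:R X) ^+ 2 = fine (\int[mu]_m f n m)%E.
  by rewrite -sqr_snorm_intE.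
exact: le_trans (ler_norm _) (ltW hn).
Qed.

(** Inside a cell of the grid both functions stay between their values at its
    ends. Their difference is therefore at most [2 d] plus the sum of their increments
    over the cell, and these increments add up to at most [2 M] for each function. *)
Lemma monotone_grid_dist M d n (y z : R -> R) : 0 <= M -> 0 <= d ->
  (forall a b, Omega (a : R) -> Omega (b : R) -> a <= b -> y a <= y b) ->
  (forall a b, Omega (a : R) -> Omega (b : R) -> a <= b -> z a <= z b) ->
  (forall k, (k < n.+1)%N -> `|trunc M (y (k%:R / n.+1%:R)) - trunc M (z (k%:R / n.+1%:R))| <= d) ->
  forall (Y Z : L2 R), (\forall m \ae mu, Y m = trunc M (y m)) ->
   (\forall m \ae mu, Z m = trunc M (z m)) ->
  N (Y - Z) ^+ 2 <= 2 * M * (4 * M / n.+1%:R + 2 * d).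
Proof.
move=> M0 d0 ymono zmono yzd Y Z YE ZE.
pose p k : R := k%:R / n.+1%:R.
have n1 : 0 < n.+1%:R :> R by [].
(* Values at the nodes. At the ends of the unit interval, where the monotone
   functions are not defined, the bounds [- M] and [M] replace them. *)
pose ext (w : R -> R) k := if k == 0%N then - M else if (k < n.+1)%N then trunc M (w (p k)) else M.
pose c k := (ext y k.+1 - ext y k) + (ext z k.+1 - ext z k) + 2 * d.
pose cell k : set T := `[p k, p k.+1[%classic.
have mcell k : measurable (cell k) by exact: measurable_itv.
have Op k : (0 < k)%N -> (k < n.+1)%N -> Omega (p k).
  move=> k0 kn; rewrite /Omega/= in_itv/= divr_gt0 ?ltr0n//=.
  by rewrite ltr_pdivrMr// mul1r ltr_nat.
have itvE a : Omega (a : R) = (0 < a < 1) by rewrite /Omega/= in_itv.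
have ext_le (w : R -> R) k m : (forall a b, Omega (a : R) -> Omega (b : R) -> a <= b -> w a <= w b) ->
    Omega (m : R) -> p k <= m -> m < p k.+1 -> (k < n.+1)%N ->
    ext w k <= trunc M (w m) <= ext w k.+1.
  move=> wmono Om pm mp kn; rewrite /ext.
  have /andP[t1 t2] := trunc_bound (w m) M0.
  apply/andP; split.
    case: eqP => [//|/eqP]; rewrite -lt0n => k0; rewrite kn.
    by apply: trunc_mono; apply: wmono => //; exact: Op.
  rewrite /=; case: ifPn => // kn'.
  by apply: trunc_mono; apply: wmono; rewrite ?ltW//; exact: Op.
have ext_mono (w : R -> R) k : (forall a b, Omega (a : R) -> Omega (b : R) -> a <= b -> w a <= w b) ->
    (k < n.+1)%N -> ext w k <= ext w k.+1.
  move=> wmono kn.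
  pose m : R := (k%:R + 2^-1) / n.+1%:R.
  have hk : k.+1%:R = k%:R + 1 :> R by rewrite mulrSr.
  have km : p k <= m by rewrite ler_pM2r ?invr_gt0// lerDl.
  have mk : m < p k.+1 by rewrite ltr_pM2r ?invr_gt0// hk ltrD2l; lra.
  have Om : Omega m.
    have m0 : 0 < m by rewrite divr_gt0// ltr_wpDl// invr_gt0.
    rewrite itvE m0/=.
    by rewrite (lt_le_trans mk)// ler_pdivrMr// mul1r ler_nat.
  by have /andP[h1 h2] := ext_le w k m wmono Om km mk kn; exact: le_trans h2.
have c0 k : (k < n.+1)%N -> 0 <= c k.
  move=> kn; have := ext_mono _ _ ymono kn; have := ext_mono _ _ zmono kn.
  by rewrite /c => *; lra.
have ext_d k : (k < n.+1)%N -> `|ext y k - ext z k| <= d.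
  by move=> kn; rewrite /ext kn; case: eqP => [_|_]; [rewrite subrr normr0|exact: yzd].
have ext_d1 k : (k < n.+1)%N -> `|ext y k.+1 - ext z k.+1| <= d.
  move=> kn; have [kn'|kn'] := ltnP k.+1 n.+1; first exact: ext_d.
  by rewrite /ext/= ltnNge kn'/= subrr normr0.
pose s m : \bar R := (\sum_(k < n.+1) (2 * M * c k)%:E * (\1_(cell k) m)%:E)%E.
have -> : N (Y - Z) ^+ 2 = fine ((N (Y - Z) ^+ 2)%:E) by [].
rewrite -lee_fin fineK// sqr_snorm_intE.
have sE : (\int[mu]_m s m = \sum_(k < n.+1) (2 * M * c k)%:E * mu (cell k))%E.
  rewrite ge0_integral_sum//; last 2 first.
  - by move=> k; apply/measurable_EFinP/measurable_funM.
  - by move=> k m _; rewrite mule_ge0// lee_fin// !mulr_ge0// c0.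
  apply: eq_bigr => k _; rewrite ge0_integralZl//.
  - by rewrite integral_indic// setIT.
  - by apply/measurable_EFinP; exact: measurable_indic.
  - by rewrite lee_fin !mulr_ge0// c0.
apply: (@le_trans _ _ (\int[mu]_m s m)%E).
  apply: ae_ge0_le_integral => //.
  - by move=> m _; rewrite lee_fin sqr_ge0.
  - exact: L2_sqr_measurable.
  - move=> m _; apply: sume_ge0 => k _; rewrite mule_ge0// lee_fin// !mulr_ge0// c0//.
  - by apply: emeasurable_sum => k; apply/measurable_EFinP/measurable_funM.
  - apply: filterS3 YE ZE (@ae_Omega R) => m Ym Zm Om _.
    have [k [kn pm mp]] : exists k, [/\ (k < n.+1)%N, p k <= m & m < p k.+1].
      have m0 : 0 <= (m : R) * n.+1%:R.
        by move: Om; rewrite itvE => /andP[m0 _]; rewrite mulr_ge0 ?(ltW m0).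
      have := truncn_itv m0; set k := Num.truncn _ => /andP[h1 h2].
      exists k; split.
      + rewrite -(ltr_nat R); apply: le_lt_trans h1 _.
        by move: Om; rewrite itvE => /andP[_ m1]; rewrite gtr_pMl.
      + by rewrite ler_pdivrMr.
      + by rewrite ltr_pdivlMr.
    rewrite /s (bigD1 (Ordinal kn))//= indicE mem_set; last first.
      by rewrite /cell/= in_itv/= pm.
    rewrite mule1; apply: (@le_trans _ _ (2 * M * c k)%:E); last first.
      apply: leeDl; apply: sume_ge0 => i _.
      by rewrite mule_ge0// lee_fin// !mulr_ge0// c0.
    change (((Y m - Z m) ^+ 2)%:E <= (2 * M * c k)%:E)%E.
    rewrite lee_fin Ym Zm.
    have /andP[y1 y2] := ext_le _ _ _ ymono Om pm mp kn.
    have /andP[z1 z2] := ext_le _ _ _ zmono Om pm mp kn.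
    have := ext_d _ kn; rewrite ler_norml => /andP[d1 d2].
    have := ext_d1 _ kn; rewrite ler_norml => /andP[d3 d4].
    have cd : `|trunc M (y m) - trunc M (z m)| <= c k.
      by rewrite ler_norml /c; apply/andP; split; lra.
    have c2M : `|trunc M (y m) - trunc M (z m)| <= 2 * M.
      have /andP[? ?] := trunc_bound (y m) M0; have /andP[? ?] := trunc_bound (z m) M0.
      by rewrite ler_norml; apply/andP; split; lra.
    by rewrite -(real_normK (num_real _)) expr2 ler_pM.
rewrite sE.
apply: (@le_trans _ _ (\sum_(k < n.+1) (2 * M * c k * n.+1%:R^-1)%:E)%E).
  apply: lee_sum => k _; rewrite (EFinM (2 * M * c k)); apply: lee_wpmul2l.
    by rewrite lee_fin !mulr_ge0// c0.
  apply: (@le_trans _ _ (lebesgue_measure (cell k))).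
    apply: le_measure; last exact: subIsetl; apply/mem_set => //.
    exact: measurableI (mcell k) (@measurable_Omega R).
  rewrite lebesgue_measure_itv/= lte_fin.
  case: ifP => _; last by rewrite lee_fin.
  by rewrite -EFinB lee_fin /p -mulrBl mulrSr addrAC subrr add0r mul1r.
rewrite sumEFin lee_fin -mulr_suml -mulr_sumr -mulrA ler_wpM2l ?mulr_ge0//.
rewrite ler_pdivrMr// mulrDl divfK ?gt_eqF//.
have -> : \sum_(k < n.+1) c k = (ext y n.+1 - ext y 0%N) + (ext z n.+1 - ext z 0%N) + n.+1%:R * (2 * d).
  have tel w : \sum_(k < n.+1) (ext w k.+1 - ext w k) = ext w n.+1 - ext w 0%N.
    by rewrite -(telescope_sumr (ext w) (leq0n _)) big_mkord.
  by rewrite /c big_split/= big_split/= !tel sumr_const card_ord [in RHS]mulr_natl.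
rewrite /ext/= ltnn [n.+1%:R * _]mulrC; lra.
Qed.

(** A form of Helly's selection theorem. Up to small tails, the distance of two
    monotone functions is controlled by finitely many bounded numbers, which converge
    along any ultrafilter. As the ultrafilter does not depend on the sequence, it can
    serve a whole curve. *)
Lemma ultra_cauchy_tails (U : set_system nat) (x : nat -> L2 R) :
  UltraFilter U -> (forall j, K (x j)) ->
  (forall e : R, 0 < e -> exists2 M, 0 <= M & forall j, tail M (x j) <= e) ->
  forall e : R, 0 < e -> exists A, U A /\ forall i j, A i -> A j -> N (x i - x j) <= e.
Proof.
move=> ultraU Kx tails e e0.
have e3 : 0 < e / 3 by rewrite divr_gt0.
have [M M0 tM] := tails _ e3.
have ex j : exists y : R -> R, (forall a b, Omega (a : R) -> Omega (b : R) ->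
    a <= b -> y a <= y b) /\ \forall m \ae mu, x j m = y m.
  by have [y [? ?]] := cone_rep (Kx j); exists y.
have [y yP] := choice ex.
pose e9 := e ^+ 2 / 9; have e90 : 0 < e9 by rewrite divr_gt0// exprn_gt0.
pose d := e9 / (8 * (M + 1)).
have M1 : 0 < 8 * (M + 1) by rewrite mulr_gt0// ltr_wpDl.
have d0 : 0 < d by rewrite divr_gt0.
have q0 : 0 < e9 / (16 * (M + 1) ^+ 2).
  by rewrite divr_gt0// mulr_gt0// exprn_gt0// ltr_wpDl.
have [n _ nP] := near_infty_natSinv_lt (PosNum q0).
have {nP} hn := nP n (leqnn n); rewrite /= in hn.
(* The finitely many numbers that determine the truncations up to small errors. *)
pose r k j := trunc M (y j (k%:R / n.+1%:R)).
have rM k j : `|r k j| <= M by rewrite ler_norml trunc_bound.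
have [A [UA AP]] := ultra_cauchy_finite ultraU n.+1 rM d0.
exists A; split => // i j Ai Aj.
pose t k := x k - softL2 M (x k).
have tE k : \forall m \ae mu, t k m = trunc M (y k m).
  apply: filterS (yP k).2 => m h.
  by rewrite L2B softL2E// /soft h opprB addrC subrK.
have hij := @monotone_grid_dist M d n _ _ M0 (ltW d0) (yP i).1 (yP j).1
  (fun k kn => AP k kn i j Ai Aj) _ _ (tE i) (tE j).
have Nt : N (t i - t j) <= e / 3.
  have e30 : 0 <= e / 3 := ltW e3.
  rewrite -(@ler_pXn2r _ 2)// ?nnegrE ?snorm_ge0//; apply: le_trans hij _.
  have -> : (e / 3) ^+ 2 = e9 by rewrite /e9; field.
  have h1 : 2 * M * (2 * d) <= e9 / 2.
    have -> : e9 / 2 = 2 * (M + 1) * (2 * d) by rewrite /d; field; rewrite gt_eqF// ltr_wpDl.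
    by apply: ler_wpM2r; [rewrite mulr_ge0// ltW|rewrite ler_wpM2l// lerDl].
  have h2 : 2 * M * (4 * M / n.+1%:R) <= e9 / 2.
    have -> : 2 * M * (4 * M / n.+1%:R) = 8 * M ^+ 2 * n.+1%:R^-1 by ring.
    apply: (@le_trans _ _ (8 * (M + 1) ^+ 2 * (e9 / (16 * (M + 1) ^+ 2)))).
      apply: ler_pM; rewrite ?mulr_ge0 ?sqr_ge0 ?invr_ge0 ?(ltW hn)//.
      by rewrite ler_wpM2l// lerXn2r ?nnegrE ?addr_ge0// lerDl.
    rewrite le_eqVlt; apply/orP; left; apply/eqP; field.
    by rewrite gt_eqF// ltr_wpDl.
  by rewrite mulrDr; apply: le_trans (lerD h2 h1) _; rewrite -splitr.
have -> : x i - x j = (t i - t j) + (softL2 M (x i) - softL2 M (x j)).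
  by rewrite /t; vec R (L2 R).
have h1 := tM i; have h2 := tM j.
apply: le_trans (snormD _ _ _) _.
have h3 : N (softL2 M (x i) - softL2 M (x j)) <= e / 3 + e / 3.
  exact: le_trans (snormBD _ _ _) (lerD h1 h2).
have -> : e = e / 3 + (e / 3 + e / 3) by field.
exact: lerD.
Qed.

End Tails.

(** * Bochner integrals of continuous curves *)

(** Measurability may fail for the norm of a curve; the integrals are suprema
    over the simple functions below, whatever the functions. *)
Lemma ge0_le_integral_any d (T : measurableType d) (R : realType)
    (mu : {measure set T -> \bar R}) (D : set T) (f g : T -> \bar R) :
  (forall x, D x -> (0 <= f x)%E) -> (forall x, D x -> (f x <= g x)%E) ->
  (\int[mu]_(x in D) f x <= \int[mu]_(x in D) g x)%E.
Proof.
move=> f0 fg; rewrite !(integral_mkcond D).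
have h10 x : (0 <= (f \_ D) x)%E by exact: erestrict_ge0.
have h20 x : (0 <= (g \_ D) x)%E.
  by apply: erestrict_ge0 => y Dy; exact: le_trans (f0 y Dy) (fg y Dy).
have h12 x : ((f \_ D) x <= (g \_ D) x)%E by exact: lee_restrict.
rewrite !ge0_integralTE//; apply: ereal_sup_le => _ [h hf <-].
by exists h => // x; exact: le_trans (hf x) (h12 x).
Qed.

Lemma normr_innerB_le (R : realType) (H : lmodType R) (ip : semi_inner H) x y z :
  `|ip x z - ip y z| <= snorm ip (x - y) * snorm ip z.
Proof. by rewrite -innerNl -innerDl normr_inner_le. Qed.

Section BochnerIntegrals.
Variable R : realType.
Local Notation ip := (@L2_inner R).
Local Notation N := (snorm ip).
Local Notation T := (measurableTypeR R).
Local Notation leb := (@lebesgue_measure R).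
Implicit Types (f : R -> L2 R) (t : R) (s : simple_L2 R).

Lemma simple_inner_integral s (D : set T) (e : L2 R) : measurable D ->
  (leb D < +oo)%E -> {in map fst s, forall A, measurable A} ->
  leb.-integrable D (EFin \o (fun r => ip (simple_eval s r) e)) /\
  (\int[leb]_(r in D) ip (simple_eval s r) e)%R = ip (simple_integral D s) e.
Proof.
move=> mD Doo; elim: s => [_|[A c] s IH mA].
  have E0 : (fun r : T => ip (simple_eval [::] r) e) = (fun=> 0).
    by apply/funext => r; rewrite /simple_eval big_nil inner0l.
  rewrite E0 /simple_integral big_nil inner0l; split.
    exact: integrable0.
  by rewrite Rintegral_cst// mul0r.
have mA' : measurable A by apply: mA; rewrite inE eqxx.
have [|i1 i2] := IH; first by move=> B Bs; apply: mA; rewrite inE Bs orbT.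
have E : (fun r : T => ip (simple_eval ((A, c) :: s) r) e) =
    (fun r => ip c e * \1_A r + ip (simple_eval s r) e).
  by apply/funext => r; rewrite /simple_eval big_cons innerDl innerZl mulrC.
have iA : leb.-integrable D (EFin \o (\1_A : T -> R)).
  apply/integrableP; split.
    by apply/measurable_EFinP; exact: measurable_indic.
  under eq_integral => r _ do rewrite /= ger0_norm//.
  rewrite integral_indic//; apply: le_lt_trans Doo; apply: le_measure.
  - by rewrite inE; exact: measurableI.
  - by rewrite inE.
  - exact: subIsetr.
have icA : leb.-integrable D (EFin \o (fun r => ip c e * \1_A r)).
  exact: (integrableZl mD (ip c e) iA).
rewrite E; split; first exact: (integrableD mD icA i1).
rewrite RintegralD// RintegralZl// i2 /simple_integral big_cons innerDl innerZl.
by rewrite /Rintegral integral_indic// mulrC.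
Qed.

Lemma ucont_inner_integrable f t e : 0 <= t -> loc_ucont ip f ->
  leb.-integrable `[0, t] (EFin \o (fun r => ip (f r) e)).
Proof.
(* Clamping the time to [[0, t]] extends the integrand continuously to the line. *)
move=> t0 fc; pose c r := Num.max 0 (Num.min t r).
have c0t r : 0 <= c r <= t.
  by rewrite /c le_max lexx/= ge_max t0/= ge_min lexx.
have cE r : r \in `[0, t] -> c r = r.
  by rewrite in_itv/= => /andP[r0 rt]; rewrite /c (min_idPr rt) (max_idPr r0).
have c_lip x y : x <= y -> 0 <= c y - c x <= y - x.
  move=> xy; have cP r : [\/ r <= 0 /\ c r = 0, 0 <= r <= t /\ c r = r | t <= r /\ c r = t].
    have [tr|/ltW rt] := leP t r.
      by apply: Or33; rewrite /c (min_idPl tr) (max_idPr t0).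
    have [r0|/ltW r0] := leP r 0; last by apply: Or32; rewrite cE ?in_itv/= ?r0 ?rt.
    by apply: Or31; rewrite /c (min_idPr rt) (max_idPl r0).
  have [[h1 ->]|[/andP[h1 h2] ->]|[h1 ->]] := cP x;
  have [[k1 ->]|[/andP[k1 k2] ->]|[k1 ->]] := cP y;
  by apply/andP; split; lra.
pose phi r := ip (f (c r)) e.
have phi_cont : continuous phi.
  move=> x; apply/cvgrPdist_le => eps eps0.
  have e1 : 0 < N e + 1 by rewrite ltr_wpDl// snorm_ge0.
  have [d d0 fd] := fc t _ (divr_gt0 eps0 e1).
  near=> y.
  have xyd : `|x - y| <= d.
    near: y; apply/nbhs_ballP; exists d => //= y; rewrite /ball/= => ?; exact: ltW.
  rewrite /phi (le_trans (normr_innerB_le _ _ _ _))//.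
  have h : N (f (c x) - f (c y)) <= eps / (N e + 1).
    have /andP[x0 xt] := c0t x; have /andP[y0 yt] := c0t y.
    move: xyd; rewrite ler_norml => /andP[h1 h2].
    have [xy|/ltW xy] := leP x y.
      have /andP[h3 h4] := c_lip _ _ xy; rewrite snormB; apply: fd => //; lra.
    have /andP[h3 h4] := c_lip _ _ xy; apply: fd => //; lra.
  apply: (@le_trans _ _ (eps / (N e + 1) * (N e + 1))).
    by apply: ler_pM; rewrite ?snorm_ge0// lerDl.
  by rewrite divfK// gt_eqF.
suff : leb.-integrable `[0, t] (EFin \o phi).
  by apply: eq_integrable => // r; rewrite inE/= => rt; rewrite /phi cE.
apply: continuous_compact_integrable; first exact: segment_compact.
exact: continuous_subspaceT.
Unshelve. all: by end_near. Qed.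

(** Pairing with a vector commutes with the integral, since it does so for simple
    functions. *)
Lemma bochner_weak f t (I e : L2 R) : 0 <= t -> loc_ucont ip f ->
  is_bochner_integral `[0, t] f I ->
  ip I e = (\int[leb]_(r in `[0%R, t]) ip (f r) e)%R.
Proof.
move=> t0 fc [s [ms _ sint sI]].
pose D : set T := `[0, t]%classic.
have mD : measurable D by exact: measurable_itv.
have Doo : (leb D < +oo)%E.
  by rewrite /D lebesgue_measure_itv/=; case: ifP => _; rewrite ?ltry// -EFinB ltry.
(* By homogeneity, the norm of [e] is at most one. *)
wlog Ne : e / N e <= 1.
  move=> wl; have e1 : 0 < N e + 1 by rewrite ltr_wpDl// snorm_ge0.
  have := wl ((N e + 1)^-1 *: e); rewrite snormZ ger0_norm ?invr_ge0 ?(ltW e1)//.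
  rewrite mulrC ler_pdivrMr// mul1r lerDl ler01 => /(_ isT).
  rewrite innerZr => h; apply: (mulfI (x := (N e + 1)^-1)); first by rewrite gt_eqF// invr_gt0.
  rewrite {}h -RintegralZl//; last exact: ucont_inner_integrable.
  by apply: eq_Rintegral => r _; rewrite innerZr.
have iphi := ucont_inner_integrable e t0 fc.
set J := (X in _ = X).
apply/eqP; rewrite -subr_eq0 -normr_le0; apply: (@eps_ler R) => eps eps0.
rewrite add0r; have eps2 : 0 < eps / 2 by rewrite divr_gt0.
have /fine_cvgP[[n1 _ fin1] /cvgrPdist_lt/(_ _ eps2)[n2 _ small]] := sint.
have /cvgrPdist_lt/(_ _ eps2)[n3 _ small3] := sI.
pose k := maxn n1 (maxn n2 n3).
have k1 : (n1 <= k)%N by exact: leq_maxl.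
have k2 : (n2 <= k)%N by rewrite (leq_trans (leq_maxl n2 n3))// leq_maxr.
have k3 : (n3 <= k)%N by rewrite (leq_trans (leq_maxr n2 n3))// leq_maxr.
have [ik Ek] := simple_inner_integral e mD Doo (ms k).
have hI : `|ip I e - ip (simple_integral D (s k)) e| <= eps / 2.
  rewrite (le_trans (normr_innerB_le _ _ _ _))//.
  have := small3 k k3; rewrite /= sub0r normrN L2normE ger0_norm ?snorm_ge0// => /ltW h.
  by rewrite (le_trans _ h)// ler_piMr// snorm_ge0.
have hJ : `|ip (simple_integral D (s k)) e - J| <= eps / 2.
  rewrite -Ek /J -RintegralB//.
  have iB : leb.-integrable D (EFin \o (fun r => ip (simple_eval (s k) r) e - ip (f r) e)).
    exact: (integrableB mD ik iphi).
  rewrite -lee_fin EFin_normr_Rintegral//.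
  apply: le_trans (le_abse_integral _ _ _) _ => //.
    by case/integrableP : iB.
  apply: (@le_trans _ _ (\int[leb]_(r in D) (L2norm (f r - simple_eval (s k) r))%:E)%E).
    apply: ge0_le_integral_any => // r _; rewrite L2normE.
    change (`|ip (simple_eval (s k) r) e - ip (f r) e|%:E <= (N (f r - simple_eval (s k) r))%:E)%E.
    rewrite lee_fin (le_trans (normr_innerB_le _ _ _ _))// snormB.
    by rewrite ler_piMr// snorm_ge0.
  have := fin1 k k1 => /fineK <-; rewrite lee_fin.
  have := small k k2; rewrite /= sub0r normrN => h.
  exact: le_trans (ler_norm _) (ltW h).
have -> : ip I e - J = (ip I e - ip (simple_integral D (s k)) e) +
  (ip (simple_integral D (s k)) e - J) by rewrite addrA subrK.
apply: le_trans (ler_normD _ _) _; rewrite [leRHS]splitr; exact: lerD.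
Qed.

Lemma bochner_unique f t (I J : L2 R) : 0 <= t -> loc_ucont ip f ->
  is_bochner_integral `[0, t] f I -> is_bochner_integral `[0, t] f J ->
  N (I - J) = 0.
Proof.
move=> t0 fc bI bJ; apply/eqP; rewrite -(@eqrXn2 _ 2)// ?snorm_ge0//.
rewrite expr0n/= sqr_snorm innerDl innerNl.
by rewrite (bochner_weak _ t0 fc bI) (bochner_weak _ t0 fc bJ) subrr.
Qed.

(** The last point is a cell of its own, so that the step function equals a nodal
    value of [f] at every point of the closed interval. *)
Definition step_partition f (tau : R) n : simple_L2 R :=
  rcons [seq (`[i%:R * tau, i.+1%:R * tau[%classic : set T, f (i%:R * tau)) | i <- iota 0 n]
   ([set n%:R * tau], f (n%:R * tau)).

Lemma step_partition_eval f tau n r : 0 < tau -> 0 <= r -> r <= n%:R * tau ->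
  exists2 i : nat, simple_eval (step_partition f tau n) r = f (i%:R * tau) &
    i%:R * tau <= r <= i%:R * tau + tau /\ (i <= n)%N.
Proof.
move=> tau0 r0; rewrite le_eqVlt => /predU1P[->|rn].
  exists n; last by rewrite lexx lerDl ltW.
  rewrite /simple_eval big_rcons/= indicE mem_set// scale1r big_map.
  rewrite big1_seq ?add0r// ?addr0// => i; rewrite mem_iota/= add0n => in_.
  rewrite indicE memNset ?scale0r//= in_itv/= => /andP[_].
  by rewrite ltNge ler_wpM2r ?(ltW tau0)// ler_nat.
have q0 : 0 <= r / tau by rewrite divr_ge0// ltW.
have := truncn_itv q0; set i := Num.truncn _ => /andP[h1 h2].
have ir : i%:R * tau <= r by rewrite -ler_pdivlMr.
have ri : r < i.+1%:R * tau by rewrite -ltr_pdivrMr.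
have in_ : (i < n)%N.
  by rewrite -(ltr_nat R) -(ltr_pM2r tau0) (le_lt_trans ir).
exists i; last first.
  by rewrite ir (ltnW in_) /=; split => //; move: ri; rewrite mulrSr mulrDl mul1r => /ltW.
rewrite /simple_eval big_rcons/= [X in X *: f (n%:R * tau)](_ : _ = 0); last first.
  by rewrite indicE memNset//= => re; rewrite -re ltxx in rn.
rewrite scale0r ?add0r ?addr0 big_map.
rewrite (bigD1_seq i) ?mem_iota ?iota_uniq//= indicE mem_set; last first.
  by rewrite /= in_itv/= ir.
rewrite scale1r big1 ?addr0// => j ji; rewrite indicE memNset ?scale0r//=.
rewrite in_itv/= => /andP[jr rj]; move/negP: ji; apply; apply/eqP/anti_leq/andP; split.
  by rewrite -ltnS -(ltr_nat R) -(ltr_pM2r tau0) (le_lt_trans jr).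
by rewrite -ltnS -(ltr_nat R) -(ltr_pM2r tau0) (le_lt_trans ir).
Qed.

Lemma step_partition_integral f tau n : 0 < tau ->
  simple_integral `[0, n%:R * tau] (step_partition f tau n) =
  tau *: \sum_(i < n) f (i%:R * tau).
Proof.
move=> tau0; rewrite /simple_integral big_rcons/=.
rewrite [X in fine X *: f (n%:R * tau)](_ : _ = 0%E); last first.
  apply: (@subset_measure0 _ _ _ leb _ [set n%:R * tau]) => //.
  - by apply: measurableI => //; exact: measurable_itv.
  - exact: lebesgue_measure_set1.
rewrite scale0r ?add0r ?addr0 big_map scaler_sumr -(big_mkord xpredT (fun i => tau *: f (i%:R * tau))).
rewrite /index_iota subn0 !big_seq; apply: eq_bigr => i; rewrite mem_iota add0n/= => in_.
congr (_ *: _); rewrite setIidl; last first.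
  move=> r /=; rewrite !in_itv/= => /andP[h1 h2].
  rewrite (le_trans _ h1) ?mulr_ge0 ?(ltW tau0)//= (le_trans (ltW h2))//.
  by rewrite ler_wpM2r ?(ltW tau0)// ler_nat.
rewrite lebesgue_measure_itv/= lte_fin ltr_pM2r// ltr_nat ltnSn -EFinB/=.
by rewrite mulrSr; ring.
Qed.

(** Riemann sums are integrals of step functions that converge uniformly to [f]. *)
Lemma primitive_bochner f J t : loc_ucont ip f -> primitive ip f J -> 0 < t ->
  is_bochner_integral `[0, t] f (J t).
Proof.
move=> fc fJ t0.
pose tau k : R := t / k.+1%:R.
have tau0 k : 0 < tau k by rewrite divr_gt0.
have tauE k : k.+1%:R * tau k = t by rewrite /tau mulrC divfK.
have tau_small (d : R) : 0 < d -> exists n, forall k, (n <= k)%N -> tau k <= d.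
  move=> d0; have dt : 0 < d / t by rewrite divr_gt0.
  have [n _ nP] := near_infty_natSinv_lt (PosNum dt).
  exists n => k nk; have := nP k nk; rewrite /= => /ltW h.
  by rewrite /tau mulrC -ler_pdivlMr.
have close (e : R) : 0 < e -> exists n, forall k, (n <= k)%N -> forall r,
    0 <= r -> r <= t -> N (f r - simple_eval (step_partition f (tau k) k.+1) r) <= e.
  move=> e0; have [d d0 fd] := fc t e e0; have [n nP] := tau_small d d0.
  exists n => k nk r r0 rt.
  have [|i -> [/andP[h1 h2] _]] := @step_partition_eval f (tau k) k.+1 r (tau0 k) r0.
    by rewrite tauE.
  apply: fd => //; first by rewrite mulr_ge0// ltW.
  by have := nP k nk; lra.
exists (fun k => step_partition f (tau k) k.+1); split.
- move=> k A; rewrite /step_partition map_rcons mem_rcons inE => /predU1P[->|].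
    exact: measurable_set1.
  by rewrite -map_comp => /mapP[i _ ->] /=; exact: measurable_itv.
- apply: aeW => r; rewrite /= in_itv/= => /andP[r0 rt].
  apply/cvgrPdist_le => e e0; have [n nP] := close e e0.
  exists n => // k nk; rewrite sub0r normrN L2normE ger0_norm ?snorm_ge0//.
  exact: nP.
- apply/fine_cvgP.
  have bound (e : R) : 0 < e -> exists n, forall k, (n <= k)%N ->
    (0 <= \int[leb]_(r in `[0%R, t]) (L2norm (f r - simple_eval (step_partition f (tau k) k.+1) r))%:E <= (e * t)%:E)%E.
    move=> e0; have [n nP] := close e e0; exists n => k nk; apply/andP; split.
      by apply: integral_ge0 => r _; rewrite lee_fin L2normE snorm_ge0.
    apply: (@le_trans _ _ (\int[leb]_(r in `[0%R, t]) e%:E)%E).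
      apply: ge0_le_integral_any => r; rewrite /= in_itv/= => /andP[r0 rt].
        by rewrite lee_fin L2normE snorm_ge0.
      by rewrite lee_fin L2normE nP.
    have lebD : leb (`[0%R, t]%classic : set T) = t%:E.
      by rewrite lebesgue_measure_itv/= lte_fin t0 -EFinB subr0.
    by rewrite integral_cst// [X in (_ * X)%E](_ : _ = t%:E) ?EFinM//; exact: lebD.
  split.
    have [n nP] := bound 1 ltr01; exists n => // k nk.
    have /andP[h1 h2] := nP k nk.
    by rewrite ge0_fin_numE// (le_lt_trans h2)// ltry.
  apply/cvgrPdist_le => e e0; have [n nP] := bound (e / t) (divr_gt0 e0 t0).
  exists n => // k nk; have /andP[h1 h2] := nP k nk.
  rewrite sub0r normrN ger0_norm ?fine_ge0//=.
  rewrite -lee_fin fineK; last by rewrite ge0_fin_numE// (le_lt_trans h2)// ltry.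
  by apply: le_trans h2 _; rewrite lee_fin divfK// gt_eqF.
- apply/cvgrPdist_le => e e0.
  have [eta eta0 etaP] := primitive_riemann_sum t fJ (divr_gt0 e0 t0).
  have [n nP] := tau_small eta eta0.
  exists n => // k nk; rewrite sub0r normrN L2normE ger0_norm ?snorm_ge0//.
  have := etaP (tau k) k.+1 (ltW (tau0 k)) (nP k nk); rewrite tauE => /(_ (lexx _)).
  have := step_partition_integral f k.+1 (tau0 k); rewrite tauE => ->.
  by rewrite [t * _]mulrC divfK// gt_eqF.
Qed.

End BochnerIntegrals.

(** * The projected Euler scheme *)

Section Force.
Variables (R : realType) (H : lmodType R) (ip : semi_inner H).
Local Notation N := (snorm ip).
Variables (K : set H) (F : H -> H) (C : R).
Hypotheses (C0 : 0 <= C) (F_bnd : forall x, K x -> N (F x) <= C * (1 + N x)).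
Hypothesis F_ucont : forall e, 0 < e -> exists2 d : R, 0 < d &
  forall x y, K x -> K y -> N (x - y) <= d -> N (F x - F y) <= e.

Lemma force_ucont X : (forall t, 0 <= t -> K (X t)) -> loc_lip ip X ->
  loc_ucont ip (F \o X).
Proof.
move=> KX lipX T e e0; have [d d0 Fd] := F_ucont e0; have [L L0 lX] := lipX T.
have L1 : 0 < L + 1 by rewrite ltr_wpDl.
exists (d / (L + 1)); first by rewrite divr_gt0.
move=> s t s0 st tT; rewrite ler_pdivlMr// => h; apply: Fd.
- exact: KX (le_trans s0 st).
- exact: KX.
apply: le_trans (lX s t s0 st tT) _; apply: le_trans h.
by rewrite mulrC ler_wpM2l ?subr_ge0// lerDl.
Qed.

Lemma force_bounded X T : (forall t, 0 <= t -> K (X t)) -> loc_lip ip X ->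
  exists2 M, 0 <= M & forall t, 0 <= t -> t <= T -> N (F (X t)) <= M.
Proof.
move=> KX lipX; have [L L0 lX] := lipX T.
have [T0|T0] := ltP T 0.
  by exists 0 => // t t0 tT; have := le_lt_trans (le_trans t0 tT) T0; rewrite ltxx.
exists (C * (1 + (N (X 0) + L * T))).
  by rewrite mulr_ge0// addr_ge0// addr_ge0 ?snorm_ge0// mulr_ge0.
move=> t t0 tT; apply: le_trans (F_bnd (KX t t0)) _.
rewrite ler_wpM2l// lerD2l.
have := lX 0 t (lexx _) t0 tT; rewrite subr0 => h.
have := snorm_triangle ip (X 0) (X t) 0; rewrite !subr0 => h2.
have : L * t <= L * T by rewrite ler_wpM2l.
move=> h3; lra.
Qed.

Lemma force_primitive X : scomplete ip -> (forall t, 0 <= t -> K (X t)) ->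
  loc_lip ip X -> exists2 J, primitive ip (F \o X) J &
  forall v, loc_lip ip (fun t => v + J t).
Proof.
move=> cH KX lipX; have [J JP] := primitive_exists cH (force_ucont KX lipX).
exists J => // v T; have [M M0 MP] := force_bounded T KX lipX; exists M => //.
move=> s t s0 st tT; have := primitive_lip JP MP s0 st tT.
by have -> : v + J t - (v + J s) = J t - J s by vec R H.
Qed.

End Force.

Section Euler.
Variables (R : realType) (H : lmodType R) (ip : semi_inner H).
Local Notation N := (snorm ip).
Variables (K : set H) (F PK : H -> H) (C : R) (x0 v0 : H).
Implicit Types (tau T e t s : R) (n m k : nat).
Hypotheses (C0 : 0 <= C) (F_bnd : forall x, K x -> N (F x) <= C * (1 + N x)).
Hypotheses (K_PK : forall x, K (PK x)).
Hypotheses (PK_var : forall x y, K y -> ip (x - PK x) (y - PK x) <= 0).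
Hypotheses (K0 : K 0) (Kx0 : K x0).

(** Discretization of [X' + dI_K(X) ∋ G], [G' = F(X)], implicit in the cone and
    explicit in the force; the result is the pair [(X, G)]. *)
Fixpoint euler tau n : H * H :=
  if n is n'.+1 then
    (PK ((euler tau n').1 + tau *: (euler tau n').2),
     (euler tau n').2 + tau *: F (euler tau n').1)
  else (x0, v0).

Local Notation EX tau n := (euler tau n).1.
Local Notation EG tau n := (euler tau n).2.

Lemma euler_cone tau n : K (EX tau n).
Proof. by case: n => /=. Qed.

Lemma projection_contracts x y : K y -> N (PK x - y) <= N (x - y).
Proof.
move=> Ky; have [->|n0] := eqVneq (N (PK x - y)) 0; first exact: snorm_ge0.
rewrite -(@ler_pM2r _ (N (PK x - y))) ?lt_def ?n0 ?snorm_ge0//.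
apply: le_trans (cauchy_schwarz _ _ _); rewrite -expr2 sqr_snorm.
have -> : ip (x - y) (PK x - y) = ip (PK x - y) (PK x - y) - ip (x - PK x) (y - PK x).
  rewrite -innerNr opprB -innerDl.
  by have -> : PK x - y + (x - PK x) = x - y by vec R H.
by rewrite lerBrDl gerDr PK_var.
Qed.

Definition growth T : R := expR ((1 + C) * T) * (1 + N x0 + N v0).

Lemma growth_ge0 T : 0 <= growth T.
Proof. by rewrite mulr_ge0 ?expR_ge0// !addr_ge0 ?snorm_ge0. Qed.

Lemma exp_growth tau c n (u : nat -> R) T : 0 <= tau -> 0 <= c -> 0 <= u 0%N ->
  n%:R * tau <= T ->
  (forall k, (k < n)%N -> u k.+1 <= u k * (1 + tau * c)) ->
  u n <= expR (c * T) * u 0%N.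
Proof.
move=> tau0 c0 u0 nT uS.
apply: (@le_trans _ _ (expR (c * (n%:R * tau)) * u 0%N)); last first.
  by rewrite ler_wpM2r// ler_expR ler_wpM2l.
elim: n uS {nT} => [_|n IH uS]; first by rewrite mul0r mulr0 expR0 mul1r.
have h := IH (fun k kn => uS k (ltnW kn)).
apply: le_trans (uS n (ltnSn n)) _.
have -> : c * (n.+1%:R * tau) = c * (n%:R * tau) + tau * c by rewrite mulrSr; ring.
rewrite expRD mulrAC; set E := expR (c * _) * _ in h *.
apply: (@le_trans _ _ (E * (1 + tau * c))).
  by rewrite ler_wpM2r// addr_ge0// mulr_ge0.
by rewrite ler_wpM2l ?expR_ge1Dx// mulr_ge0// expR_ge0.
Qed.

Lemma euler_bound tau n T : 0 <= tau -> n%:R * tau <= T ->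
  N (EX tau n) <= growth T /\ N (EG tau n) <= growth T.
Proof.
move=> tau0 nT; pose u k := 1 + N (EX tau k) + N (EG tau k).
have u0 : 0 <= u 0%N by rewrite !addr_ge0 ?snorm_ge0.
suff : u n <= growth T.
  have := snorm_ge0 ip (EX tau n); have := snorm_ge0 ip (EG tau n).
  by rewrite /u => *; split; lra.
apply: (exp_growth tau0 _ u0 nT); first by rewrite addr_ge0.
move=> k _; rewrite /u /=.
set x := EX tau k; set g := EG tau k.
have h1 : N (PK (x + tau *: g)) <= N x + tau * N g.
  have := projection_contracts (x + tau *: g) K0; rewrite !subr0 => h.
  apply: le_trans h _; apply: le_trans (snormD _ _ _) _.
  by rewrite snormZ ger0_norm.
have h2 : N (g + tau *: F x) <= N g + tau * (C * (1 + N x)).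
  apply: le_trans (snormD _ _ _) _; rewrite lerD2l snormZ ger0_norm//.
  by rewrite ler_wpM2l// F_bnd//; exact: euler_cone.
have h3 : 0 <= tau * (C * N g) by rewrite !mulr_ge0// snorm_ge0.
have h4 : 0 <= tau * N x by rewrite mulr_ge0// snorm_ge0.
lra.
Qed.

Lemma euler_step tau n T : 0 <= tau -> n%:R * tau <= T ->
  N (EX tau n.+1 - EX tau n) <= tau * growth T /\
  N (EG tau n.+1 - EG tau n) <= tau * (C * (1 + growth T)).
Proof.
move=> tau0 nT; have [hX hG] := euler_bound tau0 nT; split => /=.
  apply: le_trans (projection_contracts _ (euler_cone tau n)) _.
  by rewrite addrAC subrr add0r snormZ ger0_norm// ler_wpM2l.
rewrite addrAC subrr add0r snormZ ger0_norm// ler_wpM2l//.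
apply: le_trans (F_bnd (euler_cone tau n)) _.
by rewrite ler_wpM2l// lerD2l.
Qed.

Lemma euler_lip tau m n T : 0 <= tau -> (m <= n)%N -> n%:R * tau <= T ->
  N (EX tau n - EX tau m) <= (n - m)%:R * (tau * growth T) /\
  N (EG tau n - EG tau m) <= (n - m)%:R * (tau * (C * (1 + growth T))).
Proof.
move=> tau0 /subnKC <-; rewrite addKn; elim: (n - m)%N => [_|k IH kT].
  by rewrite addn0 !subrr !snorm0 !mul0r.
have kT' : (m + k)%:R * tau <= T.
  by apply: le_trans kT; rewrite ler_wpM2r// ler_nat addnS.
have [h1 h2] := IH kT'; have [h3 h4] := euler_step tau0 kT'.
rewrite addnS mulrSr !mulrDl !mul1r; split.
  apply: le_trans (snorm_triangle ip (EX tau (m + k)) _ _) _.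
  by rewrite addrC; exact: lerD.
apply: le_trans (snorm_triangle ip (EG tau (m + k)) _ _) _.
by rewrite addrC; exact: lerD.
Qed.

(** The variational inequality of the projection, tested with [Z]. *)
Lemma euler_evi_step tau n Z : K Z -> 0 <= tau ->
  ip (EX tau n.+1 - Z) (EX tau n.+1 - Z) <=
  ip (EX tau n - Z) (EX tau n - Z) + 2 * (tau * ip (EG tau n) (EX tau n.+1 - Z)).
Proof.
move=> KZ tau0 /=; set x := EX tau n; set g := EG tau n; set y := PK _.
have := PK_var (x + tau *: g) KZ; rewrite -/y => h.
have := inner_ge0 ip (y - x) => h2.
have E : ip (x - Z) (x - Z) + 2 * (tau * ip g (y - Z)) - ip (y - Z) (y - Z) =
  ip (y - x) (y - x) - 2 * ip (x + tau *: g - y) (Z - y).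
  rewrite !innerE (innerC _ Z x) (innerC _ y x) (innerC _ Z y); ring.
lra.
Qed.

Lemma euler_evi tau m n Z D : K Z -> 0 <= tau -> (m <= n)%N ->
  (forall k, (m <= k)%N -> (k < n)%N -> ip (EG tau k) (EX tau k.+1 - Z) <= D) ->
  ip (EX tau n - Z) (EX tau n - Z) <=
  ip (EX tau m - Z) (EX tau m - Z) + 2 * ((n - m)%:R * tau * D).
Proof.
move=> KZ tau0 /subnKC <-; rewrite addKn; elim: (n - m)%N => [_|k IH kD].
  by rewrite addn0 !mul0r mulr0 addr0.
have h1 := IH (fun i mi ik => kD i mi (leq_trans ik (leq_add (leqnn m) (leqnSn k)))).
have h2 := kD (m + k)%N (leq_addr _ _).
rewrite addnS ltnSn in h2; have {}h2 := h2 isT.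
rewrite addnS; apply: le_trans (euler_evi_step (m + k) KZ tau0) _.
have h3 : tau * ip (EG tau (m + k)) (EX tau (m + k).+1 - Z) <= tau * D by rewrite ler_wpM2l.
rewrite mulrSr; move: h1 h3; set a := ip (EX tau (m + k) - Z) _.
set b := ip (EX tau m - Z) _; set c := tau * ip _ _; move=> h1 h3; lra.
Qed.

Lemma euler_velocityE tau n :
  EG tau n = v0 + tau *: \sum_(k < n) F (EX tau k).
Proof.
elim: n => [|n IH]; first by rewrite big_ord0 scaler0 addr0.
by rewrite big_ord_recr/= IH scalerDr addrA.
Qed.

Section Limit.
Variable U : set_system nat.
Hypotheses (ultraU : UltraFilter U) (ooU : \oo `<=` U).

Let filterU : Filter U := @filter_filter _ _ (@ultra_proper _ _ ultraU).
Let UI (A B : set nat) : U A -> U B -> U (A `&` B) := @filterI _ U filterU A B.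
Let US (A B : set nat) : A `<=` B -> U A -> U B := @filterS _ U filterU A B.
Let exU (A : set nat) : U A -> exists j, A j := @filter_ex _ _ (@ultra_proper _ _ ultraU) A.

Definition mesh (j : nat) : R := j.+1%:R^-1.
Definition cell_of (j : nat) t : nat := Num.truncn (t / mesh j).
Definition euler_curve j t : H := EX (mesh j) (cell_of j t).
Definition euler_drift j t : H := EG (mesh j) (cell_of j t).

Lemma mesh_gt0 j : 0 < mesh j. Proof. by rewrite invr_gt0. Qed.
Lemma mesh_ge0 j : 0 <= mesh j. Proof. exact/ltW/mesh_gt0. Qed.

Lemma cell_ofP j t : 0 <= t ->
  (cell_of j t)%:R * mesh j <= t /\ t <= (cell_of j t)%:R * mesh j + mesh j.
Proof.
move=> t0; have q0 : 0 <= t / mesh j by rewrite divr_ge0// mesh_ge0.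
have /andP[h1 h2] := truncn_itv q0; split.
  by rewrite -ler_pdivlMr ?mesh_gt0.
have -> : (cell_of j t)%:R * mesh j + mesh j = (cell_of j t).+1%:R * mesh j.
  by rewrite mulrSr mulrDl mul1r.
by rewrite -ler_pdivrMr ?mesh_gt0// ltW.
Qed.

Lemma cell_of_mesh j k : cell_of j (k%:R * mesh j) = k.
Proof. by rewrite /cell_of mulfK ?natrK// gt_eqF// mesh_gt0. Qed.

Lemma cell_of_le j s t : s <= t -> (cell_of j s <= cell_of j t)%N.
Proof. by move=> st; apply: le_truncn; rewrite ler_wpM2r// invr_ge0 mesh_ge0. Qed.

Lemma mesh_small e : 0 < e -> U [set j | mesh j <= e].
Proof.
move=> e0; apply: ooU; have [n _ nP] := near_infty_natSinv_lt (PosNum e0).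
by exists n => // j nj; exact/ltW/nP.
Qed.

Lemma cell_of_sub j s t : 0 <= s -> s <= t ->
  (cell_of j t - cell_of j s)%:R * mesh j <= t - s + mesh j /\
  t - s - mesh j <= (cell_of j t - cell_of j s)%:R * mesh j.
Proof.
move=> s0 st; have [h1 h2] := cell_ofP j s0; have [h3 h4] := cell_ofP j (le_trans s0 st).
rewrite natrB ?cell_of_le// mulrBl; split; lra.
Qed.

Lemma euler_curve_lip j s t T : 0 <= s -> s <= t -> t <= T ->
  N (euler_curve j t - euler_curve j s) <= (t - s + mesh j) * growth T.
Proof.
move=> s0 st tT; have [h1 _] := cell_of_sub j s0 st.
have [h3 _] := cell_ofP j (le_trans s0 st).
have [h _] := euler_lip (mesh_ge0 j) (cell_of_le j st) (le_trans h3 tT).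
by apply: le_trans h _; rewrite mulrA ler_wpM2r ?growth_ge0.
Qed.

Variable X : R -> H.
Hypothesis Xlim : forall t e, 0 <= t -> 0 < e -> U [set j | N (euler_curve j t - X t) <= e].
Hypothesis KX : forall t, 0 <= t -> K (X t).

Lemma limit_lip T : lip_until ip X T (growth T).
Proof.
move=> s t s0 st tT; set B := growth T.
have B0 : 0 <= B := growth_ge0 T.
apply: (@eps_ler R) => e e0; pose e1 := e / (2 + B).
have B2 : 0 < 2 + B by rewrite ltr_pwDl.
have e10 : 0 < e1 by rewrite divr_gt0.
have t0 := le_trans s0 st.
have := UI (UI (Xlim t0 e10) (Xlim s0 e10)) (mesh_small e10).
move=> /exU[j [[/= ht hs] hm]].
have hl := euler_curve_lip j s0 st tT.
have -> : X t - X s = - (euler_curve j t - X t) + (euler_curve j s - X s)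
    + (euler_curve j t - euler_curve j s) by vec R H.
apply: le_trans (snormD _ _ _) _.
have h1 := snormD ip (- (euler_curve j t - X t)) (euler_curve j s - X s).
rewrite snormN in h1.
have h2 : mesh j * B <= e1 * B by rewrite ler_wpM2r.
have h3 : e1 * (2 + B) = e by rewrite divfK// gt_eqF.
rewrite -/B in hl; lra.
Qed.

Lemma limit_loc_lip : loc_lip ip X.
Proof. by move=> T; exists (growth T); [exact: growth_ge0|exact: limit_lip]. Qed.

Lemma limit_grid n h e : 0 <= h -> 0 < e ->
  U [set j | forall i, (i <= n)%N -> N (euler_curve j (i%:R * h) - X (i%:R * h)) <= e].
Proof.
move=> h0 e0; elim: n => [|n IH].
  have := Xlim (mulr_ge0 (ler0n R 0) h0) e0.
  by apply: US => j hj i; rewrite leqn0 => /eqP ->.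
have := UI IH (Xlim (mulr_ge0 (ler0n R n.+1) h0) e0).
apply: US => j [/= h1 h2] i; rewrite leq_eqVlt ltnS => /predU1P[->//|].
exact: h1.
Qed.

(** The curves are equi-Lipschitz up to the mesh, so pointwise limits along the
    ultrafilter are uniform on bounded intervals. *)
Lemma limit_uniform T e : 0 <= T -> 0 < e -> U [set j | forall t, 0 <= t -> t <= T ->
  N (euler_curve j t - X t) <= e].
Proof.
move=> T0 e0; set B := growth T; have B0 : 0 <= B := growth_ge0 T.
pose h := e / (4 * (B + 1)).
have B1 : 0 < 4 * (B + 1) by rewrite mulr_gt0// ltr_wpDl.
have h0 : 0 < h by rewrite divr_gt0.
have hB : h * (4 * (B + 1)) = e by rewrite divfK// gt_eqF.
have e4 : 0 < e / 4 by rewrite divr_gt0.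
have := UI (limit_grid (Num.truncn (T / h)) (ltW h0) e4) (mesh_small h0).
apply: US => j [/= hg hm] t t0 tT.
have q0 : 0 <= t / h by rewrite divr_ge0// ltW.
pose i := Num.truncn (t / h).
have /andP[i1 i2] := truncn_itv q0; rewrite -/i in i1 i2.
have it : i%:R * h <= t by rewrite -ler_pdivlMr.
have ti : t - i%:R * h <= h.
  by move: i2; rewrite ltr_pdivrMr// mulrSr mulrDl mul1r => /ltW; lra.
have i0 : 0 <= i%:R * h by rewrite mulr_ge0// ltW.
have iT : (i <= Num.truncn (T / h))%N.
  by apply: le_truncn; rewrite ler_wpM2r// invr_ge0 ltW.
have g1 := hg i iT.
have g2 := euler_curve_lip j i0 it tT.
have g3 := limit_lip i0 it tT.
have -> : euler_curve j t - X t = (euler_curve j t - euler_curve j (i%:R * h)) +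
   (euler_curve j (i%:R * h) - X (i%:R * h)) - (X t - X (i%:R * h)) by vec R H.
apply: le_trans (snormD _ _ _) _; rewrite snormN.
have g4 := snormD ip (euler_curve j t - euler_curve j (i%:R * h)) (euler_curve j (i%:R * h) - X (i%:R * h)).
have g5 : (t - i%:R * h + mesh j) * B <= (h + h) * B by rewrite ler_wpM2r// lerD.
have g6 : B * (t - i%:R * h) <= B * h by rewrite ler_wpM2l.
rewrite -/B in g2 g3; lra.
Qed.

Hypothesis F_ucont : forall e, 0 < e -> exists2 d : R, 0 < d &
  forall x y, K x -> K y -> N (x - y) <= d -> N (F x - F y) <= e.
Variable J : R -> H.
Hypothesis FJ : primitive ip (F \o X) J.
Let G t := v0 + J t.

(** The accumulated forces are Riemann sums of [F] along the scheme, which is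
    uniformly close to [X]. *)
Lemma limit_drift t e : 0 <= t -> 0 < e -> U [set j | N (euler_drift j t - G t) <= e].
Proof.
move=> t0 e0.
have [M M0 MP] := force_bounded C0 F_bnd t KX limit_loc_lip.
pose e1 := e / (2 * t + M + 1).
have D0 : 0 < 2 * t + M + 1 by rewrite ltr_wpDl// addr_ge0// mulr_ge0.
have e10 : 0 < e1 by rewrite divr_gt0.
have e1E : e1 * (2 * t + M + 1) = e by rewrite divfK// gt_eqF.
have [d d0 Fd] := F_ucont e10.
have [eta eta0 etaP] := primitive_riemann_sum t FJ e10.
have := UI (limit_uniform t0 d0) (UI (mesh_small eta0) (mesh_small e10)).
apply: US => j [/= hu [hm1 hm2]].
pose n := cell_of j t; have [h1 h2] := cell_ofP j t0; rewrite -/n in h1 h2.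
have nm0 : 0 <= n%:R * mesh j by rewrite mulr_ge0// mesh_ge0.
have r1 := etaP (mesh j) n (mesh_ge0 j) hm1 h1.
have r2 : N (J t - J (n%:R * mesh j)) <= M * (t - n%:R * mesh j).
  exact: primitive_lip FJ MP _ _ nm0 h1 (lexx _).
have r3 : N (mesh j *: \sum_(k < n) F (EX (mesh j) k) -
    mesh j *: \sum_(k < n) (F \o X) (k%:R * mesh j)) <= n%:R * mesh j * e1.
  rewrite -scalerBr -sumrB snormZ ger0_norm ?mesh_ge0//.
  rewrite [n%:R * _]mulrC -mulrA ler_wpM2l ?mesh_ge0//.
  apply: le_trans (snorm_sum _ _ _ _) _.
  have -> : n%:R * e1 = \sum_(k < n) e1 by rewrite sumr_const card_ord mulr_natl.
  apply: ler_sum => k _; apply: Fd.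
  - exact: euler_cone.
  - by apply: KX; rewrite mulr_ge0// mesh_ge0.
  have km0 : 0 <= k%:R * mesh j by rewrite mulr_ge0// mesh_ge0.
  have kmt : k%:R * mesh j <= t.
    by apply: le_trans h1; rewrite ler_wpM2r ?mesh_ge0// ler_nat ltnW.
  by have := hu _ km0 kmt; rewrite /euler_curve cell_of_mesh.
rewrite /euler_drift euler_velocityE -/n /G.
set S1 := mesh j *: \sum_(k < n) _ in r3 *; set S2 := mesh j *: _ in r1 r3.
have -> : v0 + S1 - (v0 + J t) = (S1 - S2) - (J (n%:R * mesh j) - S2) - (J t - J (n%:R * mesh j)).
  by vec R H.
apply: le_trans (snormD _ _ _) _; rewrite snormN.
have r4 := snormD ip (S1 - S2) (- (J (n%:R * mesh j) - S2)); rewrite snormN in r4.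
have r5 : n%:R * mesh j * e1 <= t * e1 by rewrite ler_wpM2r// ltW.
have r6 : M * (t - n%:R * mesh j) <= M * e1.
  by rewrite ler_wpM2l//; lra.
lra.
Qed.

(** Add up [euler_evi_step] between the cells of [s] and [t]. There the position
    and the velocity differ from their values at [s] by [O(t - s)] up to the mesh, which
    makes the error quadratic in [t - s]; the mesh disappears in the limit. *)
Lemma limit_evi_local T Z : K Z -> exists2 E, 0 <= E & forall s t, 0 <= s -> s <= t ->
  t <= T -> ip (X t - Z) (X t - Z) <=
    ip (X s - Z) (X s - Z) + (t - s) * (2 * ip (G s) (X s - Z)) + E * (t - s) ^+ 2.
Proof.
move=> KZ; set B := growth T; have B0 : 0 <= B := growth_ge0 T.
pose L := C * (1 + B); have L0 : 0 <= L by rewrite mulr_ge0// addr_ge0.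
have NZ0 := snorm_ge0 ip Z.
pose E := L * (B + N Z) + B * B.
have E0 : 0 <= E by rewrite addr_ge0// mulr_ge0// addr_ge0.
exists (2 * E); first exact: mulr_ge0.
move=> s t s0 st tT; have t0 := le_trans s0 st.
have discrete j : ip (euler_curve j t - Z) (euler_curve j t - Z) <=
  ip (euler_curve j s - Z) (euler_curve j s - Z) +
  (t - s) * (2 * ip (euler_drift j s) (euler_curve j s - Z)) + 2 * E * (t - s) ^+ 2 +
  mesh j * (2 * (B * (B + N Z)) + 2 * E * (3 * (t - s) + 2 * mesh j)).
  pose m := cell_of j s; pose n := cell_of j t.
  have mn : (m <= n)%N by exact: cell_of_le.
  have [nt _] := cell_ofP j t0; rewrite -/n in nt.
  have nT : n%:R * mesh j <= T := le_trans nt tT.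
  have mT : m%:R * mesh j <= T.
    by apply: le_trans nT; rewrite ler_wpM2r ?mesh_ge0// ler_nat.
  have [mX mG] := euler_bound (mesh_ge0 j) mT.
  have mu0 := mesh_ge0 j; set mu := mesh j in mu0 *.
  have [d1 d2] := cell_of_sub j s0 st; rewrite -/m -/n -/mu in d1 d2.
  set A := ip (euler_drift j s) (euler_curve j s - Z).
  have Aabs : `|A| <= B * (B + N Z).
    apply: le_trans (normr_inner_le _ _ _) _; apply: ler_pM; rewrite ?snorm_ge0//.
    by apply: le_trans (snormD _ _ _) _; rewrite snormN lerD2r.
  pose D := A + E * (t - s + 2 * mu).
  have ev : ip (EX mu n - Z) (EX mu n - Z) <=
      ip (EX mu m - Z) (EX mu m - Z) + 2 * ((n - m)%:R * mu * D).
    apply: euler_evi => // k mk kn.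
    have kT : k.+1%:R * mu <= T by apply: le_trans nT; rewrite ler_wpM2r// ler_nat.
    have kT' : k%:R * mu <= T by apply: le_trans kT; rewrite ler_wpM2r// ler_nat.
    have kle i : (m <= i)%N -> (i <= n.+1)%N -> (i - m)%:R * mu <= t - s + 2 * mu.
      move=> mi iN; have : (i - m)%:R <= (n - m)%:R + 1 :> R.
        by rewrite -[1]/(1%:R) -natrD ler_nat addn1 -subSn// leq_sub2r.
      move=> h; have : (i - m)%:R * mu <= ((n - m)%:R + 1) * mu by rewrite ler_wpM2r.
      rewrite mulrDl mul1r; lra.
    have [_ hG] := euler_lip mu0 mk kT'.
    have [hX _] := euler_lip mu0 (leq_trans mk (leqnSn k)) kT.
    have [bX _] := euler_bound mu0 kT.
    have -> : ip (EG mu k) (EX mu k.+1 - Z) = A + ip (EG mu m) (EX mu k.+1 - EX mu m)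
       + ip (EG mu k - EG mu m) (EX mu k.+1 - Z).
      rewrite /A /euler_drift /euler_curve -/m -/mu !innerE; ring.
    rewrite /D -addrA lerD2l.
    have g1 : ip (EG mu m) (EX mu k.+1 - EX mu m) <= B * ((t - s + 2 * mu) * B).
      apply: le_trans (cauchy_schwarz _ _ _) _; apply: ler_pM; rewrite ?snorm_ge0//.
      by apply: le_trans hX _; rewrite mulrA ler_wpM2r// kle// ltnW.
    have g2 : ip (EG mu k - EG mu m) (EX mu k.+1 - Z) <= ((t - s + 2 * mu) * L) * (B + N Z).
      apply: le_trans (cauchy_schwarz _ _ _) _; apply: ler_pM; rewrite ?snorm_ge0//.
        by apply: le_trans hG _; rewrite mulrA ler_wpM2r// kle// ltnW// ltnS ltnW.
      by apply: le_trans (snormD _ _ _) _; rewrite snormN lerD2r.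
    rewrite /E; lra.
  rewrite /euler_curve -/m -/n -/mu; apply: le_trans ev _.
  rewrite -!addrA lerD2l.
  set c := (n - m)%:R * mu in d1 d2 *.
  have ts0 : 0 <= t - s by rewrite subr_ge0.
  have w1 : c * A <= (t - s) * A + mu * (B * (B + N Z)).
    have : (c - (t - s)) * A <= mu * (B * (B + N Z)).
      apply: le_trans (ler_norm _) _; rewrite normrM; apply: ler_pM => //.
      by rewrite ler_norml; apply/andP; split; lra.
    move=> ?; lra.
  have w2 : c * (E * (t - s + 2 * mu)) <= (t - s + mu) * (E * (t - s + 2 * mu)).
    by rewrite ler_wpM2r// mulr_ge0// addr_ge0// mulr_ge0.
  rewrite /D; lra.
apply: (@eps_ler R) => e e0.
set h := t - s in discrete *; have h0 : 0 <= h by rewrite subr_ge0.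
set p := N (X t - Z); set q := N (X s - Z); set g := N (G s).
have p0 : 0 <= p := snorm_ge0 _ _.
have q0 : 0 <= q := snorm_ge0 _ _.
have g0 : 0 <= g := snorm_ge0 _ _.
pose M := (2 * p + 1) + (2 * q + 1) + 2 * h * (q + 1 + g) +
  (2 * (B * (B + N Z)) + 2 * E * (3 * h + 2)).
have BZ0 : 0 <= B * (B + N Z) by rewrite mulr_ge0// addr_ge0.
have M1 : 1 <= M.
  rewrite /M; have : 0 <= 2 * h * (q + 1 + g) by rewrite !mulr_ge0// !addr_ge0.
  have : 0 <= 2 * E * (3 * h + 2) by rewrite !mulr_ge0// addr_ge0// mulr_ge0.
  move=> *; lra.
have M0 : 0 < M by lra.
pose d := Num.min 1 (e / M).
have d0 : 0 < d by rewrite lt_min ltr01 divr_gt0.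
have d1 : d <= 1 by rewrite ge_min lexx.
have dM : d * M <= e by rewrite -ler_pdivlMr// ge_min lexx orbT.
have := UI (UI (Xlim t0 d0) (Xlim s0 d0)) (UI (limit_drift s0 d0) (mesh_small d0)).
move=> /exU[j [[/= ht hs] [hg hm]]].
have pert x y a : N (x - y) <= d -> `|ip (x - Z) (x - Z) - ip (y - Z) (y - Z)| <= d * (2 * N (y - Z) + 1) /\
    `|ip a (x - Z) - ip a (y - Z)| <= d * N a.
  move=> xy; split.
    have -> : ip (x - Z) (x - Z) - ip (y - Z) (y - Z) = ip (x - y) ((x - y) + 2 *: (y - Z)).
      rewrite !innerE (innerC _ Z x) (innerC _ y x) (innerC _ Z y); ring.
    apply: le_trans (normr_inner_le _ _ _) _; apply: ler_pM; rewrite ?snorm_ge0//.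
    apply: le_trans (snormD _ _ _) _; rewrite snormZ ger0_norm// addrC lerD2l.
    exact: le_trans xy d1.
  have -> : ip a (x - Z) - ip a (y - Z) = ip a (x - y) by rewrite !innerE; ring.
  rewrite mulrC; apply: le_trans (normr_inner_le _ _ _) _.
  by rewrite ler_wpM2l// snorm_ge0.
have [e1 _] := pert _ _ 0 ht; have [e2 e3] := pert _ _ (euler_drift j s) hs.
have e4 : N (euler_drift j s) <= g + 1.
  have := snorm_triangle ip (G s) (euler_drift j s) 0; rewrite !subr0 -/g => tri.
  by apply: le_trans tri _; rewrite addrC lerD2l; exact: le_trans hg d1.
have e5 : `|ip (euler_drift j s) (X s - Z) - ip (G s) (X s - Z)| <= d * q.
  have -> : ip (euler_drift j s) (X s - Z) - ip (G s) (X s - Z) = ip (euler_drift j s - G s) (X s - Z).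
    by rewrite innerDl innerNl.
  apply: le_trans (normr_inner_le _ _ _) _; apply: ler_pM; rewrite ?snorm_ge0//.
have e6 : `|ip (euler_drift j s) (euler_curve j s - Z) - ip (euler_drift j s) (X s - Z)| <= d * (g + 1).
  by apply: le_trans e3 _; rewrite ler_wpM2l// ltW.
have e7 := discrete j.
have e8 : mesh j * (2 * (B * (B + N Z)) + 2 * E * (3 * h + 2 * mesh j)) <=
   d * (2 * (B * (B + N Z)) + 2 * E * (3 * h + 2)).
  apply: ler_pM => //; first exact: mesh_ge0.
    have : 0 <= 2 * E * (3 * h + 2 * mesh j).
      by apply: mulr_ge0; [exact: mulr_ge0|apply: addr_ge0; apply: mulr_ge0 => //; exact: mesh_ge0].
    by apply: addr_ge0; apply: mulr_ge0.
  rewrite lerD2l ler_wpM2l ?mulr_ge0// lerD2l.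
  by rewrite -[X in _ <= X]mulr1 ler_wpM2l// (le_trans hm).
move: e1 e2 e5 e6; rewrite !ler_norml -/p -/q => /andP[u1 _] /andP[_ u2] /andP[_ u3] /andP[_ u4].
have u5 : h * (ip (euler_drift j s) (euler_curve j s - Z) - ip (G s) (X s - Z)) <= h * (d * (q + 1 + g)).
  by rewrite ler_wpM2l// mulrDr mulrDr; move: u3 u4; set b1 := ip _ _; set b2 := ip _ _; set b3 := ip _ _ => *; lra.
move: u1 u2 u5 e7 e8 dM; rewrite /M.
set a1 := ip _ _; set a2 := ip _ _; set a3 := ip _ _; set a4 := ip (euler_drift _ _) _.
set a5 := ip (X s - Z) _; set a6 := ip (G s) _.
set E' := 2 * E * h ^+ 2.
set S1 := mesh j * _; set S2 := B * _; set S3 := 2 * E * _ => *; lra.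
Qed.

Lemma limit_evi : evi ip K G X.
Proof.
move=> Z KZ; exists set0; first exact: negligible_set0.
move=> t t0 _ e e0; have [E E0 EP] := limit_evi_local (t + 1) KZ.
have E1 : 0 < E + 1 by rewrite ltr_wpDl.
exists (Num.min 1 (e / (E + 1))); first by rewrite lt_min ltr01 divr_gt0.
move=> h h0; rewrite lt_min ltr_pdivlMr// => /andP[h1 hE].
have := EP t (t + h) (ltW t0).
have -> : t + h - t = h by rewrite addrC addKr.
rewrite lerDl (ltW h0) lerD2l (ltW h1) => /(_ isT isT) le1.
apply: le_trans le1 _; rewrite lerD2l expr2 mulrA ler_wpM2r ?ltW//.
by apply: le_lt_trans hE; rewrite mulrC ler_wpM2l ?ltW// ltrDl.
Qed.

Lemma limit_initial : N (X 0 - x0) = 0.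
Proof.
apply/eqP; rewrite eq_le snorm_ge0 andbT; apply: (@eps_ler R) => e e0.
have [j /= hj] := exU (Xlim (lexx 0) e0).
rewrite add0r -snormN opprB; move: hj; rewrite /euler_curve.
by have := cell_of_mesh j 0; rewrite mul0r => ->.
Qed.

End Limit.

(** A set of indices in the ultrafilter with small diameter is chosen for each
    precision; indices picked in their successive intersections give a Cauchy sequence. *)
Lemma ultra_limit (U : set_system nat) (u : nat -> H) : UltraFilter U -> scomplete ip ->
  (forall e, 0 < e -> exists A, U A /\ forall i j, A i -> A j -> N (u i - u j) <= e) ->
  exists x, forall e, 0 < e -> U [set j | N (u j - x) <= e].
Proof.
move=> ultraU cH uC.
pose filterU : Filter U := @filter_filter _ _ (@ultra_proper _ _ ultraU).
have exU (A : set nat) : U A -> exists j, A j := @filter_ex _ _ (@ultra_proper _ _ ultraU) A.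
have /choice[A AP] : forall k : nat, exists A, U A /\
    forall i j, A i -> A j -> N (u i - u j) <= k.+1%:R^-1.
  by move=> k; apply: uC; rewrite invr_gt0.
have /choice[p pP] : forall k : nat, exists j, forall i, (i <= k)%N -> A i j.
  move=> k; apply: exU; elim: k => [|k IH].
    by apply: (@filterS _ U filterU _ _ _ (AP 0%N).1) => j Aj i; rewrite leqn0 => /eqP->.
  apply: (@filterS _ U filterU _ _ _ (@filterI _ U filterU _ _ IH (AP k.+1).1)).
  by move=> j [h1 h2] i; rewrite leq_eqVlt ltnS => /predU1P[->//|]; exact: h1.
have small e : 0 < e -> exists n : nat, n.+1%:R^-1 <= e :> R.
  move=> e0; have [n _ nP] := near_infty_natSinv_lt (PosNum e0).
  by exists n; apply/ltW/nP => /=.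
have [x xP] : exists x, slim ip (u \o p) x.
  apply: cH => e /small[n ne]; exists n => i j ni nj.
  by apply: le_trans ne; apply: (AP n).2; exact: pP.
exists x => e e0; have e2 : 0 < e / 2 by rewrite divr_gt0.
have [n ne] := small _ e2; have [m mP] := xP _ e2.
apply: (@filterS _ U filterU _ _ _ (AP n).1) => j Aj /=.
pose k := maxn m n.
have h1 := mP k (leq_maxl _ _).
have h2 : N (u j - u (p k)) <= e / 2.
  by apply: le_trans ne; apply: (AP n).2 => //; apply: pP; exact: leq_maxr.
apply: le_trans (snorm_triangle ip (u (p k)) _ _) _.
by rewrite [X in _ <= X]splitr; exact: lerD.
Qed.

Lemma euler_limit (U : set_system nat) : UltraFilter U -> \oo `<=` U ->
  scomplete ip -> sclosure ip K `<=` K ->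
  (forall e, 0 < e -> exists2 d : R, 0 < d &
    forall x y, K x -> K y -> N (x - y) <= d -> N (F x - F y) <= e) ->
  (forall t, 0 <= t -> forall e, 0 < e -> exists A, U A /\ forall i j, A i -> A j ->
    N (euler_curve i t - euler_curve j t) <= e) ->
  exists X J, [/\ forall t, 0 <= t -> K (X t), loc_lip ip X, N (X 0 - x0) = 0,
    primitive ip (F \o X) J & evi ip K (fun t => v0 + J t) X].
Proof.
move=> ultraU ooU cH Kcl F_ucont uC.
have /choice[X XP] : forall t, exists x, 0 <= t -> forall e, 0 < e ->
    U [set j | N (euler_curve j t - x) <= e].
  move=> t; have [t0|t0] := leP 0 t; last by exists 0.
  by have [x xP] := ultra_limit ultraU cH (uC t t0); exists x.
have KX t : 0 <= t -> K (X t).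
  move=> t0; apply: Kcl => e e0.
  have [j jP] := @filter_ex _ _ (@ultra_proper _ _ ultraU) _ (XP t t0 e e0).
  exists (euler_curve j t); first exact: euler_cone.
  exact: jP.
have Xlim t e (t0 : 0 <= t) (e0 : 0 < e) := XP t t0 e e0.
have lipX := limit_loc_lip ultraU ooU Xlim.
have [J FJ _] := force_primitive C0 F_bnd F_ucont cH KX lipX.
exists X, J; split => //; first exact: (@limit_initial U ultraU X Xlim).
exact: (limit_evi ultraU ooU Xlim KX F_ucont FJ).
Qed.

End Euler.

(** * Propagation of tails and existence of a flow *)

Section Coupled.
Variables (R : realType) (tau c k a b : R).
Hypotheses (tau0 : 0 <= tau) (c0 : 0 <= c) (k0 : 0 <= k) (a0 : 0 <= a) (b0 : 0 <= b).

(** With [k] positive this bounds levels above which tails are measured, and with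
    [k = 0] the tails themselves: position and velocity feed each other linearly. *)
Fixpoint coupled n : R * R :=
  if n is n'.+1 then
    ((coupled n').1 + tau * (coupled n').2,
     (coupled n').2 + tau * (c * (k + (coupled n').1)))
  else (a, b).

Lemma coupled_ge0 n : 0 <= (coupled n).1 /\ 0 <= (coupled n).2.
Proof.
elim: n => //= n [h1 h2]; split; apply: addr_ge0 => //; apply: mulr_ge0 => //.
by apply: mulr_ge0 => //; exact: addr_ge0.
Qed.

Lemma coupled_growth n T : n%:R * tau <= T ->
  (coupled n).1 <= expR ((1 + c) * T) * (k + a + b).
Proof.
move=> nT; pose u n := k + (coupled n).1 + (coupled n).2.
have [h1 h2] := coupled_ge0 n.
suff : u n <= expR ((1 + c) * T) * u 0%N.
  by apply: le_trans; rewrite /u addrAC lerDr addr_ge0.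
apply: (exp_growth tau0 _ _ nT); [exact: addr_ge0| |move=> i _].
  by rewrite /u/= !addr_ge0.
have [g1 g2] := coupled_ge0 i; rewrite /u/=.
have g3 : 0 <= tau * (c * (coupled i).2) by rewrite !mulr_ge0.
have g4 : 0 <= tau * (k + (coupled i).1) by rewrite mulr_ge0// addr_ge0.
lra.
Qed.

End Coupled.

Section EulerTails.
Variable R : realType.
Local Notation mu := (leb_Omega R).
Local Notation ip := (@L2_inner R).
Local Notation N := (snorm ip).
Local Notation K := (@monotone_cone R).
Variables (F PK : L2 R -> L2 R) (C Cp : R) (x0 v0 : L2 R).
Hypotheses (C0 : 0 <= C) (F_bnd : forall x, K x -> N (F x) <= C * (1 + N x)).
Hypotheses (Cp0 : 0 <= Cp) (F_pw : forall X, K X ->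
  \forall m \ae mu, `|F X m| <= Cp * (1 + `|X m| + L1norm X)).
Hypotheses (K_PK : forall x, K (PK x)).
Hypotheses (PK_var : forall x y, K y -> ip (x - PK x) (y - PK x) <= 0).
Hypothesis (Kx0 : K x0).

Lemma tail_antitone M M' (X : L2 R) : 0 <= M -> M <= M' -> tail M' X <= tail M X.
Proof.
move=> M0 MM'; rewrite -[leRHS]mul1r; apply: tail_le => //; first by rewrite mul1r.
by apply: nearW => m; rewrite mul1r lerB.
Qed.

Lemma tail_ge0 M (X : L2 R) : 0 <= tail M X. Proof. exact: snorm_ge0. Qed.

(** Each operation of the scheme propagates tails: the projection does not
    increase them, sums and multiples combine levels and tails linearly, and the
    pointwise bound turns a tail of [X] above [a] into a tail of [F X] above
    [Cp (1 + xi + a)], where [xi] bounds the [L^1] norm of [X]. *)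
Lemma euler_tail tau n T M : 0 <= tau -> n%:R * tau <= T -> 0 <= M ->
  let lev := coupled tau Cp (1 + growth ip C x0 v0 T) M M n in
  let val := coupled tau Cp 0 (tail M x0) (tail M v0) n in
  tail lev.1 (euler F PK x0 v0 tau n).1 <= val.1 /\
  tail lev.2 (euler F PK x0 v0 tau n).2 <= val.2.
Proof.
move=> tau0 + M0; elim: n => [_//|n IH nT].
set xi := growth ip C x0 v0 T.
have xi0 : 0 <= 1 + xi by rewrite addr_ge0// growth_ge0.
have nT' : n%:R * tau <= T by apply: le_trans nT; rewrite ler_wpM2r// ler_nat.
have [] := IH nT'.
have [] := @coupled_ge0 R tau Cp (1 + xi) M M tau0 Cp0 xi0 M0 M0 n.
have [+ _] := @euler_bound _ _ ip K F PK C x0 v0 C0 F_bnd K_PK PK_var (@cone0 R) Kx0 tau n T tau0 nT'.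
have := euler_cone F v0 K_PK Kx0 tau n.
rewrite /= -/xi.
set X := (euler F PK x0 v0 tau n).1; set G := (euler F PK x0 v0 tau n).2.
set a := (coupled _ _ _ _ _ n).1; set b := (coupled _ _ _ _ _ n).2.
set al := (coupled _ _ _ _ _ n).1; set be := (coupled _ _ _ _ _ n).2.
move=> KX Xxi a0 b0 hX hG; split.
  apply: le_trans (tail_projection (addr_ge0 a0 (mulr_ge0 tau0 b0)) (K_PK _) (PK_var _)) _.
  apply: le_trans (tail_add _ _ a0 (mulr_ge0 tau0 b0)) _.
  apply: lerD => //; apply: le_trans (tailZ _ b0 tau0) _.
  by rewrite ler_wpM2l.
have c0 : 0 <= Cp * (1 + xi + a) by rewrite mulr_ge0// addr_ge0.
apply: le_trans (tail_add _ _ b0 (mulr_ge0 tau0 c0)) _.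
apply: lerD => //; apply: le_trans (tailZ _ c0 tau0) _.
rewrite ler_wpM2l// add0r.
apply: (@le_trans _ _ (Cp * tail a X)); last by rewrite ler_wpM2l.
apply: tail_le => //; first by rewrite ler_wpM2l// lerDr.
apply: filterS (F_pw KX) => m h.
rewrite lerBlDr; apply: le_trans h _; rewrite -mulrDr ler_wpM2l//.
have l := le_trans (L1norm_le X) Xxi.
have -> : `|X m| - a + (1 + xi + a) = 1 + `|X m| + xi by ring.
by rewrite lerD2l.
Qed.

(** Start with a level at which the tails of the data are small; over a bounded
    time both the level and the tails grow by a fixed factor. *)
Lemma euler_uniform_tails T e : 0 < e -> exists2 M, 0 <= M &
  forall tau n, 0 <= tau -> n%:R * tau <= T -> tail M (euler F PK x0 v0 tau n).1 <= e.
Proof.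
move=> e0; set E := expR ((1 + Cp) * T).
have E0 : 0 < E by exact: expR_gt0.
have d0 : 0 < e / E / 2 by rewrite !divr_gt0.
have [M1 M10 t1] := tail_small x0 d0; have [M2 M20 t2] := tail_small v0 d0.
pose M := M1 + M2; have M0 : 0 <= M by rewrite addr_ge0.
have {}t1 : tail M x0 <= e / E / 2 by apply: le_trans (tail_antitone _ _ _) t1 => //; rewrite lerDl.
have {}t2 : tail M v0 <= e / E / 2 by apply: le_trans (tail_antitone _ _ _) t2 => //; rewrite lerDr.
have xi0 : 0 <= 1 + growth ip C x0 v0 T by rewrite addr_ge0// growth_ge0.
exists (E * (1 + growth ip C x0 v0 T + M + M)).
  apply: mulr_ge0; first exact: ltW.
  by apply: addr_ge0 => //; exact: addr_ge0.
move=> tau n tau0 nT; have [h _] := euler_tail tau0 nT M0.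
have l0 := (@coupled_ge0 R tau Cp _ M M tau0 Cp0 xi0 M0 M0 n).1.
have l1 := @coupled_growth R tau Cp _ M M tau0 Cp0 xi0 M0 M0 n T nT.
have v1 := @coupled_growth R tau Cp 0 _ _ tau0 Cp0 (lexx 0) (tail_ge0 M x0) (tail_ge0 M v0) n T nT.
apply: le_trans (tail_antitone _ l0 l1) _; apply: le_trans h _; apply: le_trans v1 _.
rewrite -/E -ler_pdivlMl// mulrC add0r.
rewrite [leRHS]splitr; apply: lerD; [exact: t1|exact: t2].
Qed.

End EulerTails.

Section Existence.
Variable R : realType.
Local Notation mu := (leb_Omega R).
Local Notation ip := (@L2_inner R).
Local Notation N := (snorm ip).
Local Notation K := (@monotone_cone R).
Variables (F : L2 R -> L2 R) (C : R).
Hypothesis F_pw : pointwise_linearly_bounded F.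
Hypotheses (C0 : 0 <= C) (F_bnd : forall x, K x -> N (F x) <= C * (1 + N x)).
Hypothesis F_ucont : forall e, 0 < e -> exists2 d : R, 0 < d &
  forall x y, K x -> K y -> N (x - y) <= d -> N (F x - F y) <= e.

Lemma flow_exists x0 v0 : K x0 -> exists X J,
  [/\ forall t, 0 <= t -> K (X t), loc_lip ip X, N (X 0 - x0) = 0,
    primitive ip (F \o X) J & evi ip K (fun t => v0 + J t) X].
Proof.
move=> Kx0; have [Cp Cp0 pw] := F_pw.
have /choice[PK PKP] : forall x, exists p, K p /\ forall y, K y -> ip (x - p) (y - p) <= 0.
  move=> x; have [] := projection_closure x (@L2_complete R) (@sconvex_cone R).
    by exists 0; exact: cone0.
  by move=> p Kp pP; exists p; split => //; exact: closed_cone.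
have K_PK x := (PKP x).1; have PK_var x := (PKP x).2.
have [U [ultraU ooU]] := ultraFilterLemma (F := \oo : set_system nat) _.
apply: (euler_limit C0 F_bnd K_PK PK_var (@cone0 R) Kx0 ultraU ooU (@L2_complete R)
  (@closed_cone R) F_ucont) => t t0 e e0.
apply: ultra_cauchy_tails => //.
  by move=> j; exact: euler_cone.
move=> d d0.
have [M M0 MP] := euler_uniform_tails v0 C0 F_bnd Cp0 pw K_PK PK_var Kx0 t d0.
exists M => // j; apply: MP; first exact: mesh_ge0.
exact: (cell_ofP j t0).1.
Qed.

End Existence.

(** * Flows and Lagrangian solutions *)

Lemma rderiv_translate (R : realType) (H : lmodType R) (ip : semi_inner H)
  v (X : R -> H) t V : rderiv ip X t V -> rderiv ip (fun s => v + X s) t V.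
Proof.
move=> dX e e0; have [d d0 dP] := dX e e0; exists d => // h h0 hd.
have -> : v + X (t + h) - (v + X t) - h *: V = X (t + h) - X t - h *: V by vec R H.
exact: dP.
Qed.

Lemma inner_resplit (R : realType) (H : lmodType R) (ip : semi_inner H) a b c d x z :
  ip (a + b) (x - z) = ip d (x - z) - ip (a + c - d) (z - x) - ip (c - b) (x - z).
Proof. by rewrite !innerE; ring. Qed.

Section Quotients.
Variable R : realType.
Local Notation ip := (@L2_inner R).
Local Notation N := (snorm ip).
Implicit Types (X : R -> L2 R) (D : L2 R) (t h : R).

Lemma quotient_right X t D h e : 0 < h ->
  (L2norm (h^-1 *: (X (t + h) - X t) - D) <= e) =
  (N (X (t + h) - X t - h *: D) <= e * h).
Proof.
move=> h0; have hn0 : h != 0 by rewrite gt_eqF.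
have -> : X (t + h) - X t - h *: D = h *: (h^-1 *: (X (t + h) - X t) - D).
  by rewrite scalerBr scalerA divff// scale1r.
by rewrite L2normE snormZ (ger0_norm (ltW h0)) [e * h]mulrC (ler_pM2l h0).
Qed.

Lemma quotient_left X t D h e : 0 < h ->
  (L2norm ((- h)^-1 *: (X (t - h) - X t) - D) <= e) =
  (N (X t - X (t - h) - h *: D) <= e * h).
Proof.
move=> h0; have hn0 : h != 0 by rewrite gt_eqF.
have -> : X t - X (t - h) - h *: D = h *: ((- h)^-1 *: (X (t - h) - X t) - D).
  by rewrite scalerBr scalerA invrN mulrN divff// scaleN1r opprB.
by rewrite L2normE snormZ (ger0_norm (ltW h0)) [e * h]mulrC (ler_pM2l h0).
Qed.

Lemma dist0_L2norm D e : (`|0 - L2norm D| <= e) = (L2norm D <= e).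
Proof. by rewrite sub0r normrN L2normE ger0_norm// snorm_ge0. Qed.

Lemma right_derivative_rderiv X t D : rderiv ip X t D -> is_L2_right_derivative X t D.
Proof.
move=> dX; apply/cvgrPdist_le => e e0; have [d d0 dP] := dX e e0.
exists d => // h /=; rewrite sub0r normrN => hd h0; rewrite dist0_L2norm quotient_right//.
by apply: dP => //; rewrite (le_lt_trans (ler_norm _) hd).
Qed.

Lemma derivative_two_sided X t D : rderiv ip X t D -> lderiv ip X t D ->
  is_L2_derivative X t D.
Proof.
move=> rX lX; apply/cvgrPdist_le => e e0.
have [d1 d10 dP1] := rX e e0; have [d2 d20 dP2] := lX e e0.
exists (Num.min d1 d2); first by rewrite /= lt_min d10.
move=> h /=; rewrite sub0r normrN lt_min => /andP[hd1 hd2] hn0.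
rewrite dist0_L2norm; case: (ltgtP h 0) hn0 => // h0 _.
  rewrite ltr0_norm// in hd2; rewrite -(opprK h) quotient_left ?oppr_gt0//.
  by apply: dP2 => //; rewrite oppr_gt0.
by rewrite quotient_right//; apply: dP1 => //; rewrite (le_lt_trans (ler_norm _) hd1).
Qed.

Lemma derivative_rderiv X t D : is_L2_derivative X t D -> rderiv ip X t D.
Proof.
move=> /cvgrPdist_le dX e e0; have [d d0 dP] := dX e e0.
exists d => // h h0 hd; rewrite -quotient_right//.
rewrite -dist0_L2norm; apply: dP; rewrite /= ?gt_eqF//.
by rewrite sub0r normrN ger0_norm// ltW.
Qed.

End Quotients.

Section Solutions.
Variable R : realType.
Local Notation ip := (@L2_inner R).
Local Notation N := (snorm ip).
Local Notation K := (@monotone_cone R).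
Variables (F : L2 R -> L2 R) (C : R).
Hypotheses (C0 : 0 <= C) (F_bnd : forall x, K x -> N (F x) <= C * (1 + N x)).
Hypothesis F_ucont : forall e, 0 < e -> exists2 d : R, 0 < d &
  forall x y, K x -> K y -> N (x - y) <= d -> N (F x - F y) <= e.

(** Solutions described without integrals: [J] is a primitive of the force along
    [X], and [v0 + J] drives the evolution inequality. *)
Definition flow (x0 v0 : L2 R) (X J : R -> L2 R) : Prop :=
  [/\ forall t, 0 <= t -> K (X t), loc_lip ip X, N (X 0 - x0) = 0,
    primitive ip (F \o X) J & evi ip K (fun t => v0 + J t) X].

Lemma flow_drift_lip x0 v0 X J : flow x0 v0 X J -> loc_lip ip (fun t => v0 + J t).
Proof.
move=> [KX lipX _ FJ _] T.
have [M M0 MP] := force_bounded C0 F_bnd T KX lipX; exists M => //.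
move=> s t s0 st tT; have := primitive_lip FJ MP s0 st tT.
by have -> : v0 + J t - (v0 + J s) = J t - J s by vec R (L2 R).
Qed.

Lemma flow_velocity x0 v0 X J : flow x0 v0 X J -> exists V, forall t, 0 <= t ->
  [/\ rderiv ip X t (V t), forall Z, K Z -> ip (v0 + J t - V t) (Z - X t) <= 0 &
      ip (v0 + J t - V t) (V t) = 0].
Proof.
move=> fl; have lipG := flow_drift_lip fl; case: fl => [KX lipX _ _ ev].
have /choice[V VP] : forall t, exists V, 0 <= t -> [/\ rderiv ip X t V,
    forall Z, K Z -> ip (v0 + J t - V) (Z - X t) <= 0 & ip (v0 + J t - V) V = 0].
  move=> t; have [t0|t0] := leP 0 t; last by exists 0.
  have [V VP] := right_derivative (@sconvex_cone R) KX lipX lipG ev (@L2_complete R) t0.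
  by exists V.
by exists V.
Qed.

(** The right derivative is a derivative at almost every time, and the
    variational inequality it satisfies is membership in the subdifferential. *)
Lemma flow_lagrangian x0 v0 X J : flow x0 v0 X J -> lagrangian_solution F x0 v0 X.
Proof.
move=> fl; have [V VP] := flow_velocity fl; have lipG := flow_drift_lip fl.
case: fl => [KX lipX X0 FJ ev]; split => //.
- move=> T T0; have [L L0 LP] := lipX T; exists L => s t /andP[s0 sT] /andP[t0 tT].
  rewrite L2normE; have [st|/ltW ts] := leP s t.
    by rewrite (ger0_norm (x := t - s)) ?subr_ge0//; exact: LP.
  by rewrite distrC snormB (ger0_norm (x := s - t)) ?subr_ge0//; exact: LP.
- have := ae_eq_snorm X0; apply: filterS => m; rewrite L2B => /eqP.
  by rewrite subr_eq0 => /eqP.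
have [E Enull EP] := @ae_two_sided _ _ ip K X (fun t => v0 + J t) V KX lipX lipG ev
  (fun t t0 => let: And3 h _ _ := VP t t0 in h) (fun t t0 => let: And3 _ h _ := VP t t0 in h)
  (fun t t0 => let: And3 _ _ h := VP t t0 in h).
apply: negligibleS Enull => t /= nt; apply: contrapT => nEt; apply: nt => t0.
have [dV VI _] := VP t (ltW t0).
exists (V t), (J t); split.
- exact: derivative_two_sided (EP t t0 nEt).
- exact: primitive_bochner (force_ucont F_ucont KX lipX) FJ t0.
- exact: VI.
Qed.

(** At a point of differentiability, expanding the squared distance to [Z] turns
    membership in the subdifferential into the evolution inequality; the Bochner
    integral of the force differs from [J t] by a null vector. *)
Lemma lagrangian_flow x0 v0 X : lagrangian_solution F x0 v0 X -> exists J, flow x0 v0 X J.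
Proof.
move=> [KX lip X0 ae].
have lipX : loc_lip ip X.
  move=> T; have [T0|T0] := leP 0 T; last first.
    by exists 0 => // s t s0 st tT; have := le_lt_trans (le_trans (le_trans s0 st) tT) T0; rewrite ltxx.
  have [L LP] := lip T T0; exists (Num.max L 0); first by rewrite le_max lexx orbT.
  move=> s t s0 st tT; rewrite -L2normE.
  have := LP s t _ _; rewrite s0 (le_trans s0 st) tT (le_trans st tT) => /(_ isT isT) h.
  apply: le_trans h _; rewrite ger0_norm ?subr_ge0// ler_wpM2r ?subr_ge0//.
  by rewrite le_max lexx.
have uF := force_ucont F_ucont KX lipX.
have [J FJ _] := force_primitive C0 F_bnd F_ucont (@L2_complete R) KX lipX.
exists J; split => //; first exact: snorm_ae_eq.
move=> Z KZ.
pose E' := [set t : R | ~ (0 < t -> exists X' I : L2 R,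
        [/\ is_L2_derivative X t X',
            is_bochner_integral `[0, t] (F \o X) I &
            subdiff_cone (X t) (v0 + I - X')])].
exists E'; first exact: ae.
move=> t t0 nE e e0.
have [X' [I [dX bI sub]]] : exists X' I : L2 R,
        [/\ is_L2_derivative X t X',
            is_bochner_integral `[0, t] (F \o X) I &
            subdiff_cone (X t) (v0 + I - X')] by apply: contrapT => h; apply: nE => /(_ t0).
have dXZ := rderiv_translate (- Z) (derivative_rderiv dX).
have [d d0 dP] := rderiv_sqr dXZ e0; exists d => // h h0 hd.
rewrite ![_ - Z]addrC; apply: le_trans (dP h h0 hd) _.
rewrite lerD2r lerD2l ler_wpM2l ?(ltW h0)// ler_wpM2l// ![- Z + _]addrC.
have IJ : ip (I - J t) (X t - Z) = 0.
  have n0 := bochner_unique (ltW t0) uF bI (primitive_bochner uF FJ t0).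
  have := normr_inner_le ip (I - J t) (X t - Z).
  by rewrite n0 mul0r normr_le0 => /eqP.
have := sub Z KZ; rewrite -[L2inner _ _]/(ip _ _) => h1.
rewrite (inner_resplit ip v0 (J t) I X' (X t) Z).
by rewrite IJ subr0 innerC lerDl oppr_ge0.
Qed.

End Solutions.

(** * Convex energies with Lipschitz derivative *)

Lemma sub_chain (R : realType) (a b c e d : R) :
  a - e * b <= 0 -> - (d / 2) <= a -> e * (b - c) <= d / 2 -> - (e * c) <= d.
Proof. by move=> *; lra. Qed.

(** The support line inequality and the Lipschitz bound make [eta] the derivative
    of [phi]. *)
Record smooth_energy (R : realType) (k : R) (phi eta : R -> R) : Prop := {
  energy_ge0 : forall r, 0 <= phi r;
  energy_even : forall r, phi (- r) = phi r;
  energy0 : phi 0 = 0;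
  energy_measurable : measurable_fun [set: R] phi;
  slope0 : eta 0 = 0;
  slope_lip : forall a b, a <= b -> 0 <= eta b - eta a <= k * (b - a);
  energy_convex : forall a b, eta a * (b - a) <= phi b - phi a }.

Section PointwiseEnergy.
Variables (R : realType) (k : R) (phi eta : R -> R).
Hypothesis E : smooth_energy k phi eta.
Implicit Types a b r : R.

Lemma slope_norm a b : `|eta b - eta a| <= k * `|b - a|.
Proof.
have [ab|/ltW ba] := leP a b.
  by have /andP[h1 h2] := slope_lip E ab; rewrite !ger0_norm// subr_ge0.
have /andP[h1 h2] := slope_lip E ba.
by rewrite distrC (distrC b) !ger0_norm// subr_ge0.
Qed.

Lemma energy_upper a b : phi b - phi a <= eta a * (b - a) + k * (b - a) ^+ 2.
Proof.
have h := energy_convex E b a.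
have h2 : (eta b - eta a) * (b - a) <= k * (b - a) ^+ 2.
  apply: le_trans (ler_norm _) _; rewrite normrM.
  have -> : k * (b - a) ^+ 2 = k * `|b - a| * `|b - a| by rewrite -mulrA -normrM -expr2 ger0_norm// sqr_ge0.
  by rewrite ler_wpM2r// slope_norm.
lra.
Qed.

Lemma energy_quadratic r : phi r <= k * (r * r).
Proof. by have := energy_upper 0 r; rewrite (energy0 E) (slope0 E) mul0r add0r !subr0. Qed.

Lemma slope_linear r : `|eta r| <= k * `|r|.
Proof. by have := slope_norm 0 r; rewrite (slope0 E) !subr0. Qed.

Lemma energy_mono a b : `|a| <= `|b| -> phi a <= phi b.
Proof.
have pabs r : phi `|r| = phi r.
  by case: (ger0P r) => // _; rewrite (energy_even E).
rewrite -(pabs a) -(pabs b); have := normr_ge0 a.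
move: `|a| `|b| => x y x0 xy.
have := energy_convex E x y.
have /andP[h _] := slope_lip E x0; rewrite (slope0 E) subr0 in h.
have : 0 <= eta x * (y - x) by rewrite mulr_ge0// subr_ge0.
move=> *; lra.
Qed.

Variables (lambda D : R).
Hypotheses (lambda2 : 2 <= lambda) (D0 : 0 <= D).
Hypothesis phi_scale : forall r, phi (lambda * r) <= D * phi r.

(** The midpoint convexity and the growth condition. *)
Lemma energy_sum2 a b : phi (a + b) <= D / 2 * (phi a + phi b).
Proof.
pose m := (a + b) / 2.
have h1 := energy_convex E m a; have h2 := energy_convex E m b.
have h3 : eta m * (a - m) + eta m * (b - m) = 0 by rewrite /m; field.
have h4 : phi (a + b) <= phi (lambda * m).
  apply: energy_mono; have -> : a + b = 2 * m by rewrite /m; field.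
  by rewrite !normrM ler_wpM2r// !ger0_norm// (le_trans _ lambda2).
apply: le_trans h4 _; apply: le_trans (phi_scale _) _.
have -> : D / 2 * (phi a + phi b) = D * ((phi a + phi b) / 2) by field.
by rewrite ler_wpM2l//; lra.
Qed.

(** The form needed for the pointwise bound on the force, with [b] its [L^1] norm. *)
Lemma energy_sum3 c a b r : 0 <= c -> c * 3 <= lambda -> 0 <= b ->
  `|r| <= c * (1 + `|a| + b) -> phi r <= D / 3 * (phi 1 + phi a + phi b).
Proof.
move=> c0 cl b0 hr; pose m := (1 + `|a| + b) / 3.
have m0 : 0 <= m by rewrite divr_ge0// !addr_ge0.
have h1 := energy_convex E m `|a|; have h2 := energy_convex E m b; have h3 := energy_convex E m 1.
have h4 : eta m * (`|a| - m) + eta m * (b - m) + eta m * (1 - m) = 0 by rewrite /m; field.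
have pabs : phi `|a| <= phi a by apply: energy_mono; rewrite normr_id.
have h5 : phi r <= phi (lambda * m).
  apply: energy_mono; apply: le_trans hr _.
  have -> : 1 + `|a| + b = 3 * m by rewrite /m; field.
  rewrite normrM (ger0_norm m0) mulrA ler_wpM2r//; apply: le_trans cl _; exact: ler_norm.
apply: le_trans h5 _; apply: le_trans (phi_scale _) _.
have -> : D / 3 * (phi 1 + phi a + phi b) = D * ((phi 1 + phi a + phi b) / 3) by field.
by rewrite ler_wpM2l//; lra.
Qed.

End PointwiseEnergy.

Section IntegralEnergy.
Variable R : realType.
Local Notation mu := (leb_Omega R).
Local Notation T := (measurableTypeR R).
Local Notation ip := (@L2_inner R).
Local Notation N := (snorm ip).
Local Notation K := (@monotone_cone R).
Implicit Types U W X Y Z : L2 R.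
Variables (k : R) (phi eta : R -> R).
Hypotheses (k0 : 0 < k) (E : smooth_energy k phi eta).

Lemma integrable_add (f g : T -> R) : mu.-integrable setT (EFin \o f) ->
  mu.-integrable setT (EFin \o g) -> mu.-integrable setT (EFin \o (fun m => f m + g m)).
Proof. by move=> h1 h2; exact: (integrableD measurableT h1 h2). Qed.

Definition Energy U : R := (\int[mu]_m phi (U m))%R.
Definition slopeL2 U : L2 R := toL2 (eta \o U).

Lemma slope_measurable : measurable_fun [set: R] eta.
Proof.
apply: nondecreasing_measurable => // a b /(slope_lip E)/andP[h _].
by rewrite -subr_ge0.
Qed.

Lemma slopeL2E U m : slopeL2 U m = eta (U m).
Proof.
rewrite /slopeL2 toL2E//; apply: (@le_L2_in _ _ U k).
  by apply: measurableT_comp => //; exact: slope_measurable.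
apply: nearW => x; apply: le_trans (slope_linear E _) _.
by rewrite ler_wpM2l ?ltW// ltrDr.
Qed.

Lemma energy_integrable U : mu.-integrable setT (EFin \o (fun m => phi (U m))).
Proof.
apply: (@le_integrable _ _ _ mu setT measurableT _ (EFin \o (fun m => (k *: U) m * U m))) => //.
- apply/measurable_EFinP; apply: measurableT_comp; [exact: energy_measurable E|exact: L2_measurable].
- move=> m _; rewrite lee_fin; change (`|phi (U m)| <= `|k * U m * U m|).
  rewrite -mulrA ger0_norm ?(energy_ge0 E)//.
  exact: le_trans (energy_quadratic E _) (ler_norm _).
- exact: L2_mul_integrable.
Qed.

Lemma Energy_intE U : (Energy U)%:E = (\int[mu]_m (phi (U m))%:E)%E.
Proof. by rewrite fineK//; apply: integrable_fin_num => //; exact: energy_integrable. Qed.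

Lemma Energy_ge0 U : 0 <= Energy U.
Proof. by apply: Rintegral_ge0 => m _; exact: energy_ge0 E _. Qed.

Lemma Energy_ae_le U W : (\forall m \ae mu, phi (U m) <= phi (W m)) -> Energy U <= Energy W.
Proof.
move=> UW; rewrite -lee_fin !Energy_intE; apply: ae_ge0_le_integral => //.
- by move=> m _; rewrite lee_fin (energy_ge0 E).
- apply/measurable_EFinP; apply: measurableT_comp; [exact: energy_measurable E|exact: L2_measurable].
- by move=> m _; rewrite lee_fin (energy_ge0 E).
- apply/measurable_EFinP; apply: measurableT_comp; [exact: energy_measurable E|exact: L2_measurable].
- by apply: filterS UW => m h _; rewrite lee_fin.
Qed.

Lemma Energy_ae_eq U W : N (U - W) = 0 -> Energy U = Energy W.
Proof.
move=> /ae_eq_snorm UW; apply/le_anti/andP; split; apply: Energy_ae_le;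
  by apply: filterS UW => m; rewrite L2B => /eqP; rewrite subr_eq0 => /eqP ->.
Qed.

Lemma Energy_convex U W : Energy U + ip (slopeL2 U) W <= Energy (U + W).
Proof.
rewrite /Energy -[ip _ _]/(L2inner _ _) /L2inner -RintegralD//; last 2 first.
- exact: energy_integrable.
- exact: L2_mul_integrable.
apply: le_Rintegral => //.
- by apply: integrable_add; [exact: energy_integrable|exact: L2_mul_integrable].
- exact: energy_integrable.
move=> m _; rewrite slopeL2E L2D; have := energy_convex E (U m) (U m + W m).
by rewrite addrAC subrr add0r; lra.
Qed.

Lemma Energy_upper U W : Energy (U + W) <= Energy U + ip (slopeL2 U) W + k * N W ^+ 2.
Proof.
have -> : k * N W ^+ 2 = ip (k *: W) W by rewrite sqr_snorm innerZl.
rewrite /Energy -![ip _ _]/(L2inner _ _) /L2inner -RintegralD//; last 2 first.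
- exact: energy_integrable.
- exact: L2_mul_integrable.
have i2 : mu.-integrable setT (EFin \o (fun m => phi (U m) + slopeL2 U m * W m)).
  by apply: integrable_add; [exact: energy_integrable|exact: L2_mul_integrable].
rewrite -RintegralD//; last exact: L2_mul_integrable.
apply: le_Rintegral => //.
- exact: energy_integrable.
- by apply: integrable_add => //; exact: L2_mul_integrable.
move=> m _; rewrite slopeL2E L2D L2Z; have := energy_upper E (U m) (U m + W m).
by rewrite addrAC subrr add0r expr2 -mulrA; lra.
Qed.

Lemma slopeL2_lip U W : N (slopeL2 U - slopeL2 W) <= k * N (U - W).
Proof.
have -> : k * N (U - W) = N (k *: (U - W)) by rewrite snormZ ger0_norm// ltW.
apply: snorm_ae_le; apply: nearW => m.
rewrite L2B !slopeL2E L2Z normrM (gtr0_norm k0); exact: slope_norm E _ _.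
Qed.

Lemma slopeL2_norm U : N (slopeL2 U) <= k * N U.
Proof.
have -> : k * N U = N (k *: U) by rewrite snormZ ger0_norm// ltW.
apply: snorm_ae_le; apply: nearW => m.
rewrite slopeL2E L2Z normrM (gtr0_norm k0); exact: slope_linear E _.
Qed.

Lemma Energy_lip U W : Energy W <= Energy U + (k * N U + k * N (W - U)) * N (W - U).
Proof.
have := Energy_upper U (W - U); rewrite addrC subrK => h.
apply: le_trans h _; rewrite -addrA lerD2l mulrDl; apply: lerD.
  apply: le_trans (cauchy_schwarz _ _ _) _; rewrite ler_wpM2r ?snorm_ge0//.
  exact: slopeL2_norm.
by rewrite expr2 mulrA.
Qed.

Lemma energy_rderiv (X : R -> L2 R) t V e : rderiv ip X t V -> 0 < e ->
  exists2 d : R, 0 < d & forall h, 0 < h -> h < d ->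
    Energy (X (t + h)) <= Energy (X t) + h * ip (slopeL2 (X t)) V + e * h.
Proof.
move=> dX e0; set S := slopeL2 (X t).
have e2 : 0 < e / 2 by rewrite divr_gt0.
have [d1 d10 dP1] := rderiv_inner S dX e2.
have [d2 d20 dP2] := dX 1 ltr01.
pose B := k * (N V + 1) ^+ 2.
have NV1 : 0 < N V + 1 by rewrite ltr_wpDl// snorm_ge0.
have B0 : 0 < B by rewrite mulr_gt0// exprn_gt0.
exists (Num.min (Num.min d1 d2) (e / 2 / B)); first by rewrite !lt_min d10 d20 !divr_gt0.
move=> h h0; rewrite !lt_min => /andP[/andP[hd1 hd2] hB].
have hB' : h * B <= e / 2 by rewrite -ler_pdivlMr// ltW.
have a1 := dP1 h h0 hd1; have a2 := dP2 h h0 hd2; rewrite mul1r in a2.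
have a3 : N (X (t + h) - X t) <= h * (N V + 1).
  have -> : X (t + h) - X t = h *: V + (X (t + h) - X t - h *: V) by vec R (L2 R).
  rewrite mulrDr mulr1; apply: le_trans (snormD _ _ _) _; apply: lerD => //.
  by rewrite snormZ gtr0_norm.
have a4 : k * N (X (t + h) - X t) ^+ 2 <= h * (e / 2).
  apply: (@le_trans _ _ (k * (h * (N V + 1)) ^+ 2)).
    by apply: ler_wpM2l; [exact: ltW|rewrite lerXn2r// nnegrE ?snorm_ge0// mulr_ge0 ?ltW].
  have -> : k * (h * (N V + 1)) ^+ 2 = h * (h * B) by rewrite /B; ring.
  by rewrite ler_wpM2l// ltW.
have := Energy_upper (X t) (X (t + h) - X t); rewrite addrC subrK -/S => a5.
have a6 : ip S (X (t + h) - X t) <= h * ip S V + e / 2 * h.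
  by rewrite innerDr innerNr (innerC _ S) (innerC _ S (X t)) (innerC _ S V) lerBlDl addrA.
apply: le_trans a5 _; rewrite -!addrA lerD2l.
have -> : e * h = e / 2 * h + h * (e / 2) by field.
rewrite addrA; exact: lerD.
Qed.

Lemma contraction_perturb (h e : R) : 0 < h -> 0 <= e -> e * k <= 1 ->
  contraction_nd (fun s => s - e * h * eta (s / h)).
Proof.
move=> h0 e0 ek a b ab.
have abh : a / h <= b / h by rewrite ler_pM2r ?invr_gt0.
have /andP[h1 h2] := slope_lip E abh.
have h3 : 0 <= e * h * (eta (b / h) - eta (a / h)) by rewrite !mulr_ge0// ltW.
have h4 : e * h * (eta (b / h) - eta (a / h)) <= b - a.
  apply: (@le_trans _ _ (e * h * (k * (b / h - a / h)))).
    by rewrite ler_wpM2l// mulr_ge0// ltW.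
  have -> : e * h * (k * (b / h - a / h)) = e * k * (b - a) by field; rewrite gt_eqF.
  by rewrite -[leRHS]mul1r ler_wpM2r// subr_ge0.
apply/andP; split; lra.
Qed.

(** Let [z] be a difference quotient of [X] at [t] and [e = 1 / k]. As
    [s - e eta(s)] is a contraction, [X t + h (z - e eta(z))] is monotone and can be
    tested against [G - V]. In the limit [z = V], and the orthogonality of [G - V] and
    [V] leaves [<G - V, eta(V)> >= 0], which is the claim by convexity. *)
Lemma energy_velocity (X : R -> L2 R) t G V : 0 <= t -> (forall s, 0 <= s -> K (X s)) ->
  rderiv ip X t V -> (forall Z, K Z -> ip (G - V) (Z - X t) <= 0) -> ip (G - V) V = 0 ->
  Energy V <= Energy G.
Proof.
move=> t0 KX dX VI V0.
suff : 0 <= ip (slopeL2 V) (G - V).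
  have := Energy_convex V (G - V); have -> : V + (G - V) = G by vec R (L2 R).
  by move=> h1 h2; apply: le_trans h1; rewrite lerDl.
set W := G - V in VI V0 *.
pose e := k^-1; have e0 : 0 < e by rewrite invr_gt0.
rewrite innerC -(pmulr_rge0 _ e0).
rewrite -oppr_le0; apply: (@eps_ler R) => d d0; rewrite add0r.
pose d1 := d / (2 * (N W + 1)).
have NW1 : 0 < N W + 1 by rewrite ltr_wpDl// snorm_ge0.
have d10 : 0 < d1 by rewrite divr_gt0// mulr_gt0.
have [r r0 rP] := dX d1 d10.
pose h := r / 2; have h0 : 0 < h by rewrite divr_gt0.
have hr : h < r by rewrite /h; lra.
have Nh := rP h h0 hr.
pose z := h^-1 *: (X (t + h) - X t).
have hn0 : h != 0 by rewrite gt_eqF.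
have Nz : N (z - V) <= d1.
  have zE : X (t + h) - X t - h *: V = h *: (z - V).
    by rewrite scalerBr scalerA divff// scale1r.
  by rewrite zE snormZ (gtr0_norm h0) mulrC ler_pM2r in Nh.
have KZ : K (X t + h *: (z - e *: slopeL2 z)).
  apply: (@cone_perturb _ (X t) (X (t + h)) _ (fun s => s - e * h * eta (s / h))).
  - by apply: contraction_perturb => //; [exact: ltW|rewrite mulVf// gt_eqF].
  - exact: KX.
  - by apply: KX; rewrite addr_ge0// ltW.
  apply: nearW => m; have zm : z m = (X (t + h) m - X t m) / h by rewrite L2Z L2B mulrC.
  rewrite L2D (L2Z h) L2B (L2Z e) slopeL2E -zm mulrBr; congr (_ + (_ - _)).
    by rewrite zm mulrC divfK.
  by rewrite mulrA [h * e]mulrC.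
have := VI _ KZ; rewrite addrC addKr innerZr pmulr_rle0// => h1.
have W1 : (N W + 1) * d1 = d / 2 by rewrite /d1; field; rewrite gt_eqF.
have hz : `|ip W z| <= d / 2.
  have -> : ip W z = ip W (z - V) by rewrite innerDr innerNr V0 subr0.
  apply: le_trans (normr_inner_le _ _ _) _; rewrite -W1.
  by apply: ler_pM; rewrite ?snorm_ge0// lerDl.
have hs : `|e * (ip W (slopeL2 z) - ip W (slopeL2 V))| <= d / 2.
  have -> : ip W (slopeL2 z) - ip W (slopeL2 V) = ip W (slopeL2 z - slopeL2 V).
    by rewrite innerDr innerNr.
  have l1 : N (slopeL2 z - slopeL2 V) <= k * d1.
    by apply: le_trans (slopeL2_lip z V) _; rewrite ler_wpM2l// ltW.
  rewrite normrM (gtr0_norm e0) -W1.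
  apply: (@le_trans _ _ (e * (N W * (k * d1)))).
    rewrite ler_wpM2l ?(ltW e0)//; apply: le_trans (normr_inner_le _ _ _) _.
    by rewrite ler_wpM2l ?snorm_ge0.
  have -> : e * (N W * (k * d1)) = N W * d1 by rewrite /e; field; rewrite gt_eqF.
  by rewrite ler_wpM2r ?(ltW d10)// lerDl.
move: h1; rewrite innerDr innerNr (innerZr ip e W (slopeL2 z)) => h1.
move: hz hs; rewrite !ler_norml => /andP[z1 _] /andP[_ z2].
exact: sub_chain h1 z1 z2.
Qed.

End IntegralEnergy.

(** * Growth of an energy along a flow *)

(** The product of [u t] with [exp (- c t)] has nonpositive Dini derivatives. *)
Lemma gronwall_dini (R : realType) (u : R -> R) (c b L : R) : 0 <= b -> 0 <= c -> 0 <= L ->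
  (forall s t, 0 <= s -> s <= t -> t <= b -> u t <= u s + L * (t - s)) ->
  (forall t, 0 <= t -> t < b -> forall e, 0 < e -> exists2 d : R, 0 < d &
     forall h, 0 < h -> h < d -> t + h <= b -> u (t + h) <= u t + h * (c * u t) + e * h) ->
  (forall t, 0 <= t -> t <= b -> 0 <= u t) ->
  u b <= expR (c * b) * u 0.
Proof.
move=> b0 c0 L0 lipu dini u0.
pose g t := expR (- (c * t)) * u t.
have exp1 t : 0 <= t -> expR (- (c * t)) <= 1.
  by move=> t0; rewrite -expR0 ler_expR oppr_le0 mulr_ge0.
suff : g b <= g 0.
  rewrite /g mulr0 oppr0 expR0 mul1r => h.
  have -> : u b = expR (c * b) * (expR (- (c * b)) * u b).
    by rewrite mulrA -expRD subrr expR0 mul1r.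
  by rewrite ler_wpM2l// expR_ge0.
apply: (@dini_nonincreasing _ g 0 b L set0) => //.
- move=> s t s0 st tb; rewrite /g.
  have t0 := le_trans s0 st.
  apply: (@le_trans _ _ (expR (- (c * s)) * u t)).
    by rewrite ler_wpM2r ?u0// ler_expR lerN2 ler_wpM2l.
  apply: (@le_trans _ _ (expR (- (c * s)) * (u s + L * (t - s)))).
    by rewrite ler_wpM2l ?expR_ge0// lipu.
  rewrite mulrDr lerD2l -[leRHS]mul1r ler_wpM2r ?exp1//.
  by rewrite mulr_ge0// subr_ge0.
- exact: negligible_set0.
move=> t t0 tb _ e e0; have [d d0 dP] := dini t t0 tb e e0.
exists d => // h h0 hd thb; have uh := dP h h0 hd thb.
have ut := u0 t t0 (ltW tb).
rewrite /g mulrDr opprD expRD.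
set A := expR (- (c * t)); set B := expR (- (c * h)).
have A0 : 0 <= A by exact: expR_ge0.
have B0 : 0 <= B by exact: expR_ge0.
have A1 : A <= 1 by exact: exp1.
have B1 : B <= 1 by apply: exp1; exact: ltW.
have Bc : B * (1 + h * c) <= 1.
  have := expR_ge1Dx (c * h); rewrite mulrC => h1.
  apply: (@le_trans _ _ (B * expR (c * h))); first by rewrite ler_wpM2l// [c * h]mulrC.
  by rewrite -expRD addNr expR0.
apply: (@le_trans _ _ (A * B * (u t + h * (c * u t) + e * h))).
  by rewrite ler_wpM2l// mulr_ge0.
have -> : A * B * (u t + h * (c * u t) + e * h) =
  A * (B * (1 + h * c)) * u t + (A * B) * (e * h) by ring.
apply: lerD.
  by rewrite -mulrA ler_wpM2l// -[leRHS]mul1r ler_wpM2r.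
rewrite -[leRHS]mul1r ler_wpM2r//; first by rewrite mulr_ge0 ?ltW.
by rewrite mulr_ile1.
Qed.

Lemma half_slope (R : realType) (D x y z a : R) : x + a <= z ->
  z <= D / 2 * (0 + x + y) -> 0 <= x -> 0 <= D * (x + y) -> a <= D * (x + y).
Proof. by move=> *; lra. Qed.

Lemma rate_sum (R : realType) (D kappa x v g f a b : R) : 0 <= D -> 0 <= kappa ->
  0 <= x -> 0 <= g -> a <= D * (x + v) -> b <= D * (g + f) ->
  f <= D / 3 * (kappa + 2 * x) -> v <= g -> a + b <= (2 * D + D * D) * (kappa + x + g).
Proof.
move=> D0 k0 x0 g0 ha hb hf hv.
have h1 : D * (x + v) <= D * (x + g) by rewrite ler_wpM2l// lerD2l.
have h2 : D * (g + f) <= D * (g + D / 3 * (kappa + 2 * x)) by rewrite ler_wpM2l// lerD2l.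
have h3 : 0 <= D * kappa by rewrite mulr_ge0.
have h4 : 0 <= D * x by rewrite mulr_ge0.
have h5 : 0 <= D * D * kappa by rewrite !mulr_ge0.
have h6 : 0 <= D * D * x by rewrite !mulr_ge0.
have h7 : 0 <= D * D * g by rewrite !mulr_ge0.
lra.
Qed.

Lemma sum_lip (R : realType) (kappa x x' g g' L L' d : R) :
  x' <= x + L * d -> g' <= g + L' * d -> kappa + x' + g' <= kappa + x + g + (L + L') * d.
Proof. by move=> *; lra. Qed.

Lemma sum_rates (R : realType) (kappa x x' g g' h a b e : R) :
  x' <= x + h * a + e / 2 * h -> g' <= g + h * b + e / 2 * h ->
  kappa + x' + g' <= kappa + x + g + h * (a + b) + e * h.
Proof. by move=> *; lra. Qed.

Section EnergyFlow.
Variable R : realType.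
Local Notation mu := (leb_Omega R).
Local Notation ip := (@L2_inner R).
Local Notation N := (snorm ip).
Local Notation K := (@monotone_cone R).
Implicit Types U W X Y Z : L2 R.
Variables (F : L2 R -> L2 R) (C Cp : R).
Hypotheses (C0 : 0 <= C) (F_bnd : forall x, K x -> N (F x) <= C * (1 + N x)).
Hypotheses (Cp0 : 0 <= Cp) (F_pw : forall X, K X ->
  \forall m \ae mu, `|F X m| <= Cp * (1 + `|X m| + L1norm X)).
Variables (k : R) (phi eta : R -> R).
Hypotheses (k0 : 0 < k) (E : smooth_energy k phi eta).
Variables (D kappa : R).
(* A sum of two terms is twice their mean, and the bound on the force is [3 * Cp]
   times the mean of three terms: the scaling factor dominates both. *)
Hypotheses (D0 : 0 <= D) (phi_scale : forall r, phi ((3 * Cp + 2) * r) <= D * phi r).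
Hypothesis phi1 : phi 1 <= kappa.

Local Notation Phi := (Energy phi).

Lemma lambda_ge2 : 2 <= 3 * Cp + 2.
Proof. by rewrite lerDr mulr_ge0. Qed.

Lemma L1norm_ge0 U : 0 <= L1norm U.
Proof. by rewrite fine_ge0// Lnorm_ge0. Qed.

(** Integrate the support line of [phi] at the mean of [|U|]. *)
Lemma energy_jensen U : phi (L1norm U) <= Phi U.
Proof.
have [A AE lE] := L1norm_inner U; set l := L1norm U in lE *.
have PA : Phi A <= Phi U.
  by apply: (Energy_ae_le E); apply: nearW => m; apply: (energy_mono E); rewrite AE normr_id.
apply: le_trans PA.
have := Energy_convex k0 E (L2cst l) (A - L2cst l).
have -> : L2cst l + (A - L2cst l) = A by vec R (L2 R).
have -> : Phi (L2cst l) = phi l.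
  rewrite /Energy; under eq_Rintegral do rewrite L2cstE.
  by rewrite Rintegral_cst// leb_OmegaT mulr1.
have -> : ip (slopeL2 eta (L2cst l)) (A - L2cst l) = 0.
  have sE : N (slopeL2 eta (L2cst l) - eta l *: L2cst 1) = 0.
    apply: snorm_ae_eq; apply: nearW => m.
    by rewrite (slopeL2E k0 E) L2Z !L2cstE mulr1.
  have -> : ip (slopeL2 eta (L2cst l)) (A - L2cst l) =
    ip (slopeL2 eta (L2cst l) - eta l *: L2cst 1) (A - L2cst l) +
    eta l * (ip A (L2cst 1) - ip (L2cst l) (L2cst 1)).
    rewrite (innerDl _ (slopeL2 eta (L2cst l))) innerNl innerZl.
    rewrite (innerDr _ (L2cst 1)) innerNr (innerC _ (L2cst 1)) (innerC _ (L2cst 1)).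
    by rewrite subrK.
  have -> : ip (L2cst l) (L2cst 1) = l.
    have -> : ip (L2cst l) (L2cst 1) = (\int[mu]_m (l : R))%R.
      by apply: eq_Rintegral => m _; rewrite !L2cstE mulr1.
    by rewrite Rintegral_cst// leb_OmegaT mulr1.
  rewrite -lE subrr mulr0 addr0.
  have := normr_inner_le ip (slopeL2 eta (L2cst l) - eta l *: L2cst 1) (A - L2cst l).
  by rewrite sE mul0r normr_le0 => /eqP.
by rewrite addr0.
Qed.

Lemma Energy_ae_le2 U X Y (a c : R) : 0 <= a -> 0 <= c ->
  (\forall m \ae mu, phi (U m) <= a * (c + phi (X m) + phi (Y m))) ->
  Phi U <= a * (c + Phi X + Phi Y).
Proof.
move=> a0 c0 h; rewrite -lee_fin EFinM !EFinD !(Energy_intE E).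
have mphi (W : L2 R) : measurable_fun [set: measurableTypeR R] (fun m => (phi (W m))%:E).
  by apply/measurable_EFinP; apply: measurableT_comp; [exact: energy_measurable E|exact: L2_measurable].
have p0 (W : L2 R) m : (0 <= (phi (W m))%:E)%E by rewrite lee_fin (energy_ge0 E).
have -> : (c%:E = \int[mu]_m c%:E)%E.
  by rewrite integral_cst// leb_OmegaT mule1.
rewrite -ge0_integralD//.
rewrite -ge0_integralD//; last 2 first.
- by move=> m _; rewrite adde_ge0.
- exact: emeasurable_funD.
rewrite -ge0_integralZl//; last 2 first.
- by apply: emeasurable_funD => //; exact: emeasurable_funD.
- by move=> m _; rewrite !adde_ge0.
apply: ae_ge0_le_integral => //.
- by move=> m _; rewrite mule_ge0// !adde_ge0.
- by apply: emeasurable_funM => //; apply: emeasurable_funD => //; exact: emeasurable_funD.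
by apply: filterS h => m h _; rewrite -!EFinD -EFinM lee_fin.
Qed.

Lemma energy_force U : K U -> Phi (F U) <= D / 3 * (kappa + 2 * Phi U).
Proof.
move=> KU; apply: (@le_trans _ _ (D / 3 * ((kappa + phi (L1norm U)) + Phi U + Phi 0))).
  apply: Energy_ae_le2; first by rewrite divr_ge0.
    by rewrite addr_ge0// ?(energy_ge0 E)//; exact: le_trans (energy_ge0 E 1) phi1.
  apply: filterS (F_pw KU) => m h; rewrite L2_0 (energy0 E) addr0.
  have cl : Cp * 3 <= 3 * Cp + 2 by rewrite mulrC lerDl.
  apply: le_trans (energy_sum3 E D0 phi_scale Cp0 cl (L1norm_ge0 U) h) _.
  rewrite ler_wpM2l ?divr_ge0//.
  by rewrite addrAC !lerD2r.
have -> : Phi 0 = 0.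
  have := Energy_intE E 0; under eq_integral do rewrite L2_0 (energy0 E).
  by rewrite integral0 => -[].
rewrite addr0 ler_wpM2l ?divr_ge0//.
by have := energy_jensen U; rewrite -addrA lerD2l; lra.
Qed.

(** The support line inequality between [U] and [U + W], and the doubling of
    [energy_sum2]. *)
Lemma energy_slope U W : ip (slopeL2 eta U) W <= D * (Phi U + Phi W).
Proof.
have h := Energy_convex k0 E U W.
have h2 : Phi (U + W) <= D / 2 * (0 + Phi U + Phi W).
  apply: Energy_ae_le2 => //; first by rewrite divr_ge0.
  by apply: nearW => m; rewrite add0r; exact: (energy_sum2 E lambda_ge2 D0 phi_scale).
have h3 := Energy_ge0 E U; have h4 := Energy_ge0 E W.
have h5 : 0 <= D * (Phi U + Phi W) by rewrite mulr_ge0// addr_ge0.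
exact: half_slope h h2 h3 h5.
Qed.

Lemma energy_curve_lip (X : R -> L2 R) T : loc_lip ip X -> 0 <= T -> exists2 M, 0 <= M &
  forall s t, 0 <= s -> s <= t -> t <= T -> Phi (X t) <= Phi (X s) + M * (t - s).
Proof.
move=> lipX T0; have [L L0 LP] := lipX T.
pose B := N (X 0) + L * T.
have LT0 : 0 <= L * T by rewrite mulr_ge0.
have B0 : 0 <= B by rewrite addr_ge0 ?snorm_ge0.
exists ((k * B + k * (L * T)) * L).
  by apply: mulr_ge0 => //; apply: addr_ge0; apply: mulr_ge0 => //; exact: ltW.
move=> s t s0 st tT; apply: le_trans (Energy_lip k0 E (X s) (X t)) _.
have ts0 : 0 <= t - s by rewrite subr_ge0.
have lst := LP s t s0 st tT.
have bs : N (X s) <= B.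
  have := snorm_triangle ip (X 0) (X s) 0; rewrite !subr0 => h; apply: le_trans h _.
  rewrite addrC lerD2l; apply: le_trans (LP 0 s _ _ _) _ => //; first exact: le_trans st tT.
  by rewrite subr0 ler_wpM2l// (le_trans st).
rewrite lerD2l -mulrA; apply: ler_pM => //.
- by apply: addr_ge0; apply: mulr_ge0; rewrite ?snorm_ge0// ltW.
- exact: snorm_ge0.
apply: lerD; apply: ler_wpM2l; rewrite ?(ltW k0)//.
apply: le_trans lst _; rewrite ler_wpM2l//.
by apply: le_trans tT; rewrite gerBl.
Qed.

(** The sum of the energies of [X] and [v0 + J] satisfies a linear differential
    inequality, and it dominates the energy of [V] by [energy_velocity]. *)
Lemma energy_flow x0 v0 (X J V : R -> L2 R) t T : flow F x0 v0 X J ->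
  (forall t, 0 <= t -> [/\ rderiv ip X t (V t),
     forall Z, K Z -> ip (v0 + J t - V t) (Z - X t) <= 0 &
     ip (v0 + J t - V t) (V t) = 0]) ->
  0 <= t -> t <= T ->
  Phi (X t) + Phi (V t) <= expR ((2 * D + D * D) * T) * (kappa + Phi x0 + Phi v0).
Proof.
move=> fl VP t0 tT; have lipG := flow_drift_lip C0 F_bnd fl.
case: fl => [KX lipX X0 FJ ev].
pose G s := v0 + J s; pose u s := kappa + Phi (X s) + Phi (G s).
pose c := 2 * D + D * D.
have kappa0 : 0 <= kappa := le_trans (energy_ge0 E 1) phi1.
have c0 : 0 <= c by rewrite addr_ge0// mulr_ge0.
have P0 W : 0 <= Phi W := Energy_ge0 E W.
have VG s : 0 <= s -> Phi (V s) <= Phi (G s).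
  by move=> s0; have [dV VI V0] := VP s s0; exact: (energy_velocity k0 E s0 KX dV VI V0).
have [LX LX0 LXP] := energy_curve_lip lipX t0.
have [LG LG0 LGP] := energy_curve_lip lipG t0.
have dG s : 0 <= s -> rderiv ip G s (F (X s)).
  by move=> s0; exact: (rderiv_translate v0 (primitive_rderiv FJ s0)).
have ut : u t <= expR (c * t) * u 0.
  apply: (@gronwall_dini _ u c t (LX + LG)) => //; first exact: addr_ge0.
  - move=> s r s0 sr rt; have h1 := LXP s r s0 sr rt; have h2 := LGP s r s0 sr rt.
    exact: sum_lip h1 h2.
  - move=> s s0 st e e0; have e2 : 0 < e / 2 by rewrite divr_gt0.
    have [dV _ _] := VP s s0.
    have [d1 d10 dP1] := energy_rderiv k0 E dV e2.
    have [d2 d20 dP2] := energy_rderiv k0 E (dG s s0) e2.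
    exists (Num.min d1 d2); first by rewrite lt_min d10.
    move=> h h0; rewrite lt_min => /andP[hd1 hd2] _.
    have h1 := dP1 h h0 hd1; have h2 := dP2 h h0 hd2.
    have s1 := energy_slope (X s) (V s); have s2 := energy_slope (G s) (F (X s)).
    have s3 := energy_force (KX s s0); have s4 := VG s s0.
    have s5 : ip (slopeL2 eta (X s)) (V s) + ip (slopeL2 eta (G s)) (F (X s)) <= c * u s.
      by apply: rate_sum s1 s2 s3 s4 => //; exact: P0.
    apply: (@le_trans _ _ (u s + h * (ip (slopeL2 eta (X s)) (V s) + ip (slopeL2 eta (G s)) (F (X s))) + e * h)).
      exact: sum_rates h1 h2.
    by rewrite lerD2r lerD2l ler_wpM2l// ltW.
  - by move=> s s0 st; rewrite /u !addr_ge0.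
have u0E : u 0 = kappa + Phi x0 + Phi v0.
  rewrite /u (Energy_ae_eq E X0) /G; congr (_ + _); apply: (Energy_ae_eq E).
  by rewrite addrC addKr; case: FJ.
apply: (@le_trans _ _ (u t)).
  rewrite /u -addrA ler_wpDl// lerD2l; exact: VG.
apply: le_trans ut _; rewrite u0E ler_wpM2r ?ler_expR ?ler_wpM2l//.
by rewrite !addr_ge0.
Qed.

End EnergyFlow.

(** * Moreau regularization *)

Section Moreau.
Variables (R : realType) (psi : R -> R).
Hypothesis adm : admissible_energy psi.
Local Notation g := (derive1 psi).
Implicit Types (r x y a b e n : R).

Lemma admissible_ge0 r : 0 <= psi r. Proof. by have [h _ _ _ _] := adm. Qed.
Lemma admissible_even r : psi (- r) = psi r. Proof. by have [_ h _ _ _] := adm. Qed.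
Lemma admissible0 : psi 0 = 0. Proof. by have [_ _ _ _ h] := adm. Qed.
Lemma admissible_derivable r : derivable psi r 1. Proof. by have [_ _ _ [h _] _] := adm. Qed.
Lemma admissible_slope_continuous : continuous g. Proof. by have [_ _ _ [_ h] _] := adm. Qed.

Lemma admissible_continuous : continuous psi.
Proof.
move=> r; apply: differentiable_continuous; apply/derivable1_diffP.
exact: admissible_derivable.
Qed.

(** Differentiability as a first order expansion, at all increments including
    zero. *)
Lemma admissible_expansion x e : 0 < e -> exists2 d : R, 0 < d &
  forall h, `|h| < d -> `|psi (x + h) - psi x - g x * h| <= e * `|h|.
Proof.
move=> e0; have := @admissible_derivable x.
move=> /cvg_ex[l hl].
have gl : g x = l by rewrite derive1E; apply: cvg_lim hl.
move/cvgrPdist_le : hl => /(_ e e0) [d /= d0 dP].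
exists d => // h hd; have [->|h0] := eqVneq h 0.
  by rewrite addr0 mulr0 subrr subr0 normr0 mulr0.
have hd0 : ball_ Num.Def.normr 0 d h by rewrite /ball_/= sub0r normrN.
have := dP h hd0 h0.
rewrite gl /= -[h *: 1]/(h * 1) mulr1 [h + x]addrC => h1.
have -> : psi (x + h) - psi x - l * h = - ((l - h^-1 * (psi (x + h) - psi x)) * h).
  by field.
by rewrite normrN normrM ler_wpM2r.
Qed.

Lemma admissible_convex x y a : 0 <= a <= 1 ->
  psi (a * x + (1 - a) * y) <= a * psi x + (1 - a) * psi y.
Proof.
move=> /andP[a0 a1]; have [_ _ cvx _ _] := adm.
pose t : {i01 R} := Itv01 a0 a1.
have := cvx t x y; rewrite !in_setT => /(_ isT isT).
by rewrite /conv/=.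
Qed.

(** Convexity on the segment from [x] to [y], divided by the length of a step
    that tends to zero. *)
Lemma admissible_gradient x y : g x * (y - x) <= psi y - psi x.
Proof.
apply: eps_ler => e e0.
have [->|xy] := eqVneq y x; first by rewrite !subrr mulr0 add0r ltW.
have n0 : 0 < `|y - x| by rewrite normr_gt0 subr_eq0.
have [d d0 dP] := admissible_expansion x (divr_gt0 e0 n0).
pose a := Num.min 1 (d / 2 / `|y - x|).
have a0 : 0 < a by rewrite lt_min ltr01 !divr_gt0.
have a1 : a <= 1 by rewrite ge_min lexx.
have ad : `|a * (y - x)| < d.
  rewrite normrM (gtr0_norm a0) -ltr_pdivlMr//.
  have : a <= d / 2 / `|y - x| by rewrite ge_min lexx orbT.
  have : 0 < d / `|y - x| by rewrite divr_gt0.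
  have -> : d / 2 / `|y - x| = d / `|y - x| / 2 by rewrite mulrAC.
  lra.
have h1 := dP _ ad.
have h2 : psi (x + a * (y - x)) <= a * psi y + (1 - a) * psi x.
  have -> : x + a * (y - x) = a * y + (1 - a) * x by ring.
  by apply: admissible_convex; rewrite (ltW a0).
rewrite normrM (gtr0_norm a0) in h1.
have h3 : e / `|y - x| * (a * `|y - x|) = a * e by field; rewrite gt_eqF.
rewrite h3 in h1; move: h1; rewrite ler_norml => /andP[h1 _].
rewrite -(ler_pM2l a0).
move: h1 h2; set p := psi (x + _) => h1 h2; lra.
Qed.

Lemma admissible_slope_mono a b : a <= b -> g a <= g b.
Proof.
rewrite le_eqVlt => /predU1P[->//|ab].
have h1 := admissible_gradient a b; have h2 := admissible_gradient b a.
have ba : 0 < b - a by rewrite subr_gt0.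
by rewrite -subr_ge0 -(pmulr_lge0 _ ba); lra.
Qed.

Lemma admissible_slope0 : g 0 = 0.
Proof.
have h1 := admissible_gradient 0 1; have h2 := admissible_gradient 0 (-1).
suff h e : 0 < e -> `|g 0| <= e.
  by apply/eqP; rewrite -normr_le0; apply/ler_addgt0Pr => e /h; rewrite add0r.
move=> e0; have [d d0 dP] := admissible_expansion 0 e0.
have d2 : 0 < d / 2 by rewrite divr_gt0.
have n2 : `|d / 2| < d by rewrite gtr0_norm//; lra.
have := dP _ n2; have n3 : `|- (d / 2)| < d by rewrite normrN.
have := dP _ n3; rewrite !add0r admissible_even admissible0 !subr0 normrN (gtr0_norm d2).
rewrite !ler_norml => /andP[_ k1] /andP[k2 k3].
have p0 := admissible_ge0 (d / 2).
rewrite -(ler_pM2r d2) -[X in _ && X](ler_pM2r d2).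
by apply/andP; split; lra.
Qed.

Variable k : R.
Hypothesis k0 : 0 < k.

Lemma prox_exists r : exists p, p + g p / k = r /\ `|p| <= `|r|.
Proof.
pose f y := y + g y / k.
have cf : continuous f.
  move=> y; apply: cvgD; first exact: cvg_id.
  by apply: cvgMl; exact: admissible_slope_continuous.
have ki : 0 < k^-1 by rewrite invr_gt0.
have f0 : f 0 = 0 by rewrite /f admissible_slope0 mul0r addr0.
have [r0|/ltW r0] := leP 0 r.
  have gr : 0 <= g r / k.
    by have := admissible_slope_mono r0; rewrite admissible_slope0 => h; rewrite mulr_ge0// ltW.
  have [||p] := @IVT R f 0 r r r0; first exact: continuous_subspaceT.
    by rewrite f0 ge_min r0/= le_max /f lerDl gr orbT.
  rewrite in_itv/= => /andP[p0 pr] fp; exists p; split => //.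
  by rewrite !ger0_norm.
have gr : g r / k <= 0.
  by have := admissible_slope_mono r0; rewrite admissible_slope0 => h; rewrite pmulr_lle0.
have [||p] := @IVT R f r 0 r r0; first exact: continuous_subspaceT.
  by rewrite f0 ge_min /f gerDl gr/= le_max r0 orbT.
rewrite in_itv/= => /andP[p0 pr] fp; exists p; split => //.
by rewrite !ler0_norm// lerN2.
Qed.

(** The point where the infimum of [psi y + k / 2 (r - y)^2] is attained. *)
Definition prox r := xget 0 [set p | p + g p / k = r /\ `|p| <= `|r|].

Lemma proxP r : prox r + g (prox r) / k = r /\ `|prox r| <= `|r|.
Proof. by have [p pP] := prox_exists r; rewrite /prox; case: xgetP => [_ -> //|/(_ p)]. Qed.

(** The value of that infimum, as [r - prox r = psi'(prox r) / k]. *)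
Definition moreau r := psi (prox r) + g (prox r) ^+ 2 / (2 * k).
Definition moreau_slope r := g (prox r).

Lemma moreau_slopeE r : moreau_slope r = k * (r - prox r).
Proof.
rewrite /moreau_slope; have [h _] := proxP r.
have -> : r - prox r = g (prox r) / k by move: h; set p := prox r; lra.
by rewrite mulrC divfK// gt_eqF.
Qed.

Lemma prox_mono a b : a <= b -> prox a <= prox b.
Proof.
move=> ab; rewrite leNgt; apply/negP => h.
have := admissible_slope_mono (ltW h).
have : 0 < k^-1 by rewrite invr_gt0.
have [ha _] := proxP a; have [hb _] := proxP b.
move=> ki /(ler_wpM2r (ltW ki)); lra.
Qed.

Lemma moreau_le_penalty r y : moreau r <= psi y + k / 2 * (r - y) ^+ 2.
Proof.
have h := admissible_gradient (prox r) y; have sE := moreau_slopeE r.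
rewrite /moreau -/(moreau_slope r); rewrite -/(moreau_slope r) in h.
set p := prox r in h sE *; set G := moreau_slope r in h sE *.
have -> : G ^+ 2 / (2 * k) = k / 2 * (r - p) ^+ 2 by rewrite sE; field; rewrite gt_eqF.
have h2 : 0 <= k / 2 * (y - p) ^+ 2 by rewrite mulr_ge0 ?sqr_ge0// divr_ge0// ltW.
have h3 : k / 2 * (r - y) ^+ 2 = k / 2 * (r - p) ^+ 2 - G * (y - p) + k / 2 * (y - p) ^+ 2.
  by rewrite sE; field.
rewrite h3; lra.
Qed.

Lemma moreauE r : moreau r = psi (prox r) + k / 2 * (r - prox r) ^+ 2.
Proof.
rewrite /moreau -/(moreau_slope r) moreau_slopeE; congr (_ + _).
by field; rewrite gt_eqF.
Qed.

Lemma moreau_le r : moreau r <= psi r.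
Proof. by have := moreau_le_penalty r r; rewrite subrr expr0n mulr0 addr0. Qed.

Lemma moreau_even r : moreau (- r) = moreau r.
Proof.
suff h x : moreau (- x) <= moreau x.
  by apply/le_anti; rewrite h -{1}(opprK r) h.
have := moreau_le_penalty (- x) (- prox x); rewrite admissible_even.
have -> : (- x - - prox x) ^+ 2 = (x - prox x) ^+ 2 by ring.
by rewrite -moreauE.
Qed.

(** Scaling the minimizer costs a factor [D] in [psi] and [lambda^2] in the
    quadratic term, whatever [k]. *)
Lemma moreau_scale D lambda : 1 <= D -> (forall r, psi (lambda * r) <= D * psi r) ->
  forall r, moreau (lambda * r) <= (D + lambda ^+ 2) * moreau r.
Proof.
move=> D1 sc r; apply: le_trans (moreau_le_penalty _ (lambda * prox r)) _.
rewrite moreauE -mulrBr exprMn.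
set q := (r - prox r) ^+ 2; have q0 : 0 <= q by exact: sqr_ge0.
have kq : 0 <= k / 2 * q by rewrite mulr_ge0// divr_ge0// ltW.
have h1 := sc (prox r); have h2 := admissible_ge0 (prox r).
have h3 : 0 <= lambda ^+ 2 * psi (prox r) by rewrite mulr_ge0// sqr_ge0.
have h4 : 0 <= D * (k / 2 * q) by rewrite mulr_ge0// (le_trans ler01).
lra.
Qed.

Lemma moreau_smooth : smooth_energy k moreau moreau_slope.
Proof.
have mp : measurable_fun [set: R] prox by apply: nondecreasing_measurable => // a b; exact: prox_mono.
have ki : 0 < k^-1 by rewrite invr_gt0.
split.
- by move=> r; rewrite addr_ge0 ?admissible_ge0// divr_ge0 ?sqr_ge0// mulr_ge0// ltW.
- exact: moreau_even.
- apply/le_anti/andP; split; first by have := moreau_le 0; rewrite admissible0.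
  by rewrite addr_ge0 ?admissible_ge0// divr_ge0 ?sqr_ge0// mulr_ge0// ltW.
- have -> : moreau = (fun r => psi (prox r) + k / 2 * (r - prox r) ^+ 2).
    by apply/funext => r; exact: moreauE.
  apply: measurable_funD.
    apply: measurableT_comp mp; apply: continuous_measurable_fun; exact: admissible_continuous.
  apply: measurable_funM => //; apply: measurable_funX.
  exact: measurable_funB.
- have [_] := proxP 0; rewrite normr0 normr_le0 => /eqP p0.
  by rewrite /moreau_slope p0 admissible_slope0.
- move=> a b ab; have pab := prox_mono ab; rewrite subr_ge0 admissible_slope_mono//=.
  rewrite -!/(moreau_slope _) !moreau_slopeE -mulrBr ler_wpM2l ?(ltW k0)//; lra.
move=> a b; rewrite /moreau.
have h := admissible_gradient (prox a) (prox b).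
have [ha _] := proxP a; have [hb _] := proxP b.
set p := prox a in h ha *; set q := prox b in h hb *.
have -> : b - a = (q - p) + (g q - g p) / k by rewrite -ha -hb; ring.
have h2 : 0 <= (g q - g p) ^+ 2 / (2 * k) by rewrite divr_ge0 ?sqr_ge0// mulr_ge0// ltW.
have h3 : (g q - g p) ^+ 2 / (2 * k) = g q ^+ 2 / (2 * k) - g p ^+ 2 / (2 * k) - g p * ((g q - g p) / k).
  by field; rewrite gt_eqF.
rewrite /moreau_slope -/p mulrDr; lra.
Qed.

Lemma moreau_close r : psi r - g r ^+ 2 / (2 * k) <= moreau r.
Proof.
rewrite moreauE; have h := admissible_gradient r (prox r).
have h2 : 0 <= (g r - k * (r - prox r)) ^+ 2 / (2 * k).
  by rewrite divr_ge0 ?sqr_ge0// mulr_ge0// ltW.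
have h3 : (g r - k * (r - prox r)) ^+ 2 / (2 * k) =
    g r ^+ 2 / (2 * k) - g r * (r - prox r) + k / 2 * (r - prox r) ^+ 2.
  by field; rewrite gt_eqF.
rewrite h3 in h2; lra.
Qed.

End Moreau.

Section MoreauLimit.
Variables (R : realType) (psi : R -> R).
Hypothesis adm : admissible_energy psi.

Lemma moreau_cvg r : moreau psi n.+1%:R r @[n --> \oo] --> psi r.
Proof.
have k0 (n : nat) : 0 < n.+1%:R :> R by [].
apply: (@squeeze_cvgr _ _ _ _ (fun n : nat => psi r - (derive1 psi r ^+ 2 / 2) * n.+1%:R^-1) (fun=> psi r)).
- apply: nearW => n; rewrite moreau_le// andbT.
  have -> : derive1 psi r ^+ 2 / 2 / n.+1%:R = derive1 psi r ^+ 2 / (2 * n.+1%:R).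
    by rewrite invfM mulrA.
  exact: moreau_close.
- rewrite -[X in _ --> X]subr0 -(mulr0 (derive1 psi r ^+ 2 / 2)).
  by apply: cvgB; [exact: cvg_cst|apply: cvgMr; exact: cvg_harmonic].
- exact: cvg_cst.
Qed.

End MoreauLimit.

(** * Solutions and their estimates *)

Section Hypotheses.
Variables (R : realType) (F : L2 R -> L2 R).
Local Notation ip := (@L2_inner R).
Local Notation N := (snorm ip).
Local Notation K := (@monotone_cone R).

Lemma modulus_small (w : R -> R) e : modulus_of_continuity w -> 0 < e ->
  exists2 d : R, 0 < d & forall r, 0 <= r -> r <= d -> w r <= e.
Proof.
move=> [w0 _ wc w00 _] e0.
have [_ /cvgrPdist_le /(_ e e0)] := (continuous_within_itvcyP _ _).1 wc.
move=> [d /= d0 dP]; exists (d / 2); first by rewrite divr_gt0.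
move=> r; rewrite le_eqVlt => /predU1P[<- _|r0 rd]; first by rewrite w00 ltW.
have rd' : ball_ Num.Def.normr 0 d r.
  by rewrite /ball_/= sub0r normrN gtr0_norm//; lra.
have := dP r rd' r0; rewrite w00 sub0r normrN; apply: le_trans; exact: ler_norm.
Qed.

Lemma force_linear_growth : uniformly_continuous_force F ->
  exists2 C, 0 <= C & forall X, K X -> N (F X) <= C * (1 + N X).
Proof.
move=> [[C C0 FC] _]; exists C => // X KX; rewrite -!L2normE; exact: FC.
Qed.

Lemma force_uniform_continuity : uniformly_continuous_force F ->
  forall e, 0 < e -> exists2 d : R, 0 < d &
  forall X Y, K X -> K Y -> N (X - Y) <= d -> N (F X - F Y) <= e.
Proof.
move=> [_ [w wm Fw]] e e0; have [d d0 dP] := modulus_small wm e0.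
exists d => // X Y KX KY XY; rewrite -L2normE; apply: le_trans (Fw X Y KX KY) _.
by apply: dP; rewrite L2normE// snorm_ge0.
Qed.

End Hypotheses.

Section Estimates.
Variable R : realType.
Local Notation mu := (leb_Omega R).
Local Notation ip := (@L2_inner R).
Local Notation N := (snorm ip).
Implicit Types U W X V : L2 R.

Lemma square_energy : smooth_energy (2 : R) (fun r => r ^+ 2) (fun r => 2 * r).
Proof.
split.
- by move=> r; exact: sqr_ge0.
- by move=> r; rewrite sqrrN.
- by rewrite expr0n.
- exact: measurable_funX.
- by rewrite mulr0.
- by move=> a b ab; rewrite -mulrBr lexx andbT mulr_ge0// subr_ge0.
move=> a b; rewrite -subr_ge0.
have -> : b ^+ 2 - a ^+ 2 - 2 * a * (b - a) = (b - a) ^+ 2 by ring.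
exact: sqr_ge0.
Qed.

Lemma Energy_square U : Energy (fun r => r ^+ 2) U = N U ^+ 2.
Proof. by apply: EFin_inj; rewrite (Energy_intE square_energy) sqr_snorm_intE. Qed.

Lemma sum_of_squares (a b x v E : R) : 0 <= a -> 0 <= b -> 0 <= x -> 0 <= v -> 0 <= E ->
  a ^+ 2 + b ^+ 2 <= E * (1 + x ^+ 2 + v ^+ 2) -> a + b <= (2 * E + 1) * (1 + x + v).
Proof.
move=> a0 b0 x0 v0 E0 h.
have s0 : 0 <= 1 + x + v by rewrite !addr_ge0.
have e0 : 0 <= 2 * E + 1 by rewrite addr_ge0// mulr_ge0.
rewrite -(@ler_pXn2r _ 2)// ?nnegrE ?addr_ge0 ?mulr_ge0//.
apply: (@le_trans _ _ (2 * (a ^+ 2 + b ^+ 2))).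
  by have := sqr_ge0 (a - b); lra.
apply: (@le_trans _ _ (2 * (E * (1 + x ^+ 2 + v ^+ 2)))); first by rewrite ler_wpM2l.
rewrite exprMn mulrA; apply: ler_pM; rewrite ?mulr_ge0 ?addr_ge0 ?sqr_ge0//.
  by have := mulr_ge0 E0 E0; lra.
have := mulr_ge0 x0 v0; lra.
Qed.

Lemma absorb_constant (a : R) (x v : \bar R) : 0 <= a -> (0 <= x)%E -> (0 <= v)%E ->
  (a%:E + x + v <= (1 + a)%:E * (1 + x + v))%E.
Proof.
move=> a0 x0 v0; have s0 : (0 <= 1 + x + v)%E by rewrite !adde_ge0.
have a0' : (0 <= a%:E)%E by rewrite lee_fin.
rewrite EFinD ge0_muleDl// mul1e -addeA addeC; apply: leeD.
  by rewrite -addeA leeDr.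
rewrite -[leLHS]mule1; apply: lee_pmul => //.
by rewrite -addeA leeDl// adde_ge0.
Qed.

Variable psi : R -> R.
Hypothesis adm : admissible_energy psi.

Lemma Psi_measurable U : measurable_fun [set: measurableTypeR R] (fun m => (psi (U m))%:E).
Proof.
apply/measurable_EFinP; apply: measurableT_comp; last exact: L2_measurable.
apply: continuous_measurable_fun; exact: admissible_continuous.
Qed.

Lemma Psi_ge0 U : (0 <= Psi psi U)%E.
Proof. by apply: integral_ge0 => m _; rewrite lee_fin admissible_ge0. Qed.

Lemma moreau_Energy_le n U : ((Energy (moreau psi n.+1%:R) U)%:E <= Psi psi U)%E.
Proof.
have k0 : 0 < n.+1%:R :> R by [].
have sm := moreau_smooth adm k0.
rewrite (Energy_intE sm); apply: ge0_le_integral => //.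
- by move=> m _; rewrite lee_fin (energy_ge0 sm).
- apply/measurable_EFinP; apply: measurableT_comp; [exact: energy_measurable sm|exact: L2_measurable].
- exact: Psi_measurable.
by move=> m _; rewrite lee_fin moreau_le.
Qed.

(** Fatou's lemma, since the regularizations converge pointwise. *)
Lemma Psi_of_moreau X V (B : \bar R) :
  (forall n, ((Energy (moreau psi n.+1%:R) X + Energy (moreau psi n.+1%:R) V)%:E <= B)%E) ->
  (Psi psi X + Psi psi V <= B)%E.
Proof.
move=> h; have k0 (n : nat) : 0 < n.+1%:R :> R by [].
have sm n := moreau_smooth adm (k0 n).
pose f n m := (moreau psi n.+1%:R (X m) + moreau psi n.+1%:R (V m))%:E.
have mm n (U : L2 R) : measurable_fun [set: measurableTypeR R] (fun m => moreau psi n.+1%:R (U m)).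
  apply: measurableT_comp; [exact: energy_measurable (sm n)|exact: L2_measurable].
have mf n : measurable_fun [set: measurableTypeR R] (f n).
  by apply/measurable_EFinP; exact: measurable_funD.
have f0 n m : [set: measurableTypeR R] m -> (0 <= f n m)%E.
  by move=> _; rewrite lee_fin addr_ge0// (energy_ge0 (sm n)).
rewrite /Psi -ge0_integralD//; last 4 first.
- by move=> m _; rewrite lee_fin admissible_ge0.
- exact: Psi_measurable.
- by move=> m _; rewrite lee_fin admissible_ge0.
- exact: Psi_measurable.
have -> : (\int[mu]_m ((psi (X m))%:E + (psi (V m))%:E) = \int[mu]_m limn_einf (f ^~ m))%E.
  apply: eq_integral => m _; apply/esym.
  have fc : f n m @[n --> \oo] --> ((psi (X m))%:E + (psi (V m))%:E)%E.
    rewrite -EFinD; apply: cvg_EFin; first exact: nearW.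
    by apply: cvgD; exact: moreau_cvg.
  rewrite is_cvg_limn_einfE; first exact: cvg_lim fc.
  by apply/cvg_ex; eexists; exact: fc.
apply: le_trans (fatou mu measurableT mf f0) _.
apply: (@limn_einf_le _ _ _ 0%N) => n _.
have fE : (\int[mu]_m f n m = (Energy (moreau psi n.+1%:R) X + Energy (moreau psi n.+1%:R) V)%:E)%E.
  apply: etrans (congr2 adde (esym (Energy_intE (sm n) X)) (esym (Energy_intE (sm n) V))).
  apply: (@ge0_integralD _ _ R mu _ measurableT (fun m => (moreau psi n.+1%:R (X m))%:E)
    (fun m => (moreau psi n.+1%:R (V m))%:E)).
  - by move=> m _; rewrite lee_fin (energy_ge0 (sm n)).
  - by apply/measurable_EFinP; exact: mm.
  - by move=> m _; rewrite lee_fin (energy_ge0 (sm n)).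
  - by apply/measurable_EFinP; exact: mm.
by rewrite fE.
Qed.

End Estimates.

Theorem theorem3p13 (R : realType) (F : L2 R -> L2 R)
    (F_bounded : pointwise_linearly_bounded F)
    (F_continuous : uniformly_continuous_force F) :
  [/\ forall Xbar Vbar : L2 R, monotone_cone Xbar ->
        exists X : R -> L2 R, lagrangian_solution F Xbar Vbar X,
      forall T : R, 0 <= T ->
        exists2 C : R, 0 <= C &
        forall (Xbar Vbar : L2 R) (X : R -> L2 R), monotone_cone Xbar ->
        lagrangian_solution F Xbar Vbar X ->
        exists2 V : R -> L2 R, is_velocity X V &
        forall t : R, 0 <= t <= T ->
          L2norm (X t) + L2norm (V t) <= C * (1 + L2norm Xbar + L2norm Vbar)
    & forall (psi : R -> R) (q : R), admissible_energy psi -> 1 <= q ->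
        (forall r lambda : R, 1 <= lambda ->
           psi (lambda * r) <= lambda `^ q * psi r) ->
        forall T : R, 0 <= T ->
        exists2 C : R, 0 <= C &
        forall (Xbar Vbar : L2 R) (X : R -> L2 R), monotone_cone Xbar ->
        lagrangian_solution F Xbar Vbar X ->
        exists2 V : R -> L2 R, is_velocity X V &
        forall t : R, 0 <= t <= T ->
          (Psi psi (X t) + Psi psi (V t) <=
             C%:E * (1 + Psi psi Xbar + Psi psi Vbar))%E].
Proof.
have [C C0 F_bnd] := force_linear_growth F_continuous.
have F_ucont := force_uniform_continuity F_continuous.
have [Cp Cp0 F_pw] := F_bounded.
have velocity Xbar Vbar X : lagrangian_solution F Xbar Vbar X ->
    exists J V, [/\ flow F Xbar Vbar X J, is_velocity X V & forall t, 0 <= t ->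
      [/\ rderiv (@L2_inner R) X t (V t), forall Z, monotone_cone Z ->
          L2_inner R (Vbar + J t - V t) (Z - X t) <= 0 &
          L2_inner R (Vbar + J t - V t) (V t) = 0]].
  move=> sol; have [J fl] := lagrangian_flow C0 F_bnd F_ucont sol.
  have [V VP] := flow_velocity C0 F_bnd fl.
  exists J, V; split => // t t0; apply: right_derivative_rderiv.
  by have [] := VP t t0.
have lam1 : 1 <= 3 * Cp + 2 by have := lambda_ge2 Cp0; lra.
split.
- move=> Xbar Vbar KX.
  have [X [J fl]] : exists X J, flow F Xbar Vbar X J := flow_exists F_bounded C0 F_bnd F_ucont Vbar KX.
  by exists X; exact: (flow_lagrangian C0 F_bnd F_ucont fl).
- move=> T T0; pose D := (3 * Cp + 2) ^+ 2.
  have D0 : 0 <= D by exact: sqr_ge0.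
  set E := expR ((2 * D + D * D) * T).
  exists (2 * E + 1); first by rewrite addr_ge0// mulr_ge0// expR_ge0.
  move=> Xbar Vbar X KX /velocity[J [V [fl VX VP]]]; exists V => // t /andP[t0 tT].
  rewrite !L2normE; apply: sum_of_squares; rewrite ?snorm_ge0 ?expR_ge0//.
  rewrite -!Energy_square.
  apply: (energy_flow C0 F_bnd Cp0 F_pw _ (square_energy R) D0 _ _ fl VP t0 tT) => //.
  - by move=> r; rewrite exprMn.
move=> psi q adm q1 sc T T0.
pose lam := 3 * Cp + 2; pose D1 := lam `^ q; pose D := D1 + lam ^+ 2.
have D11 : 1 <= D1.
  have := @ge0_ler_powR R q (le_trans ler01 q1) 1 lam.
  by rewrite !nnegrE powR1 ler01 (le_trans ler01 lam1); apply.
have D0 : 0 <= D by rewrite addr_ge0 ?sqr_ge0// (le_trans _ D11).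
set E := expR ((2 * D + D * D) * T).
have E0 : 0 < E by exact: expR_gt0.
have p1 : 0 <= psi 1 := admissible_ge0 adm 1.
exists (E * (1 + psi 1)); first by rewrite mulr_ge0 ?addr_ge0// ltW.
move=> Xbar Vbar X KX /velocity[J [V [fl VX VP]]]; exists V => // t /andP[t0 tT].
apply: Psi_of_moreau => // n.
have k0 : 0 < n.+1%:R :> R by [].
have sm := moreau_smooth adm k0.
have := energy_flow C0 F_bnd Cp0 F_pw k0 sm D0
  (moreau_scale adm k0 D11 (fun r => sc r lam lam1)) (moreau_le adm k0 1) fl VP t0 tT.
rewrite -/E -lee_fin => h; apply: le_trans h _.
rewrite EFinM !EFinD; apply: (@le_trans _ _ (E%:E * ((psi 1)%:E + Psi psi Xbar + Psi psi Vbar))%E).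
  rewrite lee_pmul2l// !leeD// ?moreau_Energy_le//.
rewrite EFinM -muleA lee_pmul2l//; apply: absorb_constant => //; exact: Psi_ge0.
Qed.
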